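(* Let $(\gamma_n)_{n\in\mathbb{N}}$ be a Lie series in $\mathcal{D}$ such that $\gamma_n\in\mathcal{P}_n$ for all odd $n$. Then $$\Big\{\tfrac1{q?}\gamma_q\ \Big|\ q\in\mathbb{N}^*\text{ odd}\Big\}$$ is a linear basis of $\mathcal{P}$ consisting of idempotents (for the inner product), and $\gamma$ yields, by restriction, an isomorphism of algebras $A(\mathbb{N}_{odd})\to(\mathcal{P},\star)$. Furthermore, the primitive Lie algebra of $(\mathcal{P},\star,\downarrow)$ is $$\mathsf{Prim}(\mathcal{P})=\bigoplus_{n\ge1}\gamma_n\mathcal{P}_n.$$ This Lie algebra is free, freely generated by the elements $\gamma_n$, $n\in\mathbb{N}_{odd}$, and $\mathcal{P}$ is its enveloping algebra. The dimension of the $n$-th homogeneous component $\gamma_n\mathcal{P}_n$ of $\mathsf{Prim}(\mathcal{P})$ is equal to the number of Lyndon words $q\in\mathbb{N}^*$ that are odd compositions of $n$.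
   Context: $K$ is a field of characteristic $0$. Permutations act on the right ($i\pi$ is the image of $i$) and products in $S_n$ are read from left to right. For $\pi\in S_n$: $\mathrm{Des}(\pi)=\{1\le i\le n-1\mid i\pi>(i+1)\pi\}$, $\mathrm{Peak}(\pi)=\{2\le i\le n-1\mid (i-1)\pi<i\pi>(i+1)\pi\}$. For $D\subseteq\{1,\ldots,n-1\}$ let $\Delta^D=\sum_{\mathrm{Des}(\pi)=D}\pi$ and $\Xi^D=\sum_{E\subseteq D}\Delta^E$; $\mathcal{D}_n$ is the span of the $\Delta^D$ (a subalgebra of $KS_n$) and $\mathcal{D}=\bigoplus_{n\ge0}\mathcal{D}_n$. $\mathbb{N}^*$ is the free monoid over the positive integers $\mathbb{N}$, with concatenation $q.r$; $q=q_1.\cdots.q_k$ is a composition of $n$ if its sum is $n$, and is odd if all $q_i$ are odd. $D(q)=\{q_1,q_1+q_2,\ldots,q_1+\cdots+q_{k-1}\}$, $\Delta^q=\Delta^{D(q)}$, $\Xi^q=\Xi^{D(q)}$. The Hopf algebra $(\mathcal{D},\star,\downarrow)$ is given by $\Xi^r\star\Xi^q=\Xi^{r.q}$ and the algebra homomorphism $\downarrow$ with $\Xi^n\!\downarrow=\sum_{k=0}^n\Xi^k\otimes\Xi^{n-k}$ ($\Xi^0$ the empty permutation, the identity of $(\mathcal{D},\star)$). The inner product is the product of $KS_n$ in each degree. $\mathcal{P}_n\subseteq\mathcal{D}_n$ is the span of the elements $\sum_{\mathrm{Peak}(\pi)=P}\pi$, $P\subseteq\{2,\ldots,n-1\}$,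 and $\mathcal{P}=\bigoplus_{n\ge0}\mathcal{P}_n$, which is a Hopf subalgebra of $(\mathcal{D},\star,\downarrow)$. Products such as $\gamma_n\mathcal{P}_n$ are taken in $KS_n$. Let $\omega_n=\sum_{k=0}^{n-1}(-1)^k\Delta^{1^{.k}.(n-k)}$, where $1^{.k}$ is the word $1.1.\cdots.1$ of length $k$. An idempotent $\alpha\in KS_n$ is a Lie idempotent if $\alpha KS_n=\omega_nKS_n$. A Lie series in $\mathcal{D}$ is a map $\gamma:\mathbb{N}\to\mathcal{D}$, $n\mapsto\gamma_n\in\mathcal{D}_n$, such that $\frac1n\gamma_n$ is a Lie idempotent for all $n\in\mathbb{N}$. For $q=q_1.\cdots.q_k$ put $\gamma_q=\gamma_{q_1}\star\cdots\star\gamma_{q_k}$, and $q?=\prod_{i\ge1}a_i!\,i^{a_i}$, where $a_i$ is the multiplicity of $i$ in $q$. $A(\mathbb{N})$ is the free associative algebra over the alphabet $\mathbb{N}$, i.e. the semigroup algebra of $\mathbb{N}^*$ over $K$; $\gamma$ extends to the algebra homomorphism $A(\mathbb{N})\to(\mathcal{D},\star)$, $\sum_qk_qq\mapsto\sum_qk_q\gamma_q$ (known to be an isomorphism). $\mathbb{N}_{odd}$ is the set of odd positive integers, and $A(\mathbb{N}_{odd})\subseteq A(\mathbb{N})$. For a bialgebra $B$ with coproduct $\delta$, $\mathsf{Prim}(B)$ is the Lie algebra (under commutators) of elements $b$ with $b\delta=b\otimes1+1\otimes b$. A word is Lyndon if it is nonempty and lexicographically strictly smaller than each of its proper nonempty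 suffixes. *)

(* Defs.v *)
From HB Require Import structures.
From mathcomp Require Import all_boot all_order all_algebra all_fingroup.
From mathcomp Require Import finmap monalg zify.
From mathcomp Require classical_sets.

Set Implicit Arguments.
Unset Strict Implicit.
Unset Printing Implicit Defensive.

Import GRing.Theory.

Local Open Scope ring_scope.

(** * Linear algebra relative to subspaces given as predicates *)

Section LinearAlgebra.
Variables (K : fieldType) (V : lmodType K).

(* The linear map K[J] -> V extending [b : J -> V]. *)
Definition mlin (J : choiceType) (b : J -> V) (c : {malg K[J]}) : V :=
  \sum_(j <- msupp c) c@_j *: b j.

Definition supported (J : choiceType) (Q : pred J) (c : {malg K[J]}) : Prop :=
  {subset msupp c <= Q}.

Definition spanned (J : choiceType) (Q : pred J) (b : J -> V) (x : V) : Prop :=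
  exists2 c, supported Q c & x = mlin b c.

Definition free_family (J : choiceType) (Q : pred J) (b : J -> V) : Prop :=
  forall c, supported Q c -> mlin b c = 0 -> c = 0.

Definition is_basis (W : V -> Prop) (J : choiceType) (Q : pred J)
    (b : J -> V) : Prop :=
  (forall x, W x <-> spanned Q b x) /\ free_family Q b.

Definition has_dim (W : V -> Prop) (d : nat) : Prop :=
  exists b : 'I_d -> V, is_basis W predT b.

Definition sum_of (I : choiceType) (S : I -> V -> Prop) (x : V) : Prop :=
  exists s : {fset I}, exists2 y : I -> V,
    forall i, i \in s -> S i (y i) & x = \sum_(i <- s) y i.

Definition is_direct_sum (W : V -> Prop) (I : choiceType)
    (S : I -> V -> Prop) : Prop :=
  (forall x, W x <-> sum_of S x) /\
  (forall (s : {fset I}) (y : I -> V), (forall i, i \in s -> S i (y i)) ->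
     \sum_(i <- s) y i = 0 -> forall i, i \in s -> y i = 0).

Definition subspace (W : V -> Prop) : Prop :=
  W 0 /\ forall a x y, W x -> W y -> W (a *: x + y).

Definition linear_on (W : V -> Prop) (U : lmodType K) (f : V -> U) : Prop :=
  forall a x y, W x -> W y -> f (a *: x + y) = a *: f x + f y.

End LinearAlgebra.

(** * Algebras and Lie algebras *)

Record lieAlgebra (K : fieldType) := LieAlgebra {
  lie_sort :> lmodType K;
  lie_bracket : lie_sort -> lie_sort -> lie_sort;
  lie_linear_l : forall z, linear (lie_bracket^~ z);
  lie_linear_r : forall z, linear (lie_bracket z);
  lie_alternating : forall x, lie_bracket x x = 0;
  lie_jacobi : forall x y z,
    lie_bracket x (lie_bracket y z) + lie_bracket y (lie_bracket z x)
      + lie_bracket z (lie_bracket x y) = 0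
}.

(* [mul] and [one] need only behave as an algebra structure on the subspaces
   under consideration; homomorphisms are total functions whose values outside
   their domain are irrelevant. *)
Section RelativeAlgebra.
Variables (K : fieldType) (V : lmodType K) (mul : V -> V -> V) (one : V).

Definition commutator (x y : V) : V := mul x y - mul y x.

Definition subalgebra (P : V -> Prop) : Prop :=
  [/\ subspace P, P one & forall x y, P x -> P y -> P (mul x y)].

Definition lie_subalgebra (L : V -> Prop) : Prop :=
  subspace L /\ forall x y, L x -> L y -> L (commutator x y).

Definition alg_hom_on (P : V -> Prop) (B : algType K) (f : V -> B) : Prop :=
  [/\ linear_on P f, f one = 1
    & forall x y, P x -> P y -> f (mul x y) = f x * f y].

Definition lie_hom_on (L : V -> Prop) (M : lmodType K) (br : M -> M -> M)
    (f : V -> M) : Prop :=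
  linear_on L f /\
  forall x y, L x -> L y -> f (commutator x y) = br (f x) (f y).

Definition freely_generated (L : V -> Prop) (J : choiceType) (Q : pred J)
    (g : J -> V) : Prop :=
  [/\ lie_subalgebra L,
      forall j, Q j -> L (g j)
    & forall (M : lieAlgebra K) (h : J -> M),
        exists f : V -> M,
          [/\ lie_hom_on L (@lie_bracket K M) f,
              forall j, Q j -> f (g j) = h j
            & forall f' : V -> M, lie_hom_on L (@lie_bracket K M) f' ->
                (forall j, Q j -> f' (g j) = h j) ->
                forall x, L x -> f' x = f x]].

Definition is_enveloping_algebra (L P : V -> Prop) : Prop :=
  [/\ subalgebra P, lie_subalgebra L, forall x, L x -> P x
    & forall (B : algType K) (f : V -> B),
        lie_hom_on L (fun u v : B => u * v - v * u) f ->
        exists F : V -> B,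
          [/\ alg_hom_on P F, forall x, L x -> F x = f x
            & forall F' : V -> B, alg_hom_on P F' ->
                (forall x, L x -> F' x = f x) ->
                forall x, P x -> F' x = F x]].

Definition alg_iso_on (A : lalgType K) (S : A -> Prop) (P : V -> Prop)
    (f : A -> V) : Prop :=
  [/\ forall a x y, S x -> S y -> f (a *: x + y) = a *: f x + f y,
      f 1 = one,
      forall x y, S x -> S y -> f (x * y) = mul (f x) (f y),
      forall x y, S x -> S y -> f x = f y -> x = y
    & forall z, P z <-> exists2 x, S x & z = f x].

End RelativeAlgebra.

(** * Words over the positive integers *)

Notation posnat := {n : nat | (0 < n)%N}.
Notation word := {fmonom {n : nat | (0 < n)%N}}.

Definition letters (q : word) : seq nat := [seq val i | i <- (q : seq posnat)].

Definition odd_word : pred word := fun q => all odd (letters q).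

(* Letters of q are at most [sumn (letters q)], so no factor is lost. *)
Definition qfact (q : word) : nat :=
  (\prod_(1 <= i < (sumn (letters q)).+1)
    ((count_mem i (letters q))`! * i ^ count_mem i (letters q)))%N.

Definition lyndon (s : seq nat) : bool :=
  (s != [::]) &&
  all (fun k => ((s : preorder.Order.SeqLexiOrder.Exports.seqlexi nat) < drop k s)%O)
    (iota 1 (size s).-1).

(* Componentwise multiplication; makes K[M1 * M2] the tensor product of the
   algebras K[M1] and K[M2]. *)
Section ProductMonoid.
Variables M1 M2 : monomType.
Definition pone : M1 * M2 := (mone, mone).
Definition pmul (x y : M1 * M2) : M1 * M2 := (mmul x.1 y.1, mmul x.2 y.2).
Fact pmulA : associative pmul.
Proof. by move=> x y z; rewrite /pmul /= !mulmA. Qed.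
Fact pmul1m : left_id pone pmul.
Proof. by case=> x y; rewrite /pmul /= !mul1m. Qed.
Fact pmulm1 : right_id pone pmul.
Proof. by case=> x y; rewrite /pmul /= !mulm1. Qed.
Fact punitm x y : pmul x y = pone -> x = pone /\ y = pone.
Proof. by case: x y => [a b] [c d] [/unitm[-> ->] /unitm[-> ->]]. Qed.
HB.instance Definition _ :=
  Choice_isMonomialDef.Build (M1 * M2)%type pmulA pmul1m pmulm1 punitm.
End ProductMonoid.

(** * Descents, peaks and the direct sum of the group algebras K S_n *)

(* The element i of 'I_n stands for the integer i, whereas the position i
   (counted from 1) of p : 'S_n is the ordinal of value i - 1. *)
Definition Des (n : nat) (p : 'S_n) : {set 'I_n} :=
  [set i : 'I_n | [exists j : 'I_n, (j.+1 == i :> nat) && (p i < p j)%N]].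

Definition Peak (n : nat) (p : 'S_n) : {set 'I_n} :=
  [set i : 'I_n | [exists j : 'I_n, exists k : 'I_n,
    [&& j.+1 == i :> nat, k.+1 == j :> nat, (p k < p j)%N & (p i < p j)%N]]].

(* D(q): the last partial sum is sumn q, which is not in 'I_(sumn q). *)
Definition comp_set (q : seq nat) : {set 'I_(sumn q)} :=
  [set i : 'I_(sumn q) | val i \in scanl addn 0%N q].

Notation gperm := {n : nat & 'S_n}.

Section DescentAlgebra.
Variable K : fieldType.

(* The direct sum of the K S_n; components are distinguished by the tag. *)
Notation KS := {malg K[gperm]}.
Notation KS2 := {malg K[(gperm * gperm)%type]}.

Definition elt (n : nat) (p : 'S_n) : KS :=
  << (Tagged (fun n => 'S_n) p : gperm) >>.

Definition homogeneous (n : nat) (x : KS) : Prop :=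
  forall g, g \in msupp x -> tag g = n.

(* In {perm T}, [(p * s) i = s (p i)]: products are read from left to right. *)
Definition inner (x y : KS) : KS :=
  \sum_(g <- msupp x) \sum_(h <- msupp y | tag h == tag g)
    (x@_g * y@_h) *: elt (tagged g * tagged_as g h)%g.

Definition inner_image (a : KS) (W : KS -> Prop) (y : KS) : Prop :=
  exists2 x, W x & y = inner a x.

Definition Delta_set (n : nat) (D : {set 'I_n}) : KS :=
  \sum_(p : 'S_n | Des p == D) elt p.

Definition Xi_set (n : nat) (D : {set 'I_n}) : KS :=
  \sum_(E : {set 'I_n} | E \subset D) Delta_set E.

Definition Delta (q : seq nat) : KS := Delta_set (comp_set q).

Definition Xi (q : seq nat) : KS := Xi_set (comp_set q).

Definition descent_comp (n : nat) : KS -> Prop :=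
  spanned (fun D : {set 'I_n} => [forall i in D, 0 < i]%N) (@Delta_set n).

Definition Peak_set (n : nat) (P : {set 'I_n}) : KS :=
  \sum_(p : 'S_n | Peak p == P) elt p.

Definition peak_comp (n : nat) : KS -> Prop :=
  spanned (fun P : {set 'I_n} => [forall i in P, 1 < i]%N) (@Peak_set n).

Definition peak_alg : KS -> Prop := sum_of peak_comp.

(** ** The Hopf algebra structure of the descent algebra *)

Definition XiW (q : word) : KS := Xi (letters q).

(* Coordinates in the basis (XiW q); see [XiW_free]. *)
Definition Xi_coord (x : KS) : {malg K[word]} :=
  classical_sets.xget 0 (fun c => mlin XiW c = x).

Definition star_one : KS := Xi [::].

Definition star (x y : KS) : KS := mlin XiW (Xi_coord x * Xi_coord y).

Definition tens (x y : KS) : KS2 :=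
  \sum_(g <- msupp x) \sum_(h <- msupp y) << x@_g * y@_h *g (g, h) >>.

(* The word of length at most 1 with sum n, so that Xi^0 is the identity. *)
Definition word1 (n : nat) : word :=
  FMonom (if insub n is Some i then [:: i : posnat] else [::]).

(* The coproduct in the basis (XiW q), as the multiplicative extension of
   n |-> sum_k (k, n - k). *)
Definition coprod_word (q : word) : {malg K[(word * word)%type]} :=
  \prod_(n <- letters q) \sum_(k < n.+1) << (word1 k, word1 (n - k)) >>.

Definition tensW (uv : word * word) : KS2 := tens (XiW uv.1) (XiW uv.2).

Definition coprod (x : KS) : KS2 :=
  mlin tensW (mlin coprod_word (Xi_coord x)).

Definition primitive (P : KS -> Prop) (x : KS) : Prop :=
  P x /\ coprod x = tens x star_one + tens star_one x.

(** ** Lie series *)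

Definition omega (n : nat) : KS :=
  \sum_(k < n) (-1) ^+ k *: Delta (rcons (nseq k 1%N) (n - k)%N).

Definition Lie_idempotent (n : nat) (a : KS) : Prop :=
  [/\ homogeneous n a, inner a a = a
    & forall y, inner_image a (homogeneous n) y <->
                inner_image (omega n) (homogeneous n) y].

Definition Lie_series (gamma : posnat -> KS) : Prop :=
  forall n : posnat, descent_comp (val n) (gamma n) /\
    Lie_idempotent (val n) ((val n)%:R^-1 *: gamma n).

Definition gammaW (gamma : posnat -> KS) (q : word) : KS :=
  foldr (fun n x => star (gamma n) x) star_one q.

End DescentAlgebra.

Notation KS K := {malg K[gperm]}.

(** * (XiW q) is a basis of the descent algebra, and its structure constants *)

Section MlinTheory.
Variables (K : fieldType) (V : lmodType K) (J : choiceType) (b : J -> V).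

Lemma mlinEw (d : {fset J}) (c : {malg K[J]}) :
  (msupp c `<=` d)%fset -> mlin b c = \sum_(j <- d) c@_j *: b j.
Proof.
move=> /fsubsetP le_cd; rewrite /mlin [RHS](bigID (mem (msupp c))) /=.
rewrite [X in _ + X]big1 ?addr0; last first.
  by move=> j /mcoeff_outdom ->; rewrite scale0r.
rewrite -[RHS]big_filter; apply: perm_big; apply: uniq_perm.
- exact: fset_uniq.
- by rewrite filter_uniq ?fset_uniq.
- by move=> j; rewrite mem_filter /=; case: (boolP (j \in _)) => // /le_cd ->.
Qed.

Fact mlin_is_linear : linear (mlin b).
Proof.
move=> a c d; pose D := (msupp c `|` msupp d)%fset.
have cD : (msupp c `<=` D)%fset by rewrite fsubsetUl.
have dD : (msupp d `<=` D)%fset by rewrite fsubsetUr.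
have aD : (msupp (a *: c + d) `<=` D)%fset.
  apply: fsubset_trans (msuppD_le _ _) _.
  by rewrite fsetSU //; apply: msuppZ_le.
rewrite (mlinEw cD) (mlinEw dD) (mlinEw aD) scaler_sumr -big_split /=.
by apply: eq_bigr => j _; rewrite mcoeffD mcoeffZ scalerDl scalerA.
Qed.

HB.instance Definition _ :=
  GRing.isLinear.Build K {malg K[J]} V *:%R (mlin b) mlin_is_linear.

Lemma mlinU (a : K) (j : J) : mlin b << a *g j >> = a *: b j.
Proof. by rewrite (mlinEw msuppU_le) big_seq_fset1 mcoeffUU. Qed.

End MlinTheory.

Lemma mlinM (K : fieldType) (M : monomType) (A : lalgType K) (f : M -> A) :
    (forall (a : K) (x y : A), x * (a *: y) = a *: (x * y)) ->
    {morph f : x y / mmul x y >-> x * y} ->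
  {morph mlin f : c d / c * d}.
Proof.
move=> sA fM c d; rewrite malgME raddf_sum {2}/mlin mulr_suml /=.
apply: eq_bigr => i _; rewrite raddf_sum /mlin mulr_sumr /=.
by apply: eq_bigr => j _; rewrite -/(mlin _ _) mlinU fM -scalerAl sA scalerA.
Qed.

Lemma Des_gt0 n (p : 'S_n) i : i \in Des p -> (0 < i)%N.
Proof. by rewrite inE => /existsP[j /andP[/eqP <- _]]. Qed.

Lemma Des_surj n (E : {set 'I_n}) :
  (forall i, i \in E -> (0 < i)%N) -> exists p : 'S_n, Des p = E.
Proof.
move=> E0; pose d (i : nat) := #|[set e in E | (e <= i)%N]|.
have dn i : (d i <= n)%N by rewrite -[leqRHS](card_ord n) max_card.
pose key (i : nat) := ((n - d i) * n + i)%N.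
have keyI (i j : 'I_n) : key i = key j -> i = j.
  by move/(congr1 (modn^~ n)); rewrite /key !modnMDl !modn_small // => /val_inj.
pose r (i : 'I_n) := #|[set j : 'I_n | (key j < key i)%N]|.
have r_lt (i j : 'I_n) : (key i < key j)%N -> (r i < r j)%N.
  move=> ij; apply: proper_card; apply/properP; split.
    by apply/subsetP => k; rewrite !inE => /ltn_trans; apply.
  by exists i; rewrite inE ?ltnn.
have r_mono (i j : 'I_n) : (r i < r j)%N = (key i < key j)%N.
  apply/idP/idP; last exact: r_lt.
  apply: contraTT; rewrite -!leqNgt leq_eqVlt => /orP[/eqP/keyI -> //|/r_lt].
  exact: ltnW.
have r_n i : (r i < n)%N.
  rewrite -[ltnRHS](card_ord n) -cardsT; apply: proper_card.
  by apply/properP; split; [exact: subsetT|exists i; rewrite !inE ?ltnn].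
pose f i := Ordinal (r_n i).
have f_inj : injective f.
  move=> i j /(congr1 val) /= rij; apply: keyI.
  by case: (ltngtP (key i) (key j)) => // /r_lt; rewrite rij ltnn.
exists (perm f_inj); apply/setP => i; rewrite inE.
apply/existsP/idP => [[j /andP[/eqP ji]]|iE].
  rewrite !permE /= r_mono /key -ji => kij.
  apply: contraTT kij => iE; suff -> : d j.+1 = d j by rewrite -leqNgt leq_add2l.
  apply: eq_card => e; rewrite !inE; case: (boolP (e \in E)) => //= eE.
  rewrite leq_eqVlt ltnS ji; case: eqP => // /val_inj ei.
  by rewrite ei (negbTE iE) in eE.
have i0 := E0 _ iE; have j_n : (i.-1 < n)%N by rewrite (leq_ltn_trans (leq_pred i)).
exists (Ordinal j_n); rewrite /= prednK // eqxx /= !permE /= r_mono /key /=.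
have dlt : (d i.-1 < d i)%N.
  apply: proper_card; apply/properP; split.
    apply/subsetP => k; rewrite !inE => /andP[-> /=] /leq_trans; apply.
    exact: leq_pred.
  by exists i; rewrite !inE iE /= ?leqnn // -ltnNge prednK.
have : ((n - d i).+1 * n <= (n - d i.-1) * n)%N
  by rewrite leq_mul2r ltn_sub2l ?orbT // (leq_trans dlt).
by rewrite mulSn; have := ltn_ord i; lia.
Qed.

Section XiTheory.
Variable K : fieldType.

Lemma Xi_setE n (D : {set 'I_n}) :
  Xi_set K D = \sum_(p : 'S_n | Des p \subset D) elt K p.
Proof.
rewrite (partition_big (@Des n) (fun E => E \subset D)) //=.
by apply: eq_bigr => E ED; apply: eq_bigl => p; case: eqP => [->|]; rewrite ?ED ?andbF.
Qed.

Lemma elt_coef m (s : 'S_m) n (p : 'S_n) :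
  (elt K s)@_(Tagged (fun n => 'S_n) p : gperm) =
    (Tagged (fun n => 'S_n) s == Tagged (fun n => 'S_n) p :> gperm)%:R.
Proof. by rewrite mcoeffU. Qed.

Lemma Xi_set_coef n (D : {set 'I_n}) (P : pred nat) m (p : 'S_m) :
    (forall i : 'I_n, (i \in D) = P i) ->
  (Xi_set K D)@_(Tagged (fun n => 'S_n) p : gperm) =
    ((m == n) && [forall i in Des p, P i])%:R.
Proof.
move=> DP; rewrite Xi_setE raddf_sum /=; case: eqP => [mn|/eqP mn]; last first.
  rewrite big1 // => s _; rewrite elt_coef; case: eqP => // /(congr1 tag) /= nm.
  by rewrite nm eqxx in mn.
subst m; rewrite andTb (eq_bigr (fun s => (s == p)%:R)); last first.
  by move=> s _; rewrite elt_coef eq_Tagged.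
case: forallP => [Dp|NDp].
  rewrite (bigD1 p) /= ?eqxx ?big1 ?addr0 //; first by move=> s /andP[_ /negbTE->].
  by apply/subsetP => i ip; rewrite DP; move: (Dp i); rewrite ip.
rewrite big1 // => s sD; case: eqP => // sp; case: NDp => i; apply/implyP.
by move: sD; rewrite sp => /subsetP sD /sD; rewrite DP.
Qed.

Lemma Xi_coef (q : seq nat) n (p : 'S_n) :
  (Xi K q)@_(Tagged (fun n => 'S_n) p : gperm) =
    ((n == sumn q) &&
       [forall i in Des p, (i : nat) \in scanl addn 0%N q])%:R.
Proof. by apply: Xi_set_coef => i; rewrite inE. Qed.

Lemma scanl_sorted (m : nat) (s : seq nat) : all (ltn 0) s ->
  path ltn m (scanl addn m s).
Proof.
by elim: s m => //= x s IH m /andP[x0 s0]; rewrite -[ltnLHS]addn0 ltn_add2l x0 IH.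
Qed.

Lemma scanl_le (m : nat) (s : seq nat) i : i \in scanl addn m s -> (i <= m + sumn s)%N.
Proof.
elim: s m => //= x s IH m; rewrite inE => /orP[/eqP ->|/IH]; first by lia.
by rewrite addnA.
Qed.

Lemma scanl_last (m : nat) (s : seq nat) : last m (scanl addn m s) = (m + sumn s)%N.
Proof. by elim: s m => [|x s IH] m /=; rewrite ?addn0 // IH addnA. Qed.

Lemma scanl_inj (s t : seq nat) : all (ltn 0) s -> all (ltn 0) t ->
  sumn s = sumn t -> (size t <= size s)%N ->
  (forall i, (i < sumn s)%N -> i \in scanl addn 0%N s -> i \in scanl addn 0%N t) ->
  s = t.
Proof.
move=> s0 t0 st size_ts sub.
have Ss : sorted ltn (scanl addn 0%N s).
  by apply: path_sorted (scanl_sorted 0 s0).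
have St : sorted ltn (scanl addn 0%N t).
  by apply: path_sorted (scanl_sorted 0 t0).
have ltnI : irreflexive ltn by move=> ?; rewrite /= ltnn.
have Us := sorted_uniq ltn_trans ltnI Ss.
have subst : {subset scanl addn 0%N s <= scanl addn 0%N t}.
  move=> i i_s; have := scanl_le i_s; rewrite add0n leq_eqVlt => /orP[/eqP i_n|].
    have i_gt0 : (0 < i)%N.
      by case: (s) i_s s0 i_n => // x s' _ /andP[/= x0 _] ->; rewrite addn_gt0 x0.
    have := mem_last 0%N (scanl addn 0%N t); rewrite scanl_last add0n -st -i_n.
    by rewrite inE => /orP[/eqP i0|//]; rewrite i0 in i_gt0.
  by move=> /sub sub_i; exact: sub_i.
have [_ eq_st] : (size (scanl addn 0%N s) = size (scanl addn 0%N t)) *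
  (scanl addn 0%N s =i scanl addn 0%N t).
  by apply: uniq_min_size; rewrite ?size_scanl.
have := irr_sorted_eq ltn_trans ltnI Ss St eq_st.
have K0 x : cancel (addn x) (fun y => y - x)%N by move=> y; rewrite addKn.
move/(congr1 (pairmap (fun x y => y - x)%N 0%N)).
by rewrite !(scanlK K0).
Qed.
End XiTheory.

Lemma all_letters (q : word) : all (ltn 0) (letters q).
Proof. by rewrite all_map; apply/allP => x _ /=; apply: valP x. Qed.

Lemma letters_inj : injective letters.
Proof.
move=> q r /(inj_map val_inj) qr; apply/val_inj; exact: qr.
Qed.

Lemma lettersM (q r : word) : letters (mmul q r) = letters q ++ letters r.
Proof. by rewrite /letters fmM map_cat. Qed.

Lemma letters_surj (s : seq nat) : all (ltn 0) s -> exists q : word, letters q = s.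
Proof.
elim: s => [|x s IH] /=; first by exists (FMonom [::]).
case/andP=> x0 /IH[q qs].
by exists (FMonom ((exist _ x x0 : posnat) :: (q : seq posnat))); rewrite /letters /= -qs.
Qed.

Lemma comp_surj n (D : pred nat) : ~~ D 0%N ->
  exists q : word, sumn (letters q) = n /\
    forall i, (i < n)%N -> (i \in scanl addn 0%N (letters q)) = D i.
Proof.
move=> D0; case: n => [|n].
  by exists (FMonom [::]); split.
pose t := rcons [seq i <- iota 1 n | D i] n.+1.
have pt : path ltn 0%N t.
  rewrite path_min_sorted; last first.
    apply/allP => i; rewrite mem_rcons inE mem_filter mem_iota.
    by case/orP=> [/eqP->|/and3P[]].
  rewrite /t -cats1 (sorted_pairwise ltn_trans) pairwise_cat /= andbT.
  apply/andP; split.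
    rewrite allrel1r; apply/allP => i; rewrite mem_filter mem_iota => /and3P[_ _].
    by rewrite add1n.
  by apply: pairwise_filter; rewrite -(sorted_pairwise ltn_trans) iota_ltn_sorted.
have tK m u : path ltn m u ->
    scanl addn m (pairmap (fun x y => y - x)%N m u) = u /\
    all (ltn 0) (pairmap (fun x y => y - x)%N m u).
  elim: u m => //= x u IH m /andP[mx /IH[uE ->]].
  by rewrite (subnKC (ltnW mx)) uE subn_gt0 mx.
have [tE /letters_surj[q qE]] := tK _ _ pt.
exists q; rewrite qE tE; split.
  by have := scanl_last 0%N (letters q); rewrite qE tE /t last_rcons add0n => <-.
move=> i; rewrite ltnS mem_rcons inE mem_filter mem_iota add1n !ltnS => i_n.
rewrite (_ : i == n.+1 = false) /= ?i_n ?andbT; last by apply/eqP; lia.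
by case: i i_n => [|i] i_n; rewrite ?andbT // andbF (negbTE D0).
Qed.

Lemma comp_set_gt0 (q : word) i : i \in comp_set (letters q) -> (0 < i)%N.
Proof.
rewrite inE => iq; have := scanl_sorted 0%N (all_letters q).
rewrite path_sortedE; last exact: ltn_trans.
by case/andP => /allP/(_ _ iq).
Qed.

Lemma malg_scalerAr (K : fieldType) (M : monomType) (a : K)
    (x y : {malg K[M]}) : x * (a *: y) = a *: (x * y).
Proof.
apply/malgP => k; rewrite mcoeffZ (mcoeffMlw _ (fsubset_refl _) (msuppZ_le a y)).
rewrite mcoeffMl mulr_sumr; apply: eq_bigr => i _; rewrite mulr_sumr.
by apply: eq_bigr => j _; rewrite mcoeffZ mulrnAr mulrCA.
Qed.

Section XiBasis.
Variable K : fieldType.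

Lemma maximal_size (s : seq word) : s != [::] ->
  exists2 q, q \in s & forall r, r \in s -> (size r <= size q)%N.
Proof.
elim: s => // x s IH _; have [-> |/IH[q qs qmax]] := eqVneq s [::].
  by exists x; rewrite ?inE // => r; rewrite inE => /eqP ->.
have [xq|qx] := leqP (size x) (size q).
  exists q; first by rewrite inE qs orbT.
  by move=> r; rewrite inE => /orP[/eqP ->|/qmax].
exists x; first by rewrite inE eqxx.
move=> r; rewrite inE => /orP[/eqP ->//|/qmax] rq.
exact: leq_trans rq (ltnW qx).
Qed.

Lemma XiW_free : free_family predT (XiW K).
Proof.
move=> c _ c0; apply/eqP; apply/negP => /negP; rewrite -msupp_eq0 => cn0.
have : (msupp c : seq word) != [::].
  by apply: contra cn0 => /eqP c_nil; apply/eqP/fsetP => i;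
    rewrite in_fset0 -[LHS]/(i \in enum_fset (msupp c)) c_nil.
case/maximal_size => q qc qmax.
have [p Dp] := Des_surj (@comp_set_gt0 q).
have : (mlin (XiW K) c)@_(Tagged (fun n => 'S_n) p : gperm) = c@_q.
  rewrite raddf_sum (big_fsetD1 q) //= mcoeffZ Xi_coef eqxx /=.
  have -> : [forall i in Des p, (i : nat) \in scanl addn 0%N (letters q)].
    by apply/forallP => i; apply/implyP; rewrite Dp inE.
  rewrite mulr1 big1_fset ?addr0 // => r; rewrite in_fsetD1 => /andP[rq rc] _.
  rewrite mcoeffZ Xi_coef; case: eqP => [n_r|_] /=; last by rewrite mulr0.
  case: forallP => [Dr|_]; last by rewrite mulr0.
  case/eqP: rq; apply/esym/letters_inj/scanl_inj => //; try exact: all_letters.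
    by rewrite !size_map qmax.
  move=> i i_n iq; have := Dr (Ordinal i_n); rewrite Dp inE /= iq.
  by [].
by move/eqP; rewrite c0 mcoeff0 eq_sym mcoeff_eq0 qc.
Qed.

Lemma Xi_coordK : cancel (mlin (XiW K)) (@Xi_coord K).
Proof.
move=> c; apply: classical_sets.xget_unique => // d cd.
apply/eqP; rewrite -subr_eq0; apply/eqP/(XiW_free (fun _ _ => isT)).
by rewrite raddfB /= cd subrr.
Qed.

Lemma Xi_coordW (q : word) : Xi_coord (XiW K q) = << q >>.
Proof. by rewrite -[XiW K q]scale1r -mlinU Xi_coordK. Qed.

Lemma Xi_set_word n (D : {set 'I_n}) : (forall i, i \in D -> (0 < i)%N) ->
  exists q, XiW K q = Xi_set K D.
Proof.
move=> D0; pose P i := [exists j in D, (j : nat) == i].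
have [|q [qn qP]] := @comp_surj n P.
  by apply/existsP => -[j /andP[/D0 + /eqP j0]]; rewrite j0.
exists q; apply/malgP => -[m p]; rewrite Xi_coef (@Xi_set_coef _ _ _ P).
  rewrite qn; case: eqP => // ?; subst m; congr (_%:R); congr nat_of_bool.
  by apply: eq_forallb => i; rewrite qP.
move=> i; apply/idP/existsP => [iD|[j /andP[jD /eqP/val_inj <-//]]].
by exists i; rewrite iD /=.
Qed.

Lemma Xi_span n x : descent_comp n x -> exists c, x = mlin (XiW K) c.
Proof.
pose S y := exists c, y = mlin (XiW K) c.
have S0 : S 0 by exists 0; rewrite raddf0.
have SD y z : S y -> S z -> S (y + z).
  by case=> c -> [d ->]; exists (c + d); rewrite raddfD.
have SZ a y : S y -> S (a *: y) by case=> c ->; exists (a *: c); rewrite linearZ.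
case=> c c_supp ->.
suff DeltaP m (D : {set 'I_n}) : (#|D| < m)%N -> [forall i in D, 0 < i]%N ->
    S (Delta_set K D).
  rewrite -/(S _) /mlin big_seq; apply: (big_ind S S0 SD) => D /c_supp D0.
  by apply: SZ; apply: DeltaP (ltnSn _) D0.
elim: m D => // m IH D; rewrite ltnS => Dm D0.
have -> : Delta_set K D =
    Xi_set K D + (-1) *: \sum_(E : {set 'I_n} | (E \subset D) && (E != D)) Delta_set K E.
  by rewrite /Xi_set (bigD1 D) //= scaleN1r addrK.
apply: (SD).
  have [i iD|q <-] := @Xi_set_word n D.
    by have /forallP/(_ i)/implyP := D0; apply.
  by exists << q >>; rewrite mlinU scale1r.
apply: SZ; apply: (big_ind S S0 SD) => E /andP[ED EnD]; apply: IH.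
  apply: leq_trans Dm; apply: proper_card; rewrite properEneq EnD; exact: ED.
apply/forallP => i; apply/implyP => /(subsetP ED) iD.
by have /forallP/(_ i)/implyP := D0; apply.
Qed.

Lemma starE c d : star (mlin (XiW K) c) (mlin (XiW K) d) = mlin (XiW K) (c * d).
Proof. by rewrite /star !Xi_coordK. Qed.

Lemma star_Xi (r q : word) :
  star (Xi K (letters r)) (Xi K (letters q)) = Xi K (letters r ++ letters q).
Proof.
rewrite -lettersM /star !Xi_coordW malgM_def fgmulUU mulr1 mlinU scale1r.
by [].
Qed.

Lemma letters_word1 n : letters (word1 n) = if n is 0%N then [::] else [:: n].
Proof.
rewrite /word1; case: n => [|n]; first by rewrite insubF.
by rewrite insubT.
Qed.

Lemma coprod_Xi n : coprod (Xi K (letters (word1 n))) =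
  \sum_(k < n.+1) tens (Xi K (letters (word1 k))) (Xi K (letters (word1 (n - k)))).
Proof.
rewrite /coprod Xi_coordW mlinU scale1r /coprod_word.
have -> : \prod_(i <- letters (word1 n)) \sum_(k < i.+1) << (word1 k, word1 (i - k)) >>
  = \sum_(k < n.+1) << (word1 k, word1 (n - k)) >> :> {malg K[(word * word)%type]}.
  rewrite letters_word1; case: n => [|n]; last by rewrite big_seq1.
  rewrite big_nil big_ord_recl big_ord0 addr0 subn0.
  have -> : word1 0 = mone.
    by apply: letters_inj; rewrite letters_word1 /letters fm1.
  by [].
rewrite raddf_sum; apply: eq_bigr => k _; rewrite /= mlinU scale1r //.
Qed.

Lemma coprod_wordM : {morph mlin (@coprod_word K) : c d / c * d}.
Proof.
apply: mlinM => [a x y|q r]; first exact: malg_scalerAr.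
by rewrite /coprod_word lettersM big_cat.
Qed.
End XiBasis.

(* Main.v *)
(* A = K<N> is read in D in two ways. In the basis (Xi^q), a word acts on D for the
   inner product by cutting an element with the coproduct and multiplying the pieces
   (Mackey's formula). If (g_n) are primitive homogeneous elements of D with a nonzero
   coefficient at Xi^n, then n |-> g_n is an isomorphism from A with the unshuffle
   coproduct; this transports the action to A. The elements omega_n are such generators
   by Newton's recursion, and their action is the Dynkin operator, so that inner
   multiples of omega_n are primitive. A Lie idempotent is thus primitive with
   coefficient 1 at Xi^n, and the inner square of gamma_q only counts the matchings of
   q with itself: it equals q? gamma_q.

   The coefficient of c * d at a permutation depends on its descents in the first and
   last positions, so products of the gamma_n with n odd lie in the peak algebra. The
   set of all i such that neither i nor i + 1 is a peak is D(q) for an odd q that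
   determines the peaks: there are as many independent gamma_q as peak classes.

   What remains concerns the free algebra: its primitive elements have a basis of
   Lyndon brackets, obtained from a PBW basis that is triangular for the
   lexicographic order, and the left-normed bracketing divided by the degree extends
   maps of the letters to Lie homomorphisms. *)
Require Import Defs.
From HB Require Import structures.
From mathcomp Require Import all_boot all_order all_algebra all_fingroup.
From mathcomp Require Import finmap monalg zify ring.
From mathcomp Require classical_sets.

Set Implicit Arguments.
Unset Strict Implicit.
Unset Printing Implicit Defensive.

Import GRing.Theory.

Local Open Scope ring_scope.


(** * Linear extensions, supports and triangular families *)

(** A Lie idempotent a is only known to be an inner multiple omega_n y with y in K S_n, not in D, so
    the action of D on itself does not reach y. Associativity gets around this: a word of two or
    more letters kills the primitive element omega_n, hence also omega_n y = a, and every
    homogeneous element of degree n in D then multiplies a by its coefficient at Xi^n. From a a = a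
    that coefficient of a is 1, and omega_n a = n a exhibits a as a multiple of omega_n inside D,
    where the Dynkin operator shows it to be primitive. The peak classes are never counted. One odd
    word is attached to each peak set that occurs; evaluating the corresponding gamma_q at one
    permutation per peak set gives a square matrix, whose rows are independent, and which is
    therefore invertible. All claims on P are pulled back to the span of the odd words in K<N>. This
    span is stable under the transported structure because unshuffling only rearranges letters.
    Characteristic 0 enters through divisions by degrees and through multiplicities that must not
    vanish. *)

Section MlinExtra.
Variable K : fieldType.

Lemma mlin_comp (V U : lmodType K) (f : {linear V -> U}) (J : choiceType)
    (b : J -> V) c : f (mlin b c) = mlin (fun j => f (b j)) c.
Proof. by rewrite /mlin linear_sum; apply: eq_bigr => j _; rewrite linearZ. Qed.

Lemma mlinE1 (V : lmodType K) (J : choiceType) (b : J -> V) j :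
  mlin b << j >> = b j.
Proof. by rewrite mlinU scale1r. Qed.

Lemma eq_in_mlin (V : lmodType K) (J : choiceType) (b b' : J -> V) c :
  {in msupp c, b =1 b'} -> mlin b c = mlin b' c.
Proof. by move=> bb'; apply: eq_big_seq => j jc; rewrite bb'. Qed.

Lemma eq_mlin (V : lmodType K) (J : choiceType) (b b' : J -> V) :
  b =1 b' -> mlin b =1 mlin b'.
Proof. by move=> bb' c; apply: eq_in_mlin => j _; apply: bb'. Qed.

Lemma mlin_id (J : choiceType) (c : {malg K[J]}) :
  mlin (fun j => << j >>) c = c.
Proof.
rewrite [RHS]monalgE; apply: eq_bigr => j _; apply/malgP => k.
by rewrite mcoeffZ !mcoeffU mulr_natr.
Qed.

Lemma mlin_sumb (V : lmodType K) (J : choiceType) (I : Type) (r : seq I)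
    (P : pred I) (b : I -> J -> V) c :
  mlin (fun j => \sum_(i <- r | P i) b i j) c = \sum_(i <- r | P i) mlin (b i) c.
Proof.
rewrite /mlin exchange_big; apply: eq_bigr => j _.
by rewrite scaler_sumr.
Qed.

Lemma mlinDb (V : lmodType K) (J : choiceType) (b b' : J -> V) c :
  mlin (fun j => b j + b' j) c = mlin b c + mlin b' c.
Proof. by rewrite /mlin -big_split; apply: eq_bigr => j _; rewrite scalerDr. Qed.

Lemma mlinZb (V : lmodType K) (J : choiceType) a (b : J -> V) c :
  mlin (fun j => a *: b j) c = a *: mlin b c.
Proof.
by rewrite /mlin scaler_sumr; apply: eq_bigr => j _; rewrite !scalerA mulrC.
Qed.

Lemma mcoeff_mlin (J I : choiceType) (b : J -> {malg K[I]}) c k :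
  (mlin b c)@_k = \sum_(j <- msupp c) c@_j * (b j)@_k.
Proof. by rewrite raddf_sum; apply: eq_bigr => j _; rewrite /= mcoeffZ. Qed.

Lemma mlin_exchange (V : lmodType K) (I J : choiceType) (F : I -> J -> V) a d :
  mlin (fun u => mlin (F u) d) a = mlin (fun w => mlin (F^~ w) a) d.
Proof.
rewrite /mlin; under eq_bigr do rewrite scaler_sumr.
rewrite exchange_big; apply: eq_bigr => w _; rewrite scaler_sumr.
by apply: eq_bigr => u _; rewrite !scalerA mulrC.
Qed.

Section Support.
Variable J : choiceType.
Implicit Types (Q : pred J) (c d : {malg K[J]}).

Lemma supportedP Q c : supported Q c <-> (forall j, ~~ Q j -> c@_j = 0).
Proof.
split=> [Qc j Qj|c0 j]; first by apply: mcoeff_outdom; apply: contra Qj => /Qc.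
by rewrite -mcoeff_neq0 => /negP cj; apply/negPn/negP => /c0 /eqP.
Qed.

Lemma sub_supported Q Q' c : subpred Q Q' -> supported Q c -> supported Q' c.
Proof. by move=> QQ' Qc j /Qc; apply: QQ'. Qed.

Lemma supported0 Q : supported Q (0 : {malg K[J]}).
Proof. by apply/supportedP => j _; rewrite mcoeff0. Qed.

Lemma supportedD Q c d : supported Q c -> supported Q d -> supported Q (c + d).
Proof.
move=> /supportedP Qc /supportedP Qd; apply/supportedP => j Qj.
by rewrite mcoeffD Qc ?Qd ?addr0.
Qed.

Lemma supportedZ Q a c : supported Q c -> supported Q (a *: c).
Proof.
by move=> /supportedP Qc; apply/supportedP => j Qj; rewrite mcoeffZ Qc ?mulr0.
Qed.

Lemma supportedB Q c d : supported Q c -> supported Q d -> supported Q (c - d).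
Proof. by rewrite -[- d]scaleN1r => Qc Qd; apply/supportedD/supportedZ. Qed.

Lemma supported_sum Q (I : eqType) (r : seq I) (P : pred I) (F : I -> {malg K[J]}) :
  (forall i, i \in r -> P i -> supported Q (F i)) ->
  supported Q (\sum_(i <- r | P i) F i).
Proof.
move=> QF; rewrite big_seq_cond; apply: (big_ind (supported Q)).
- exact: supported0.
- exact: supportedD.
- by move=> i /andP[]; apply: QF.
Qed.

Lemma supportedU Q (a : K) j : Q j -> supported Q << a *g j >>.
Proof.
move=> Qj; apply/supportedP => k Qk; rewrite mcoeffU.
by case: eqP => // jk; rewrite -jk Qj in Qk.
Qed.

Lemma supported_split Q c : exists d e,
  [/\ c = d + e, supported Q d & supported (predC Q) e].
Proof.
exists (\sum_(j <- msupp c | Q j) c@_j *: << j >>),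
       (\sum_(j <- msupp c | ~~ Q j) c@_j *: << j >>); split.
- by rewrite -{1}(mlin_id c) {1}/mlin (bigID Q).
- by apply: supported_sum => j _ Qj; apply/supportedZ/supportedU.
- by apply: supported_sum => j _ Qj; apply/supportedZ/supportedU.
Qed.

Lemma supported_disjoint Q c : supported Q c -> supported (predC Q) c -> c = 0.
Proof.
move=> /supportedP Qc /supportedP Qc'; apply/malgP => j; rewrite mcoeff0.
by case: (boolP (Q j)) => Qj; [rewrite Qc' //= negbK|rewrite Qc].
Qed.

End Support.

Lemma supported_mlin (I J : choiceType) (Q : pred J) (R : pred I)
    (b : J -> {malg K[I]}) c :
  supported Q c -> (forall j, Q j -> supported R (b j)) -> supported R (mlin b c).
Proof. by move=> Qc Rb; rewrite /mlin; apply: supported_sum => j /Qc Qj _; apply/supportedZ/Rb. Qed.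

Lemma maximal_rank (J : eqType) (rk : J -> nat) (s : seq J) : s != [::] ->
  exists2 j, j \in s & forall k, k \in s -> (rk k <= rk j)%N.
Proof.
elim: s => // x s IH _; have [-> |/IH[q qs qmax]] := eqVneq s [::].
  by exists x; rewrite ?inE // => r; rewrite inE => /eqP ->.
have [xq|qx] := leqP (rk x) (rk q).
  by exists q => [|r]; rewrite inE ?qs ?orbT // => /orP[/eqP->|/qmax].
exists x => [|r]; rewrite inE ?eqxx // => /orP[/eqP ->//|/qmax] rq.
exact: leq_trans rq (ltnW qx).
Qed.

Lemma maximal_msupp (J : choiceType) (rk : J -> nat) (c : {malg K[J]}) : c != 0 ->
  exists2 j, j \in msupp c & forall k, k \in msupp c -> (rk k <= rk j)%N.
Proof.
move=> c0; have /(maximal_rank rk)[j jc jmax] : (msupp c : seq J) != [::].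
  apply: contra c0 => /eqP c_nil; apply/eqP/malgP => i; rewrite mcoeff0.
  by apply: mcoeff_outdom; rewrite -[_ \in _]/(i \in enum_fset (msupp c)) c_nil.
by exists j.
Qed.

Section Triangular.
Variables (J : choiceType) (b : J -> {malg K[J]}) (rk : J -> nat).
Hypothesis b_diag : forall j, (b j)@_j != 0.
Hypothesis b_tri : forall j k, k != j -> (b j)@_k != 0 -> (rk k < rk j)%N.

(** An index of maximal rank in the support of c cannot be cancelled: any other [b k] that reaches
    it would have larger rank. *)
Lemma triangular_inj : injective (mlin b).
Proof.
suff b0 c : mlin b c = 0 -> c = 0.
  by move=> c d /eqP; rewrite -subr_eq0 -raddfB => /eqP/b0/eqP; rewrite subr_eq0 => /eqP.
move=> bc0; apply/eqP; apply: contraT => c0.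
have [j jc jmax] := maximal_msupp rk c0.
have /malgP/(_ j) := bc0; rewrite mcoeff_mlin mcoeff0 (big_fsetD1 j) //=.
rewrite big1_fset ?addr0 => [/eqP|k]; last first.
  rewrite in_fsetD1 => /andP[kj kc] _.
  case: (eqVneq (b k)@_j 0) => [->|bkj]; first by rewrite mulr0.
  by have := b_tri _ bkj; rewrite eq_sym kj ltnNge jmax // => /(_ isT).
by rewrite mulf_eq0 (negbTE (b_diag j)) orbF mcoeff_eq0 jc.
Qed.

(** Induction on the rank: after division by the diagonal coefficient, [b j] differs from [<< j >>]
    by indices of smaller rank. *)
Lemma triangular_surj x : exists c, x = mlin b c.
Proof.
pose S x := exists c, x = mlin b c.
have S0 : S 0 by exists 0; rewrite raddf0.
have SD y z : S y -> S z -> S (y + z).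
  by case=> c -> [d ->]; exists (c + d); rewrite raddfD.
have SZ a y : S y -> S (a *: y) by case=> c ->; exists (a *: c); rewrite linearZ.
suff SU n j : (rk j < n)%N -> S << j >>.
  rewrite -/(S x) -(mlin_id x); apply: (big_ind S S0 SD) => j _.
  exact/SZ/(SU (rk j).+1).
elim: n j => // n IH j; rewrite ltnS => jn.
have -> : << j >> = ((b j)@_j)^-1 *: (b j - (b j - (b j)@_j *: << j >>)).
  by rewrite opprB addrCA subrr addr0 scalerA mulVf // scale1r.
apply/SZ/SD; first by exists << j >>; rewrite mlinE1.
rewrite -scaleN1r; apply: (SZ); rewrite -(mlin_id (_ - _)) /mlin big_seq.
apply: (big_ind S S0 SD) => k; rewrite -mcoeff_neq0 => kb; apply/SZ/IH.
have kj : k != j.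
  by apply: contra kb => /eqP->; rewrite mcoeffB mcoeffZ mcoeffUU mulr1 subrr.
apply: leq_trans jn; apply: b_tri => //; move: kb.
by rewrite mcoeffB mcoeffZ mcoeffU [j == k]eq_sym (negbTE kj) mulr0 subr0.
Qed.

End Triangular.
End MlinExtra.

(** * Words, tensors and coproducts *)

Lemma linear_mlin (K : fieldType) (V U : lmodType K) (f : V -> U) (J : choiceType)
    (b : J -> V) c : linear f -> f (mlin b c) = mlin (fun j => f (b j)) c.
Proof.
move=> fl; pose F : {linear V -> U} := HB.pack f (GRing.isLinear.Build K V U *:%R f fl).
exact: (mlin_comp F).
Qed.

Lemma lin_ext (K : fieldType) (U : lmodType K) (J : choiceType)
    (f h : {malg K[J]} -> U) :
  linear f -> linear h -> (forall j, f << j >> = h << j >>) -> f =1 h.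
Proof.
move=> fl hl fh c; rewrite -(mlin_id c) (linear_mlin _ _ fl) (linear_mlin _ _ hl).
exact: eq_mlin.
Qed.

Lemma linearZ_of (K : fieldType) (V U : lmodType K) (f : V -> U) : linear f ->
  forall a x, f (a *: x) = a *: f x.
Proof.
move=> fl a x; have f0 : f 0 = 0.
  by have := fl (-1) 0 0; rewrite scaler0 addr0 scaleN1r addNr.
by rewrite -[a *: x]addr0 fl f0 addr0.
Qed.

Lemma linearD_of (K : fieldType) (V U : lmodType K) (f : V -> U) : linear f ->
  forall x y, f (x + y) = f x + f y.
Proof. by move=> fl x y; rewrite -[x]scale1r fl !scale1r. Qed.

Lemma linearB_of (K : fieldType) (V U : lmodType K) (f : V -> U) : linear f ->
  forall x y, f (x - y) = f x - f y.
Proof.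
by move=> fl x y; rewrite -scaleN1r (linearD_of fl) (linearZ_of fl) scaleN1r.
Qed.

Lemma linear_comp (K : fieldType) (U V W : lmodType K) (f : V -> W) (h : U -> V) :
  linear f -> linear h -> linear (fun x => f (h x)).
Proof. by move=> fl hl a x y; rewrite hl fl. Qed.

Lemma add_linear (K : fieldType) (V U : lmodType K) (f g : V -> U) :
  linear f -> linear g -> linear (fun x => f x + g x).
Proof. by move=> fl gl a x y; rewrite fl gl scalerDr addrACA. Qed.

Lemma opp_linear (K : fieldType) (V U : lmodType K) (f : V -> U) : linear f -> linear (fun x => - f x).
Proof. by move=> fl a x y; rewrite fl opprD scalerN. Qed.

Lemma scale_linear (K : fieldType) (V U : lmodType K) a (f : V -> U) : linear f -> linear (fun x => a *: f x).
Proof. by move=> fl b x y; rewrite fl scalerDr !scalerA mulrC. Qed.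

Lemma mcoeff_mlinU (K : fieldType) (J I : choiceType) (f : J -> I) (c : {malg K[J]}) j :
  injective f -> (mlin (fun j => << f j >> : {malg K[I]}) c)@_(f j) = c@_j.
Proof.
move=> fI; rewrite mcoeff_mlin.
transitivity ((mlin (fun j => << j >>) c)@_j); last by rewrite mlin_id.
rewrite mcoeff_mlin; apply: eq_bigr => k _; rewrite !mcoeffU.
by rewrite (inj_eq fI).
Qed.

Lemma mcoeff_mlin2 (K : fieldType) (I J : choiceType) (c : {malg K[I]}) (d : {malg K[J]}) u v :
  (mlin (fun u => mlin (fun v => << (u, v) >>) d) c)@_(u, v) = c@_u * d@_v.
Proof.
rewrite mcoeff_mlin.
transitivity ((mlin (fun j => d@_v *: << j >>) c)@_u); last first.
  by rewrite mlinZb mlin_id mcoeffZ mulrC.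
rewrite mcoeff_mlin; apply: eq_bigr => w _; congr (_ * _).
rewrite mcoeffZ mcoeffU; case: eqP => [->|wu].
  by rewrite mcoeff_mlinU ?mulr1 // => ? ? [].
rewrite mulr0 mcoeff_mlin big1 // => x _; rewrite mcoeffU.
by case: eqP => [[/wu]|]; rewrite ?mulr0.
Qed.

Lemma word_ind (P : word -> Prop) : P mone ->
  (forall n q, P q -> P (mmul (fmu n) q)) -> forall q, P q.
Proof.
move=> P1 PS q; rewrite -(fmK q); elim: (q : seq _) => [|n s IH].
  by move: P1; rewrite -(fmK mone) fm1.
by have := PS n _ IH; rewrite -(fmK (mmul _ _)) fmM fmU.
Qed.

Lemma word_rind (P : word -> Prop) : P mone ->
  (forall n q, P q -> P (mmul q (fmu n))) -> forall q, P q.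
Proof.
move=> P1 PS q; rewrite -(fmK q); elim/last_ind: (q : seq _) => [|s n IH].
  by move: P1; rewrite -(fmK mone) fm1.
by have := PS n _ IH; rewrite -(fmK (mmul _ _)) fmM fmU cats1.
Qed.

Definition deg (q : word) : nat := sumn (letters q).

Lemma letters1 : letters mone = [::]. Proof. by rewrite /letters fm1. Qed.

Lemma lettersU n : letters (fmu n) = [:: val n]. Proof. by rewrite /letters fmU. Qed.

Lemma degM q r : deg (mmul q r) = (deg q + deg r)%N.
Proof. by rewrite /deg lettersM sumn_cat. Qed.

Lemma deg1 : deg mone = 0%N. Proof. by rewrite /deg letters1. Qed.

Lemma degU n : deg (fmu n) = val n.
Proof. by rewrite /deg lettersU /= addn0. Qed.

Lemma word_nil (q : word) : letters q = [::] -> q = mone.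
Proof. by rewrite -letters1 => /letters_inj. Qed.

Lemma deg_eq0 q : (deg q == 0)%N = (q == mone).
Proof.
apply/eqP/eqP => [|->]; last exact: deg1.
move=> q0; apply: word_nil; have := all_letters q; move: q0; rewrite /deg.
by case: (letters q) => //= x s /eqP; rewrite addn_eq0 => /andP[/eqP-> _].
Qed.

HB.lock Definition ten (K : fieldType) (c d : {malg K[word]}) :
    {malg K[(word * word)%type]} :=
  mlin (fun u => mlin (fun v => << (u, v) >>) d) c.

HB.lock Definition proj (K : fieldType) (n : nat) : {malg K[word]} -> {malg K[word]} :=
  mlin (fun q => if deg q == n then << q >> else 0).

HB.lock Definition coprodX (K : fieldType) :
    {malg K[word]} -> {malg K[(word * word)%type]} :=
  mlin (@coprod_word K).

(** The coproduct dual to the shuffle product: each letter goes to the left or to the right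
    factor. *)
Definition unshuffle_word (K : fieldType) (q : word) : {malg K[(word * word)%type]} :=
  \prod_(n <- (q : seq posnat)) (ten << fmu n >> 1 + ten 1 << fmu n >>).

HB.lock Definition unshuffle (K : fieldType) :
    {malg K[word]} -> {malg K[(word * word)%type]} :=
  mlin (@unshuffle_word K).

Section Linear.
Variable K : fieldType.

Fact proj_is_linear n : linear (@proj K n).
Proof. by rewrite proj.unlock; apply: linearP. Qed.
HB.instance Definition _ n :=
  GRing.isLinear.Build K _ _ *:%R (@proj K n) (proj_is_linear n).

Fact coprodX_is_linear : linear (@coprodX K).
Proof. by rewrite coprodX.unlock; apply: linearP. Qed.
HB.instance Definition _ :=
  GRing.isLinear.Build K _ _ *:%R (@coprodX K) coprodX_is_linear.

Fact unshuffle_is_linear : linear (@unshuffle K).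
Proof. by rewrite unshuffle.unlock; apply: linearP. Qed.
HB.instance Definition _ :=
  GRing.isLinear.Build K _ _ *:%R (@unshuffle K) unshuffle_is_linear.

Lemma proj_mlin n (J : choiceType) (b : J -> {malg K[word]}) c :
  proj n (mlin b c) = mlin (fun j => proj n (b j)) c.
Proof. exact: (mlin_comp (@proj K n)). Qed.

Lemma coprodX_mlin (J : choiceType) (b : J -> {malg K[word]}) c :
  coprodX (mlin b c) = mlin (fun j => coprodX (b j)) c.
Proof. exact: (mlin_comp (@coprodX K)). Qed.

Lemma unshuffle_mlin (J : choiceType) (b : J -> {malg K[word]}) c :
  unshuffle (mlin b c) = mlin (fun j => unshuffle (b j)) c.
Proof. exact: (mlin_comp (@unshuffle K)). Qed.

End Linear.

Section Algebra.
Variable K : fieldType.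
Notation A := {malg K[word]}.
Notation A2 := {malg K[(word * word)%type]}.
Local Notation ten := (@ten K).
Local Notation proj := (@proj K).
Local Notation coprodX := (@coprodX K).
Local Notation unshuffle := (@unshuffle K).
Local Notation unshuffle_word := (@unshuffle_word K).

Lemma malgUM (M : monomType) (u v : M) :
  << u >> * << v >> = << mmul u v >> :> {malg K[M]}.
Proof. by rewrite malgM_def fgmulUU mulr1. Qed.

Lemma mulr_mlin (M : monomType) (J : choiceType) (b : J -> {malg K[M]}) c x :
  x * mlin b c = mlin (fun j => x * b j) c.
Proof.
apply: (linear_mlin (f := fun y => x * y)) => a y z.
by rewrite mulrDr malg_scalerAr.
Qed.

Lemma mlin_mulr (R : lalgType K) (J : choiceType) (b : J -> R) c x :
  mlin b c * x = mlin (fun j => b j * x) c.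
Proof.
apply: (linear_mlin (f := fun y => y * x)) => a y z.
by rewrite mulrDl scalerAl.
Qed.

(** Three separate predicates let one lemma serve for degrees, lengths, rearrangement classes and
    leading terms. *)
Lemma supportedM (M : monomType) (Q R S : pred M) (c d : {malg K[M]}) :
  supported Q c -> supported R d -> (forall q r, Q q -> R r -> S (mmul q r)) ->
  supported S (c * d).
Proof.
move=> Qc Rd QRS; rewrite -(mlin_id c) mlin_mulr; apply: supported_mlin Qc _ => q Qq.
rewrite -(mlin_id d) mulr_mlin; apply: supported_mlin Rd _ => r Rr.
by rewrite malgUM; apply/supportedU/QRS.
Qed.

Definition homog (n : nat) (c : A) := supported (fun q => deg q == n) c.

Lemma homogM m n c d : homog m c -> homog n d -> homog (m + n) (c * d).
Proof.
move=> cm dn; apply: supportedM cm dn _ => q r /eqP <- /eqP <-.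
by rewrite degM.
Qed.

Lemma homogU q : homog (deg q) << q >>.
Proof. exact: supportedU. Qed.

Lemma homog1 : homog 0 1.
Proof. by have := @homogU mone; rewrite deg1. Qed.

Lemma projE n (c : A) :
  proj n c = mlin (fun q => if deg q == n then << q >> else 0) c.
Proof. by rewrite proj.unlock. Qed.

Lemma projU n q : proj n << q >> = if deg q == n then << q >> else 0.
Proof. by rewrite projE mlinE1. Qed.

Lemma proj_homog n c : homog n (proj n c).
Proof.
rewrite projE; apply: (@supported_mlin _ _ _ predT) => // q _; case: ifP => [qn|_].
  exact: supportedU.
exact: supported0.
Qed.

Lemma proj_id n c : homog n c -> proj n c = c.
Proof.
move=> cn; rewrite -[RHS]mlin_id projE; apply: eq_in_mlin => q /cn qn.
by move: qn; rewrite /in_mem /= => ->.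
Qed.

Lemma proj_neq m n c : homog m c -> m != n -> proj n c = 0.
Proof.
move=> cm mn; rewrite projE (_ : mlin _ c = mlin (fun q => 0) c); last first.
  apply: eq_in_mlin => q /cm; rewrite /in_mem /= => /eqP->.
  by rewrite (negbTE mn).
by rewrite /mlin big1 // => q _; rewrite scaler0.
Qed.

Lemma tenE (c d : A) :
  ten c d = mlin (fun u => mlin (fun v => << (u, v) >>) d) c :> A2.
Proof. by rewrite ten.unlock. Qed.

Lemma mcoeff_ten (c d : A) u v : (ten c d)@_(u, v) = c@_u * d@_v.
Proof. by rewrite tenE mcoeff_mlin2. Qed.

Lemma tenU u v : ten << u >> << v >> = << (u, v) >>.
Proof. by rewrite tenE !mlinE1. Qed.

Lemma ten_linl d : linear (ten^~ d).
Proof.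
move=> a x y; apply/malgP => -[u v].
rewrite /= [RHS]mcoeffD (mcoeffZ a (ten x d)) [X in _ = _ + X]mcoeff_ten.
by rewrite [X in _ = _ * X + _]mcoeff_ten mcoeff_ten mcoeffD mcoeffZ mulrDl mulrA.
Qed.

Lemma ten_linr c : linear (ten c).
Proof.
move=> a x y; apply/malgP => -[u v].
rewrite /= [RHS]mcoeffD (mcoeffZ a (ten c x)) [X in _ = _ + X]mcoeff_ten.
by rewrite [X in _ = _ * X + _]mcoeff_ten mcoeff_ten mcoeffD mcoeffZ mulrDr mulrCA.
Qed.

Lemma ten_mlinl (J : choiceType) (b : J -> A) c d :
  ten (mlin b c) d = mlin (fun j => ten (b j) d) c.
Proof. exact: (linear_mlin _ _ (ten_linl d)). Qed.

Lemma ten_mlinr (J : choiceType) (b : J -> A) c d :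
  ten d (mlin b c) = mlin (fun j => ten d (b j)) c.
Proof. exact: (linear_mlin _ _ (ten_linr d)). Qed.

Lemma tenDl x y d : ten (x + y) d = ten x d + ten y d.
Proof. by rewrite -[x]scale1r ten_linl !scale1r. Qed.

Lemma tenDr x y d : ten d (x + y) = ten d x + ten d y.
Proof. by rewrite -[x]scale1r ten_linr !scale1r. Qed.

Lemma ten0l d : ten 0 d = 0.
Proof. by apply/malgP => -[u v]; rewrite mcoeff_ten !mcoeff0 mul0r. Qed.

Lemma ten0r d : ten d 0 = 0.
Proof. by apply/malgP => -[u v]; rewrite mcoeff_ten !mcoeff0 mulr0. Qed.

Lemma tenZl a x d : ten (a *: x) d = a *: ten x d.
Proof. by rewrite -[a *: x]addr0 ten_linl ten0l addr0. Qed.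

Lemma tenZr a x d : ten d (a *: x) = a *: ten d x.
Proof. by rewrite -[a *: x]addr0 ten_linr ten0r addr0. Qed.

Lemma ten_suml (I : Type) (r : seq I) (P : pred I) (F : I -> A) d :
  ten (\sum_(i <- r | P i) F i) d = \sum_(i <- r | P i) ten (F i) d.
Proof. exact: (big_morph (ten^~ d) (fun x y => tenDl x y d) (ten0l d)). Qed.

Lemma ten_sumr (I : Type) (r : seq I) (P : pred I) (F : I -> A) d :
  ten d (\sum_(i <- r | P i) F i) = \sum_(i <- r | P i) ten d (F i).
Proof. exact: (big_morph (ten d) (fun x y => tenDr x y d) (ten0r d)). Qed.

Lemma tenM a b c d : ten a b * ten c d = ten (a * c) (b * d).
Proof.
have tenMU u v : << (u, v) >> * ten c d = ten (<< u >> * c) (<< v >> * d).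
  rewrite -[c in RHS]mlin_id [<< u >> * _]mulr_mlin ten_mlinl [ten _ _ in LHS]tenE mulr_mlin.
  apply: eq_mlin => x; rewrite mulr_mlin -[d in RHS]mlin_id [<< v >> * _]mulr_mlin.
  by rewrite ten_mlinr; apply: eq_mlin => y; rewrite malgUM [in RHS]malgUM malgUM tenU.
rewrite -[a in RHS]mlin_id [_ * c]mlin_mulr ten_mlinl [ten _ _ in LHS]tenE mlin_mulr.
apply: eq_mlin => u; rewrite mlin_mulr -[b in RHS]mlin_id [_ * d]mlin_mulr ten_mlinr.
by apply: eq_mlin => v; rewrite tenMU.
Qed.

Lemma ten11 : ten 1 1 = 1.
Proof. exact: tenU. Qed.

Lemma coprodXM : {morph coprodX : c d / c * d}.
Proof. by rewrite coprodX.unlock; apply: coprod_wordM. Qed.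

Lemma coprodX1 : coprodX 1 = 1.
Proof. by rewrite coprodX.unlock mlinE1 /coprod_word letters1 big_nil. Qed.

Lemma unshuffleM : {morph unshuffle : c d / c * d}.
Proof.
rewrite unshuffle.unlock; apply: mlinM => [a x y|q r]; first exact: malg_scalerAr.
by rewrite /unshuffle_word fmM big_cat.
Qed.

Lemma unshuffleW q : unshuffle << q >> = unshuffle_word q.
Proof. by rewrite unshuffle.unlock mlinE1. Qed.

Lemma unshuffle1 : unshuffle 1 = 1.
Proof. by rewrite unshuffle.unlock mlinE1 /unshuffle_word fm1 big_nil. Qed.

Lemma unshuffleU n : unshuffle << fmu n >> = ten << fmu n >> 1 + ten 1 << fmu n >>.
Proof. by rewrite unshuffle.unlock mlinE1 /unshuffle_word fmU big_seq1. Qed.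

(** The coproduct is a parameter because primitivity is compared for [coprodX] and [unshuffle],
    which [lift] intertwines. *)
Definition prim (D : A -> A2) (x : A) := D x = ten x 1 + ten 1 x.

Lemma prim_lin (D : {linear A -> A2}) a x y :
  prim D x -> prim D y -> prim D (a *: x + y).
Proof.
rewrite /prim linearP => -> ->; rewrite tenDl tenDr tenZl tenZr scalerDr.
by rewrite addrACA.
Qed.

Lemma prim0 (D : {linear A -> A2}) : prim D 0.
Proof. by rewrite /prim linear0 ten0l ten0r addr0. Qed.

Lemma primZ (D : {linear A -> A2}) a x : prim D x -> prim D (a *: x).
Proof.
move=> Dx; have := prim_lin a Dx (prim0 D).
by rewrite addr0.
Qed.

Lemma prim_sum (D : {linear A -> A2}) (I : eqType) (r : seq I) (F : I -> A) :
  (forall i, i \in r -> prim D (F i)) -> prim D (\sum_(i <- r) F i).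
Proof.
move=> DF; rewrite big_seq; apply: (big_ind (prim D)) => [|x y Dx Dy|//].
  exact: prim0.
by rewrite -[x]scale1r; apply: prim_lin Dx Dy.
Qed.

Lemma prim_mlin (D : {linear A -> A2}) (J : choiceType) (Q : pred J) (b : J -> A) c :
  supported Q c -> (forall j, Q j -> prim D (b j)) -> prim D (mlin b c).
Proof. by move=> Qc Db; apply: prim_sum => j /Qc/Db; apply: primZ. Qed.

Lemma addr_cancel_mid (V : zmodType) (a b c d e f : V) :
  a + b + (c + d) - (e + c + (b + f)) = a - e + (d - f).
Proof.
rewrite (addrC c d) (addrACA a) (addrC b f) (addrACA e) (addrC c b).
by rewrite opprD (addrACA (a + d)) subrr addr0 opprD (addrACA a).
Qed.

Lemma prim_comm (D : {linear A -> A2}) x y : {morph D : c d / c * d} ->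
  prim D x -> prim D y -> prim D (x * y - y * x).
Proof.
move=> DM Dx Dy; rewrite /prim (_ : D _ = D (x * y) - D (y * x)); last exact: linearB.
move: Dx Dy; rewrite DM DM => -> ->.
rewrite !mulrDl !mulrDr !tenM !mulr1 !mul1r.
rewrite tenDl tenDr -[- (y * x)]scaleN1r tenZl tenZr !scaleN1r.
exact: addr_cancel_mid.
Qed.

End Algebra.

(** Preceded by a coproduct, this is the convolution product of [f] and [g]. *)
HB.lock Definition conv (K : fieldType) (f g : {malg K[word]} -> {malg K[word]}) :
    {malg K[(word * word)%type]} -> {malg K[word]} :=
  mlin (fun w => f << w.1 >> * g << w.2 >>).

(* n Xi^n = sum_(k < n) Xi^k * omega_coord (n - k): Newton's recursion for [omega]. *)
Fixpoint omega_coord_rec (K : fieldType) (f n : nat) : {malg K[word]} :=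
  if f is f'.+1 then
    n%:R *: << word1 n >> - \sum_(1 <= k < n) << word1 k >> * omega_coord_rec K f' (n - k)
  else 0.

HB.lock Definition omega_coord (K : fieldType) n := omega_coord_rec K n n.

Section Conv.
Variable K : fieldType.
Notation A := {malg K[word]}.
Variables f g : A -> A.

Fact conv_is_linear : linear (@conv K f g).
Proof. by rewrite conv.unlock; apply: linearP. Qed.
HB.instance Definition _ :=
  GRing.isLinear.Build K _ _ *:%R (@conv K f g) conv_is_linear.

Lemma conv_mlin (J : choiceType) (b : J -> {malg K[(word * word)%type]}) c :
  conv f g (mlin b c) = mlin (fun j => conv f g (b j)) c.
Proof. exact: (mlin_comp (@conv K f g)). Qed.

End Conv.

(** * The action by cutting, and the primitivity of [omega_coord] *)

Section Action.
Variable K : fieldType.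
Notation A := {malg K[word]}.
Notation A2 := {malg K[(word * word)%type]}.
Local Notation ten := (@ten K).
Local Notation proj := (@proj K).
Local Notation coprodX := (@coprodX K).
Local Notation unshuffle := (@unshuffle K).
Local Notation unshuffle_word := (@unshuffle_word K).
Local Notation conv := (@conv K).
Implicit Types a c d x y : A.

(* [actw coprodX u] is left multiplication by [Xi^u] for the inner product,
   read in the coordinates given by the basis [XiW]. *)
Fixpoint actw (D : A -> A2) (u : seq nat) (c : A) : A :=
  if u is n :: v then
    mlin (fun w => proj n << w.1 >> * actw D v << w.2 >>) (D c)
  else c@_mone *: 1.

Definition act (D : A -> A2) (a c : A) : A :=
  mlin (fun u => actw D (letters u) c) a.

Lemma actw_linear (D : {linear A -> A2}) u : linear (actw D u).
Proof.
case: u => [|n u] a x y /=; last by rewrite !linearP.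
by rewrite mcoeffD mcoeffZ scalerDl scalerA.
Qed.

Lemma act_linear (D : {linear A -> A2}) a : linear (act D a).
Proof.
move=> k x y; rewrite /act -mlinZb -mlinDb.
by apply: eq_mlin => u; rewrite actw_linear.
Qed.

Lemma act_linearl (D : A -> A2) c : linear (act D ^~ c).
Proof. by move=> k x y; rewrite /act linearP. Qed.

Lemma convE f g (w : A2) : conv f g w = mlin (fun v => f << v.1 >> * g << v.2 >>) w.
Proof. by rewrite conv.unlock. Qed.

Lemma convU f g u v : conv f g << (u, v) >> = f << u >> * g << v >>.
Proof. by rewrite conv.unlock mlinE1. Qed.

Lemma conv_ten f g c d : linear f -> linear g ->
  conv f g (ten c d) = f c * g d.
Proof.
move=> fl gl; rewrite -[c in RHS]mlin_id (linear_mlin _ _ fl) mlin_mulr tenE conv_mlin.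
apply: eq_mlin => u; rewrite -[d in RHS]mlin_id (linear_mlin _ _ gl) mulr_mlin conv_mlin.
by apply: eq_mlin => v; apply: convU.
Qed.

Lemma eq_conv f f' g g' (w : A2) : f =1 f' -> g =1 g' -> conv f g w = conv f' g' w.
Proof.
by move=> ff' gg'; rewrite conv.unlock; apply: eq_mlin => v; rewrite ff' gg'.
Qed.

Lemma proj_linear n : linear (proj n).
Proof. exact: linearP. Qed.

Lemma actw_cons (D : {linear A -> A2}) n u c :
  actw D (n :: u) c = conv (proj n) (actw D u) (D c).
Proof. by rewrite conv.unlock. Qed.

(** The recursion for [actw] extended to combinations of words; it turns recursions in A, such as
    Newton's, into identities between convolutions. *)
Lemma act_letterM (D : {linear A -> A2}) n a c :
  act D (<< fmu n >> * a) c = conv (proj (val n)) (act D a) (D c).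
Proof.
rewrite /act -[a in LHS]mlin_id mulr_mlin (mlin_comp (mlin _)) /=.
rewrite conv.unlock (eq_mlin (b' := fun w => mlin (fun u =>
  proj (val n) << w.1 >> * actw D (letters u) << w.2 >>) a)); last first.
  by move=> w; rewrite mulr_mlin.
rewrite -mlin_exchange; apply: eq_mlin => u.
by rewrite malgUM mlinE1 lettersM lettersU.
Qed.

Lemma homog_coef0 n c q : homog n c -> deg q != n -> c@_q = 0.
Proof. by move=> /supportedP/(_ q). Qed.

Lemma homog_coef1 n c : homog n c -> n != 0%N -> c@_mone = 0.
Proof.
by move=> cn n0; apply: homog_coef0 cn _; rewrite deg1 eq_sym.
Qed.

Lemma projM n x y : proj n (x * y) = \sum_(k < n.+1) proj k x * proj (n - k) y.
Proof.
pose F u v := \sum_(k < n.+1) proj k << u >> * proj (n - k) << v >>.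
have E u v : proj n (<< u >> * << v >>) = F u v.
  rewrite malgUM projU degM; case: eqP => [uvn|uvn].
    have un : (deg u < n.+1)%N by rewrite -uvn ltnS leq_addr.
    have vn : (n - deg u)%N = deg v by rewrite -uvn addKn.
    rewrite /F (bigD1 (Ordinal un)) //= !projU eqxx vn eqxx malgUM.
    rewrite big1 ?addr0 // => k; rewrite -val_eqE /= eq_sym => /negbTE uk.
    by rewrite projU uk mul0r.
  rewrite /F big1 // => k _; rewrite !projU; case: eqP => [uk|]; last by rewrite mul0r.
  case: eqP => [vk|]; last by rewrite mulr0.
  by case: uvn; rewrite uk vk subnKC // -ltnS ltn_ord.
transitivity (mlin (fun u => mlin (F u) y) x).
  rewrite -[x in LHS]mlin_id mlin_mulr proj_mlin; apply: eq_mlin => u.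
  rewrite -[y in LHS]mlin_id mulr_mlin proj_mlin; apply: eq_mlin => v.
  exact: E.
rewrite (eq_mlin (b' := fun u => \sum_(k < n.+1) proj k << u >> * proj (n - k) y)).
  rewrite mlin_sumb; apply: eq_bigr => k _.
  by rewrite -[x in RHS]mlin_id proj_mlin mlin_mulr.
move=> u; rewrite /F mlin_sumb; apply: eq_bigr => k _.
by rewrite -[y in RHS]mlin_id proj_mlin mulr_mlin.
Qed.

Lemma coef1_linear (x : A) : linear (fun c : A => c@_mone *: x).
Proof. by move=> a c d; rewrite mcoeffD mcoeffZ scalerDl scalerA. Qed.


Lemma unshuffle_word1 : unshuffle_word mone = ten 1 1.
Proof. by rewrite -unshuffleW unshuffle1 ten11. Qed.

Lemma unshuffle_wordS n q : unshuffle_word (mmul (fmu n) q) =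
  (ten << fmu n >> 1 + ten 1 << fmu n >>) * unshuffle_word q.
Proof. by rewrite -!unshuffleW -malgUM unshuffleM unshuffleU. Qed.

Lemma unshuffle_wordSr n q : unshuffle_word (mmul q (fmu n)) =
  unshuffle_word q * (ten << fmu n >> 1 + ten 1 << fmu n >>).
Proof. by rewrite -!unshuffleW -malgUM unshuffleM unshuffleU. Qed.

Lemma conv_tenMl f g a b (w : A2) : linear f -> linear g ->
  conv f g (ten a b * w) = conv (fun c => f (a * c)) (fun d => g (b * d)) w.
Proof.
move=> fl gl; rewrite -[w in LHS]mlin_id.
have -> : ten a b * mlin (fun j => << j >>) w = mlin (fun j => ten a b * << j >>) w.
  exact: mulr_mlin.
rewrite conv_mlin [RHS]convE; apply: eq_mlin => -[u v] /=.
by rewrite -tenU tenM conv_ten.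
Qed.

Lemma conv_tenMr f g a b (w : A2) : linear f -> linear g ->
  conv f g (w * ten a b) = conv (fun c => f (c * a)) (fun d => g (d * b)) w.
Proof.
move=> fl gl; rewrite -[w in LHS]mlin_id.
have -> : mlin (fun j => << j >>) w * ten a b = mlin (fun j => << j >> * ten a b) w.
  exact: mlin_mulr.
rewrite conv_mlin [RHS]convE; apply: eq_mlin => -[u v] /=.
by rewrite -tenU tenM conv_ten.
Qed.

Lemma conv_mull f g a (w : A2) : conv (fun c => a * f c) g w = a * conv f g w.
Proof.
rewrite conv.unlock.
have -> : a * mlin (fun w => f << w.1 >> * g << w.2 >>) w =
          mlin (fun w => a * (f << w.1 >> * g << w.2 >>)) w by exact: mulr_mlin.
by apply: eq_mlin => v; rewrite mulrA.
Qed.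

Lemma conv_mulr f g a (w : A2) : conv f (fun c => g c * a) w = conv f g w * a.
Proof.
rewrite conv.unlock.
have -> : mlin (fun w => f << w.1 >> * g << w.2 >>) w * a =
          mlin (fun w => f << w.1 >> * g << w.2 >> * a) w by exact: mlin_mulr.
by apply: eq_mlin => v; rewrite mulrA.
Qed.

Lemma conv_Dr f g h (w : A2) : conv f (fun c => g c + h c) w = conv f g w + conv f h w.
Proof.
by rewrite conv.unlock -mlinDb; apply: eq_mlin => v; rewrite mulrDr.
Qed.

Lemma convD f g (v w : A2) : conv f g (v + w) = conv f g v + conv f g w.
Proof. exact: (linearD (conv f g)). Qed.

Lemma conv_wordS f g n q : linear f -> linear g ->
  conv f g (unshuffle_word (mmul (fmu n) q)) =
    conv (fun c => f (<< fmu n >> * c)) g (unshuffle_word q) +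
    conv f (fun d => g (<< fmu n >> * d)) (unshuffle_word q).
Proof.
move=> fl gl; rewrite unshuffle_wordS mulrDl convD.
congr (_ + _); apply: etrans (conv_tenMl _ _ _ fl gl) _.
  apply: eq_conv => x; first exact: erefl.
  by rewrite mul1r.
apply: eq_conv => x; last exact: erefl.
by rewrite mul1r.
Qed.

Lemma conv_wordSr f g n q : linear f -> linear g ->
  conv f g (unshuffle_word (mmul q (fmu n))) =
    conv (fun c => f (c * << fmu n >>)) g (unshuffle_word q) +
    conv f (fun d => g (d * << fmu n >>)) (unshuffle_word q).
Proof.
move=> fl gl; rewrite unshuffle_wordSr mulrDr convD.
congr (_ + _); apply: etrans (conv_tenMr _ _ _ fl gl) _.
  apply: eq_conv => x; first exact: erefl.
  by rewrite mulr1.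
apply: eq_conv => x; last exact: erefl.
by rewrite mulr1.
Qed.

Lemma conv0 f g (w : A2) : (forall u v, f << u >> * g << v >> = 0) -> conv f g w = 0.
Proof.
move=> E; rewrite conv.unlock /mlin big1 // => v _.
by rewrite E scaler0.
Qed.

Lemma coef1_fmuM n (c : A) : (<< fmu n >> * c)@_mone = 0.
Proof.
have -> : << fmu n >> * c = mlin (fun q => << fmu n >> * << q >>) c.
  by rewrite -mulr_mlin mlin_id.
apply: ((supportedP (predC1 mone) _).1); last by rewrite /= eqxx.
apply: (@supported_mlin _ _ _ predT) => // q _.
rewrite malgUM; apply: supportedU; apply/eqP => /(congr1 letters).
by rewrite lettersM lettersU letters1.
Qed.

Lemma coef1_Mfmu n (c : A) : (c * << fmu n >>)@_mone = 0.
Proof.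
have -> : c * << fmu n >> = mlin (fun q => << q >> * << fmu n >>) c.
  by rewrite -mlin_mulr mlin_id.
apply: ((supportedP (predC1 mone) _).1); last by rewrite /= eqxx.
apply: (@supported_mlin _ _ _ predT) => // q _.
rewrite malgUM; apply: supportedU; apply/eqP => /(congr1 letters)/(congr1 size).
by rewrite lettersM lettersU letters1 size_cat addn1.
Qed.

(** Counit axiom. Letters are peeled on the left here and on the right in [unshuffle_counitl], so
    that the surviving term is a multiple of the induction hypothesis. *)
Lemma unshuffle_counitr c :
  conv id (fun d => d@_mone *: 1) (unshuffle c) = c.
Proof.
rewrite -[c in LHS]mlin_id unshuffle_mlin conv_mlin -[RHS]mlin_id.
apply: eq_mlin => q; rewrite unshuffleW; elim/word_ind: q => [|n q IH].
  rewrite unshuffle_word1 conv_ten //; last exact: coef1_linear.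
  by rewrite mcoeffU1 eqxx scale1r mulr1.
rewrite conv_wordS //; last exact: coef1_linear.
rewrite -malgUM -IH -conv_mull -[RHS]addr0; congr (_ + _).
by apply: conv0 => u v; rewrite coef1_fmuM scale0r mulr0.
Qed.

Lemma proj0E c : proj 0 c = c@_mone *: 1.
Proof.
rewrite projE -[c in RHS]mlin_id (linear_mlin _ _ (coef1_linear 1)).
apply: eq_mlin => q; rewrite deg_eq0 mcoeffU1.
by case: eqP => [->|_]; rewrite ?scale1r ?scale0r.
Qed.

Lemma unshuffle_counitl (f : A -> A) c : linear f ->
  conv (proj 0) f (unshuffle c) = f c.
Proof.
move=> fl; rewrite -[c in LHS]mlin_id unshuffle_mlin conv_mlin -[c in RHS]mlin_id.
rewrite (linear_mlin _ _ fl); apply: eq_mlin => q; rewrite unshuffleW.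
(* The first factor is a scalar, so [f] can be pulled out and only the identity remains to be
   treated. *)
transitivity (f (conv (proj 0) id (unshuffle_word q))).
  rewrite -(mlin_id (unshuffle_word q)) !conv_mlin (linear_mlin _ _ fl).
  apply: eq_mlin => -[u v]; rewrite !convU !proj0E.
  by rewrite -!scalerAl !mul1r (linearZ_of fl).
congr (f _); elim/word_rind: q => [|n q IH].
  rewrite unshuffle_word1 conv_ten //; last exact: linearP.
  by rewrite projU deg1 eqxx mulr1.
rewrite conv_wordSr //; last exact: linearP.
rewrite conv_mulr IH malgUM conv0 ?add0r // => u v.
by rewrite proj0E coef1_Mfmu scale0r mul0r.
Qed.

Local Notation omega_coord := (omega_coord K).

Lemma omfS f n : omega_coord_rec K f.+1 n =
  n%:R *: << word1 n >> - \sum_(1 <= k < n) << word1 k >> * omega_coord_rec K f (n - k).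
Proof. by []. Qed.

Lemma omfE f n : (n <= f)%N -> omega_coord_rec K f n = omega_coord n.
Proof.
rewrite omega_coord.unlock; elim/ltn_ind: n f => n IH [|f]; first by rewrite leqn0 => /eqP->.
case: n IH => [|n] IH nf; last first.
  rewrite !omfS; apply: (congr1 (fun z => _ - z)); apply: eq_big_nat => k /andP[k0 kn].
  by apply: (congr1 (fun z => _ * z)); apply: etrans (IH _ _ _ _) (esym (IH _ _ _ _)); lia.
by rewrite omfS scale0r big_geq // subr0.
Qed.

Lemma omega_coord_step n :
  omega_coord n = n%:R *: << word1 n >> - \sum_(1 <= k < n) << word1 k >> * omega_coord (n - k).
Proof.
rewrite -(omfE (leqnSn n)) omfS; apply: (congr1 (fun z => _ - z)).
apply: eq_big_nat => k /andP[k0 kn]; apply: (congr1 (fun z => _ * z)).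
by apply: omfE; lia.
Qed.

Lemma word10 : word1 0 = mone.
Proof. by apply: letters_inj; rewrite letters_word1 letters1. Qed.

Lemma word1S n (n0 : (0 < n)%N) : word1 n = fmu (exist _ n n0).
Proof. by apply: letters_inj; rewrite letters_word1 lettersU; case: n n0. Qed.

Lemma deg_word1 n : deg (word1 n) = n.
Proof. by rewrite /deg letters_word1; case: n => //= n; rewrite addn0. Qed.

Lemma omega_coord_newton n : n%:R *: << word1 n >> = \sum_(k < n) << word1 k >> * omega_coord (n - k).
Proof.
case: n => [|n]; first by rewrite big_ord0 scale0r.
rewrite -(big_mkord xpredT (fun k => << word1 k >> * omega_coord (n.+1 - k))).
by rewrite big_ltn // word10 mul1r subn0 omega_coord_step subrK.
Qed.

Lemma omega_coord_homog n : homog n (omega_coord n).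
Proof.
elim/ltn_ind: n => n IH; rewrite omega_coord_step; apply: supportedB.
  by apply: supportedZ; apply: supportedU; rewrite deg_word1.
apply: supported_sum => k; rewrite mem_index_iota => /andP[k0 kn] _.
suff: homog (k + (n - k)) (<< word1 k >> * omega_coord (n - k)) by rewrite subnKC // ltnW.
by apply: homogM; [apply: supportedU; rewrite deg_word1|apply: IH; lia].
Qed.

(** Every correction term starts with a letter k < n, so only n Xi^n contributes. *)
Lemma omega_coord_lead n : (omega_coord n)@_(word1 n) = n%:R.
Proof.
rewrite omega_coord_step mcoeffB mcoeffZ mcoeffUU mulr1 raddf_sum /=.
rewrite big_nat big1 ?subr0 // => k /andP[k0 kn].
rewrite (word1S k0) -(mlin_id (omega_coord _)) mulr_mlin mcoeff_mlin.
rewrite big_seq big1 // => q qs; rewrite malgUM mcoeffU1.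
case: eqP => [E|]; rewrite ?mulr0 //.
have := omega_coord_homog qs; rewrite /in_mem /= => /eqP qd.
have := congr1 letters E; rewrite lettersM lettersU letters_word1.
case: (n) kn => //= m km [] km' q0; move: qd; rewrite km' subnn => /eqP.
by lia.
Qed.

Lemma sum_triangle (V : nmodType) n (F : nat -> nat -> V) :
  \sum_(k < n) \sum_(i < k.+1) F i (k - i)%N = \sum_(j < n) \sum_(i < n - j) F i j.
Proof.
elim: n => [|n IH]; first by rewrite !big_ord0.
rewrite big_ord_recr IH /=.
transitivity (\sum_(j < n) \sum_(i < n - j) F i j + \sum_(j < n.+1) F (n - j)%N j).
  congr (_ + _); rewrite (reindex_inj rev_ord_inj) /=; apply: eq_bigr => i _.
  by rewrite subSS subKn // -ltnS.
have -> : \sum_(j < n) \sum_(i < n - j) F i j = \sum_(j < n.+1) \sum_(i < n - j) F i j.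
  by rewrite big_ord_recr /= subnn big_ord0 addr0.
rewrite -big_split; apply: eq_bigr => j _ /=.
by rewrite subSn ?big_ord_recr // -ltnS.
Qed.

Lemma coprodX_word1 n :
  coprodX << word1 n >> = \sum_(k < n.+1) ten << word1 k >> << word1 (n - k) >> :> A2.
Proof.
rewrite coprodX.unlock mlinE1 /coprod_word letters_word1; case: n => [|n].
  by rewrite big_nil big_ord1 word10 ten11.
by rewrite big_seq1; apply: eq_bigr => k _; rewrite tenU.
Qed.

Lemma sum_triangleC (V : nmodType) n (F : nat -> nat -> V) :
  \sum_(k < n) \sum_(i < k.+1) F i (k - i)%N = \sum_(j < n) \sum_(i < n - j) F j i.
Proof.
rewrite -(sum_triangle n (fun i j => F j i)); apply: eq_bigr => k _.
rewrite (reindex_inj rev_ord_inj) /=; apply: eq_bigr => i _.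
by rewrite subSS subKn // -ltnS.
Qed.

Lemma om_newton_shift n j : (j <= n)%N ->
  \sum_(i < n - j) << word1 i >> * omega_coord (n - (i + j)) = (n - j)%:R *: << word1 (n - j) >>.
Proof.
move=> jn; rewrite omega_coord_newton; apply: eq_bigr => i _.
by rewrite addnC subnDA.
Qed.

Lemma tenM_prim a b x :
  ten a b * (ten x 1 + ten 1 x) = ten (a * x) b + ten a (b * x).
Proof. by rewrite mulrDr !tenM !mulr1. Qed.

(** Newton's recursion in each tensor factor. Once Xi^k is cut into Xi^i and Xi^j, the sum over the
    factor that meets omega is a multiple of a single Xi. The term Xi^k, Xi^(n-k) receives k from
    the left factor and n - k from the right one. *)
Lemma coprod_newton n :
  \sum_(k < n) coprodX << word1 k >> * (ten (omega_coord (n - k)) 1 + ten 1 (omega_coord (n - k))) =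
  n%:R *: coprodX << word1 n >>.
Proof.
pose F i j := ten (<< word1 i >> * omega_coord (n - (i + j))) << word1 j >>.
pose F' i j := ten << word1 i >> (<< word1 j >> * omega_coord (n - (j + i))).
transitivity (\sum_(k < n) \sum_(i < k.+1) F i (k - i)%N +
              \sum_(k < n) \sum_(i < k.+1) F' i (k - i)%N).
  rewrite -big_split; apply: eq_bigr => k _ /=.
  rewrite coprodX_word1 mulr_suml -big_split; apply: eq_bigr => i _ /=.
  have ik : (i <= k)%N by rewrite -ltnS.
  by rewrite tenM_prim /F /F' (subnK ik) (subnKC ik).
rewrite (sum_triangle n F) (sum_triangleC n F') coprodX_word1 scaler_sumr.
have -> : \sum_(j < n) \sum_(i < n - j) F i j =
    \sum_(j < n.+1) (n - j)%:R *: ten << word1 (n - j) >> << word1 j >>.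
  rewrite big_ord_recr /= subnn scale0r addr0; apply: eq_bigr => j _.
  by rewrite -ten_suml -tenZl om_newton_shift // ltnW.
have -> : \sum_(j < n) \sum_(i < n - j) F' j i =
    \sum_(j < n.+1) (n - j)%:R *: ten << word1 j >> << word1 (n - j) >>.
  rewrite big_ord_recr /= subnn scale0r addr0; apply: eq_bigr => j _.
  by rewrite -ten_sumr -tenZr om_newton_shift // ltnW.
rewrite [X in X + _](reindex_inj rev_ord_inj) -big_split /=.
apply: eq_bigr => k _; have kn : (k <= n)%N by rewrite -ltnS.
by rewrite subSS subKn // -scalerDl -natrD subnKC.
Qed.

(** The coproduct of Newton's recursion is compared with [coprod_newton]. By induction their terms
    with k >= 1 agree and cancel; the terms with k = 0 are the two sides of the claim. *)
Lemma omega_coord_prim n : prim coprodX (omega_coord n).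
Proof.
elim/ltn_ind: n => n IH; case: (posnP n) => [->|n0].
  rewrite (_ : omega_coord 0 = 0); first exact: prim0.
  by rewrite omega_coord_step scale0r big_geq // subr0.
have := coprod_newton n.
have <- : coprodX (n%:R *: << word1 n >>) = n%:R *: coprodX << word1 n >> by exact: linearZ.
rewrite omega_coord_newton (linear_sum coprodX).
rewrite -(big_mkord xpredT (fun k => coprodX << word1 k >> *
  (ten (omega_coord (n - k)) 1 + ten 1 (omega_coord (n - k))))).
rewrite -(big_mkord xpredT (fun k => coprodX (<< word1 k >> * omega_coord (n - k)))).
rewrite !(big_ltn n0) word10 coprodX1 !mul1r subn0.
have -> : \sum_(1 <= k < n) coprodX << word1 k >> *
    (ten (omega_coord (n - k)) 1 + ten 1 (omega_coord (n - k))) =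
    \sum_(1 <= k < n) coprodX (<< word1 k >> * omega_coord (n - k)).
  apply: eq_big_nat => k /andP[k0 kn]; rewrite coprodXM; apply: (congr1 (fun z => _ * z)).
  by rewrite (IH (n - k)%N) //; lia.
by move/addIr.
Qed.

End Action.

(** * Algebra maps defined by primitive generators *)

Definition gword (K : fieldType) (B : lalgType K) (g : posnat -> B) (q : word) : B :=
  \prod_(n <- (q : seq posnat)) g n.

HB.lock Definition lift (K : fieldType) (B : lalgType K) (g : posnat -> B) :
  {malg K[word]} -> B := mlin (gword g).

HB.lock Definition lift2 (K : fieldType) (g : posnat -> {malg K[word]}) :
    {malg K[(word * word)%type]} -> {malg K[(word * word)%type]} :=
  mlin (fun w => ten (gword g w.1) (gword g w.2)).

Section LiftLinear.
Variables (K : fieldType) (B : lalgType K) (g : posnat -> B).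
Variable (h : posnat -> {malg K[word]}).

Fact lift_is_linear : linear (lift g).
Proof. by rewrite lift.unlock; apply: linearP. Qed.
HB.instance Definition _ := GRing.isLinear.Build K _ _ *:%R (lift g) lift_is_linear.

Lemma lift_mlin (J : choiceType) (b : J -> {malg K[word]}) c :
  lift g (mlin b c) = mlin (fun j => lift g (b j)) c.
Proof. exact: (mlin_comp (lift g)). Qed.

Fact lift2_is_linear : linear (lift2 h).
Proof. by rewrite lift2.unlock; apply: linearP. Qed.
HB.instance Definition _ := GRing.isLinear.Build K _ _ *:%R (lift2 h) lift2_is_linear.

Lemma lift2_mlin (J : choiceType) (b : J -> {malg K[(word * word)%type]}) c :
  lift2 h (mlin b c) = mlin (fun j => lift2 h (b j)) c.
Proof. exact: (mlin_comp (lift2 h)). Qed.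

End LiftLinear.

Section Lift.
Variable K : fieldType.
Notation A := {malg K[word]}.
Notation A2 := {malg K[(word * word)%type]}.
Local Notation ten := (@ten K).
Local Notation proj := (@proj K).
Local Notation coprodX := (@coprodX K).
Local Notation unshuffle := (@unshuffle K).
Implicit Types c d x y : A.

Section LiftAlg.
Variables (B : lalgType K) (g : posnat -> B).

Lemma gwordM q r : gword g (mmul q r) = gword g q * gword g r.
Proof. by rewrite /gword fmM big_cat. Qed.

Lemma gword1 : gword g mone = 1.
Proof. by rewrite /gword fm1 big_nil. Qed.

Lemma gwordU n : gword g (fmu n) = g n.
Proof. by rewrite /gword fmU big_seq1. Qed.

Lemma liftE q : lift g << q >> = gword g q.
Proof. by rewrite lift.unlock mlinE1. Qed.

Lemma lift1 : lift g 1 = 1.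
Proof. by rewrite -gword1; apply: liftE. Qed.

Lemma liftM (scalerAr : forall (a : K) (x y : B), x * (a *: y) = a *: (x * y)) :
  {morph lift g : c d / c * d}.
Proof. by rewrite lift.unlock; apply: mlinM => // q r; apply: gwordM. Qed.
End LiftAlg.

Section PrimitiveGenerators.
Variable g : posnat -> A.
Hypothesis g_homog : forall n, homog (val n) (g n).
Local Notation G := (lift g).

Lemma lift_morph : {morph G : c d / c * d}.
Proof. exact/liftM/malg_scalerAr. Qed.

Lemma gword_homog q : homog (deg q) (gword g q).
Proof.
elim/word_ind: q => [|n q IH]; first by rewrite gword1 deg1; apply: homog1.
by rewrite gwordM gwordU degM degU; apply: homogM.
Qed.

Lemma lift_homog n c : homog n c -> homog n (G c).
Proof.
move=> cn; rewrite lift.unlock; apply: supported_mlin cn _ => q /eqP <-.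
exact: gword_homog.
Qed.

Lemma lift_proj n c : proj n (G c) = G (proj n c).
Proof.
apply: (@lin_ext _ _ _ (fun x => proj n (G x)) (fun x => G (proj n x))).
- by apply: linear_comp; exact: linearP.
- by apply: linear_comp; exact: linearP.
move=> q; rewrite projU liftE; case: eqP => [<-|/eqP qn].
  by rewrite liftE; apply/proj_id/gword_homog.
by rewrite linear0; apply: proj_neq qn; apply: gword_homog.
Qed.

Lemma lift_counit c : (G c)@_mone = c@_mone.
Proof.
apply: (@lin_ext _ K^o _ (fun x => (G x)@_mone) (fun x => x@_mone)) => [a x y|a x y|q].
- by rewrite linearP mcoeffD mcoeffZ.
- by rewrite mcoeffD mcoeffZ.
rewrite liftE mcoeffU1; case: eqP => [->|/eqP]; first by rewrite gword1 mcoeffU1 eqxx.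
by rewrite -deg_eq0 => q0; apply: homog_coef1 (@gword_homog q) q0.
Qed.

Local Notation G2 := (lift2 g).

Lemma lift2_ten c d : G2 (ten c d) = ten (G c) (G d).
Proof.
rewrite tenE lift2_mlin lift.unlock ten_mlinl; apply: eq_mlin => u.
rewrite lift2_mlin ten_mlinr; apply: eq_mlin => v.
by rewrite lift2.unlock mlinE1.
Qed.

Lemma lift2D (v w : A2) : G2 (v + w) = G2 v + G2 w.
Proof. exact: linearD. Qed.

Lemma lift2M : {morph G2 : c d / c * d}.
Proof.
rewrite lift2.unlock; apply: mlinM => [a x y|q r]; first exact: malg_scalerAr.
by rewrite !gwordM tenM.
Qed.

Hypothesis g_prim : forall n, prim coprodX (g n).

(** Both sides are algebra maps in c, and they agree on letters because [g n] is primitive. *)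
Lemma coprodX_lift c : coprodX (G c) = G2 (unshuffle c).
Proof.
rewrite -(mlin_id c) lift_mlin unshuffle_mlin coprodX_mlin lift2_mlin.
apply: eq_mlin => q; elim/word_ind: q => [|n q IH].
  by rewrite unshuffle1 lift1 coprodX1 -!ten11 lift2_ten lift1.
rewrite -malgUM unshuffleM lift2M -IH lift_morph coprodXM; apply: (congr1 (fun z => z * _)).
rewrite unshuffleU lift2D (lift2_ten _ 1) (lift2_ten 1) lift1 liftE gwordU.
exact: g_prim.
Qed.

Lemma conv_lift2 f (h : A -> A) (w : A2) : linear f -> linear h ->
  conv f h (G2 w) = conv (fun c => f (G c)) (fun d => h (G d)) w.
Proof.
move=> fl hl; rewrite -[w in LHS]mlin_id lift2_mlin conv_mlin convE.
by apply: eq_mlin => -[u v]; rewrite /= -tenU lift2_ten conv_ten.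
Qed.

Lemma lift_conv f (h : A -> A) (w : A2) :
  G (conv f h w) = conv (fun c => G (f c)) (fun d => G (h d)) w.
Proof. by rewrite !convE lift_mlin; apply: eq_mlin => v; rewrite lift_morph. Qed.

(** The action is built from coproduct, product, grading and counit, and [lift g] respects all
    four. *)
Lemma actw_lift u c : actw coprodX u (G c) = G (actw unshuffle u c).
Proof.
elim: u c => [|n u IH] c; first by rewrite /= lift_counit linearZ /= lift1.
rewrite !actw_cons /= coprodX_lift lift_conv conv_lift2; [|exact: linearP|exact: actw_linear].
by apply: eq_conv => d; [apply: lift_proj|apply: IH].
Qed.

Lemma act_lift a c : act coprodX a (G c) = G (act unshuffle a c).
Proof. by rewrite /act lift_mlin; apply: eq_mlin => u; rewrite actw_lift. Qed.

Lemma lift_prim c : prim unshuffle c -> prim coprodX (G c).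
Proof.
by rewrite /prim => cp; rewrite coprodX_lift cp lift2D !lift2_ten lift1.
Qed.

Hypothesis g_lead : forall n, (g n)@_(fmu n) != 0.

Definition glead (q : word) : K := \prod_(n <- (q : seq posnat)) (g n)@_(fmu n).

Definition longer (q r : word) :=
  (deg r == deg q) && (size (q : seq posnat) < size (r : seq posnat))%N.

Lemma size_mmul (q r : word) :
  size (mmul q r : seq posnat) = (size (q : seq posnat) + size (r : seq posnat))%N.
Proof. by rewrite fmM size_cat. Qed.

Lemma size_deg (q : word) : (size (q : seq posnat) <= deg q)%N.
Proof.
elim/word_ind: q => [|n q IH]; first by rewrite fm1.
rewrite size_mmul fmU degM degU leq_add //.
by case: n.
Qed.

Lemma deg_fmu n q : deg q == val n -> q != fmu n -> (1 < size (q : seq posnat))%N.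
Proof.
rewrite /deg; have: letters q = [seq val i | i <- (q : seq posnat)] by [].
case E: (q : seq posnat) => [|m [|? ?]] //= ->.
  by case: n => -[].
rewrite /= addn0 => /eqP/val_inj mn; case/eqP.
by rewrite -(fmK q) -(fmK (fmu n)) fmU E mn.
Qed.

Lemma mul_lead (u v z y : A) (a b : K) :
  (a *: u + z) * (b *: v + y) =
  (a * b) *: (u * v) + (a *: (u * y) + z * (b *: v + y)).
Proof.
rewrite mulrDl addrA; apply: (congr1 (fun t => t + _)).
by rewrite -scalerAl mulrDr malg_scalerAr scalerDr scalerA.
Qed.

(** In degree n the letter n is the only word of length 1, so [g n] is a multiple of it plus longer
    words; lengths add under concatenation. *)
Lemma gword_lead q : exists2 y, gword g q = glead q *: << q >> + y &
  supported (longer q) y.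
Proof.
have lead1 n : exists2 y, g n = (g n)@_(fmu n) *: << fmu n >> + y &
    supported (longer (fmu n)) y.
  exists (g n - (g n)@_(fmu n) *: << fmu n >>); first by rewrite addrCA subrr addr0.
  apply/supportedP => r; rewrite mcoeffB mcoeffZ mcoeffU1.
  case: eqP => [<- _|/eqP nr]; first by rewrite mulr1 subrr.
  rewrite mulr0 subr0 /longer degU fmU /= negb_and -leqNgt => /orP[rn|].
    exact: homog_coef0 (@g_homog n) rn.
  move=> r1; apply: homog_coef0 (@g_homog n) _.
  by apply: contraL r1 => rn; rewrite -ltnNge; apply: deg_fmu rn _; rewrite eq_sym.
elim/word_ind: q => [|n q [y gq yq]].
  exists 0; last exact: supported0.
  by rewrite gword1 /glead fm1 big_nil scale1r addr0.
have [z gz zn] := lead1 n.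
exists ((g n)@_(fmu n) *: (<< fmu n >> * y) + z * (glead q *: << q >> + y)).
  rewrite gwordM gwordU gq; apply: etrans (congr1 (fun t => t * _) gz) _.
  apply: etrans (mul_lead _ _ _ _ _ _) _; apply: (congr1 (fun t => t + _)).
  rewrite /glead fmM fmU big_cons; apply: (congr1 (fun t => _ *: t)).
  exact: malgUM.
apply: supportedD.
  apply/supportedZ/(supportedM (Q := pred1 (fmu n)) _ yq) => [|p r /eqP-> /andP[/eqP rd rs]].
    by apply: supportedU; rewrite /= eqxx.
  by rewrite /longer !degM rd eqxx !size_mmul fmU /= ltn_add2l.
apply: (supportedM (R := fun r => (deg r == deg q) && (size (q : seq posnat) <= size (r : seq posnat))%N) zn).
  apply: supportedD; first by apply/supportedZ/supportedU; rewrite eqxx leqnn.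
  by apply: sub_supported yq => r /andP[-> /ltnW].
move=> p r /andP[/eqP pd ps] /andP[/eqP rd rs].
by rewrite /longer !degM rd pd eqxx !size_mmul -addSn leq_add.
Qed.

Lemma glead_neq0 q : glead q != 0.
Proof. by rewrite /glead prodf_seq_neq0; apply/allP => n _; apply: g_lead. Qed.

Lemma gword_diag q : (gword g q)@_q = glead q.
Proof.
have [y -> /supportedP yq] := gword_lead q.
by rewrite mcoeffD mcoeffZ mcoeffUU mulr1 yq ?addr0 // /longer ltnn andbF.
Qed.

(** Degree minus length is a rank that drops along [longer]. Lengths never exceed degrees, so the
    truncated subtraction is exact. *)
Lemma gword_tri q r : r != q -> (gword g q)@_r != 0 ->
  (deg r - size (r : seq posnat) < deg q - size (q : seq posnat))%N.
Proof.
have [y -> /supportedP yq] := gword_lead q => rq.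
rewrite mcoeffD mcoeffZ mcoeffU1 [q == r]eq_sym (negbTE rq) mulr0 add0r => yr.
have /andP[/eqP rd rs] : longer q r by apply: contraNT yr => /yq->.
by have := size_deg q; have := size_deg r; lia.
Qed.

Lemma lift_injective : injective G.
Proof.
rewrite lift.unlock; apply: (triangular_inj (rk := fun q => (deg q - size (q : seq posnat))%N)).
  by move=> q; rewrite gword_diag glead_neq0.
exact: gword_tri.
Qed.

Lemma lift_surjective x : exists c, x = G c.
Proof.
rewrite lift.unlock; apply: (triangular_surj (rk := fun q => (deg q - size (q : seq posnat))%N)).
  by move=> q; rewrite gword_diag glead_neq0.
exact: gword_tri.
Qed.

End PrimitiveGenerators.
End Lift.

(** * The Dynkin operator and the free Lie algebra *)

Section Brackets.
Variables (K : fieldType) (M : lmodType K) (br : M -> M -> M) (h : posnat -> M).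
Notation A := {malg K[word]}.

Definition right_action (m : M) (q : word) : M :=
  foldl (fun m j => br m (h j)) m (q : seq posnat).

(* n1 [...[[h n1, h n2], h n3], ..., h nk] for q = n1.n2...nk *)
Definition left_bracket (q : word) : M :=
  if (q : seq posnat) is n :: t then
    (val n)%:R *: right_action (h n) (FMonom t)
  else 0.

Hypothesis br_linearl : forall z, linear (br^~ z).

Lemma right_actionM m q r : right_action m (mmul q r) = right_action (right_action m q) r.
Proof. by rewrite /right_action fmM foldl_cat. Qed.

Lemma right_action1 m : right_action m mone = m.
Proof. by rewrite /right_action fm1. Qed.

Lemma right_actionU m n : right_action m (fmu n) = br m (h n).
Proof. by rewrite /right_action fmU. Qed.

Lemma right_action_linear q : linear (right_action^~ q).
Proof.
elim/word_rind: q => [|n q IH] a x y; first by rewrite !right_action1.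
by rewrite !right_actionM !right_actionU IH; apply: br_linearl.
Qed.

Lemma left_bracket1 : left_bracket mone = 0.
Proof. by rewrite /left_bracket fm1. Qed.

Lemma left_bracketU n : left_bracket (fmu n) = (val n)%:R *: h n.
Proof. by rewrite /left_bracket fmU. Qed.

Lemma left_bracketM q r : q != mone ->
  left_bracket (mmul q r) = right_action (left_bracket q) r.
Proof.
rewrite /left_bracket fmM => q1; have : (q : seq posnat) <> [::].
  by move=> q0; case/eqP: q1; apply: word_nil; rewrite /letters q0.
case E: (q : seq posnat) => [|n t] //= _.
rewrite (linearZ_of (right_action_linear r)); congr (_ *: _).
by rewrite -right_actionM; congr right_action; rewrite -[RHS]fmK fmM.
Qed.
End Brackets.

Definition comm (K : fieldType) (x y : {malg K[word]}) := x * y - y * x.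

HB.lock Definition dynkin (K : fieldType) : {malg K[word]} -> {malg K[word]} :=
  mlin (left_bracket (@comm K) (fun n => << fmu n >>)).

Section Dynkin.
Variable K : fieldType.
Notation A := {malg K[word]}.
Notation A2 := {malg K[(word * word)%type]}.
Local Notation ten := (@ten K).
Local Notation proj := (@proj K).
Local Notation coprodX := (@coprodX K).
Local Notation unshuffle := (@unshuffle K).
Local Notation unshuffle_word := (@unshuffle_word K).
Local Notation conv := (@conv K).
Local Notation dynkin := (@dynkin K).
Local Notation omega_coord := (omega_coord K).
Implicit Types c d x y : A.

Fact dynkin_is_linear : linear dynkin.
Proof. by rewrite dynkin.unlock; apply: linearP. Qed.
HB.instance Definition _ := GRing.isLinear.Build K _ _ *:%R dynkin dynkin_is_linear.

Lemma mulr_linear x : linear (fun y => x * y).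
Proof. by move=> a y z; rewrite mulrDr malg_scalerAr. Qed.

Lemma mulrl_linear x : linear (fun y => y * x).
Proof. by move=> a y z; rewrite mulrDl scalerAl. Qed.

Lemma comm_linearl z : linear ((@comm K)^~ z).
Proof. exact/add_linear/opp_linear/mulr_linear/mulrl_linear. Qed.

Lemma dynkinW q : dynkin << q >> = left_bracket (@comm K) (fun n => << fmu n >>) q.
Proof. by rewrite dynkin.unlock mlinE1. Qed.

(** The last summand accounts for d = 1: a single letter n is sent to n times itself, whereas the
    commutator with the image 0 of the empty word vanishes. *)
Lemma dynkin_rcons n d : dynkin (d * << fmu n >>) =
  dynkin d * << fmu n >> - << fmu n >> * dynkin d + (d@_mone *: 1) * ((val n)%:R *: << fmu n >>).
Proof.
apply: (lin_ext (f := fun d => dynkin (d * << fmu n >>)) (h := fun d =>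
  dynkin d * << fmu n >> - << fmu n >> * dynkin d +
  (d@_mone *: 1) * ((val n)%:R *: << fmu n >>))).
- by apply: (linear_comp (f := dynkin)); [exact: linearP|exact: mulrl_linear].
- apply: add_linear.
    by apply: (linear_comp (f := fun z => comm z _)); [exact: comm_linearl|exact: linearP].
  by apply: (linear_comp (f := fun z => z * _)); [exact: mulrl_linear|exact: coef1_linear].
move=> q; rewrite malgUM mcoeffU1 !dynkinW; case: eqP => [->|/eqP q1].
  by rewrite mul1m left_bracketU left_bracket1 mul0r mulr0 subrr add0r scale1r mul1r.
rewrite (left_bracketM _ comm_linearl _ q1) right_actionU.
by rewrite scale0r mul0r addr0.
Qed.

Lemma letter_prim n : prim unshuffle << fmu n >>.
Proof. exact: unshuffleU. Qed.

Lemma dynkin_prim c : prim unshuffle (dynkin c).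
Proof.
rewrite dynkin.unlock; apply: (@prim_mlin _ unshuffle _ predT) => // q _.
elim/word_rind: q => [|n q IH]; first by rewrite left_bracket1; apply: prim0.
case: (eqVneq q mone) => [->|q1].
  by rewrite mul1m left_bracketU; apply/primZ/letter_prim.
rewrite (left_bracketM _ comm_linearl _ q1) right_actionU.
apply: prim_comm IH _; [exact: unshuffleM|exact: letter_prim].
Qed.

Definition degmul : A -> A := mlin (fun q => (deg q)%:R *: << q >>).

Lemma degmulU q : degmul << q >> = (deg q)%:R *: << q >>.
Proof. exact: mlinE1. Qed.

Lemma degmul_linear : linear degmul.
Proof. exact: linearP. Qed.

(** The operator form of Newton's recursion. When a last letter n is appended, the terms in which it
    joins the first factor cancel against the negative half of the commutator in [dynkin_rcons], and
    the correction term there adds n through the counit. *)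
Lemma conv_dynkin c : conv id dynkin (unshuffle c) = degmul c.
Proof.
apply: (lin_ext (f := fun c => conv id dynkin (unshuffle c)) (h := degmul)).
- by apply: (linear_comp (f := conv id dynkin)); exact: linearP.
- exact: degmul_linear.
move=> q; rewrite unshuffleW degmulU; elim/word_rind: q => [|n q IH].
  rewrite unshuffle_word1 conv_ten //; last exact: linearP.
  by rewrite dynkinW left_bracket1 mulr0 deg1 scale0r.
have dl : linear dynkin by exact: linearP.
have idl : linear (fun x : A => x) by [].
rewrite (conv_wordSr n q idl dl).
set w := unshuffle_word q in IH *.
have -> : conv id (fun d => dynkin (d * << fmu n >>)) w =
    conv id dynkin w * << fmu n >> - conv (fun c => c * << fmu n >>) dynkin w +
    conv id (fun d => d@_mone *: 1) w * ((val n)%:R *: << fmu n >>).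
  rewrite -!conv_mulr -[conv (fun c => c * _) _ _]opprK.
  have -> : - conv (fun c => c * << fmu n >>) dynkin w =
      conv id (fun d => - (<< fmu n >> * dynkin d)) w.
    rewrite !convE -scaleN1r -mlinZb; apply: eq_mlin => v.
    by rewrite scaleN1r mulrN mulrA.
  rewrite opprK -!conv_Dr; apply: eq_conv => // d; exact: dynkin_rcons.
rewrite IH /w -unshuffleW unshuffle_counitr addrA addrCA subrr addr0.
rewrite -scalerAl malg_scalerAr malgUM degM degU natrD scalerDl.
by [].
Qed.

Lemma proj_degmul n c : proj n (degmul c) = n%:R *: proj n c.
Proof.
apply: (lin_ext (f := fun c => proj n (degmul c)) (h := fun c => n%:R *: proj n c)).
- by apply: (linear_comp (f := proj n)); [exact: linearP|exact: degmul_linear].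
- by apply: scale_linear; exact: linearP.
move=> q; rewrite degmulU (linearZ_of (proj_linear n)) projU.
by case: eqP => [->|]; rewrite ?scaler0.
Qed.

(** The counit applied to the second factor of the primitivity equation gives x = x + [x@_mone]. *)
Lemma coef1_dynkin c : (dynkin c)@_mone = 0.
Proof.
have := dynkin_prim c; rewrite /prim => E.
have := congr1 (fun w => conv id (fun d => d@_mone *: 1) w) E.
rewrite unshuffle_counitr convD !conv_ten //; try exact: coef1_linear.
rewrite mcoeffU1 eqxx scale1r mulr1 mul1r -[LHS]addr0 => /addrI/esym/malgP/(_ mone).
by rewrite mcoeffZ mcoeffU1 eqxx mulr1 mcoeff0.
Qed.

Lemma act1 D c : act D 1 c = c@_mone *: 1 :> A.
Proof. by rewrite /act mlinE1 letters1. Qed.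

(** The letter n projects the first factor to degree n, and the empty rest applies the counit to the
    second. *)
Lemma act_word1 n c : act unshuffle << word1 n >> c = proj n c.
Proof.
case: (posnP n) => [->|n0]; first by rewrite word10 act1 proj0E.
rewrite (word1S n0) -[<< _ >>]mulr1 act_letterM /=.
rewrite -[c in RHS]unshuffle_counitr.
rewrite !convE proj_mlin; apply: eq_mlin => v; rewrite act1.
by rewrite !malg_scalerAr !mulr1 (linearZ_of (proj_linear n)).
Qed.

(** Since Xi^k acts by [proj k], Newton's recursion for [omega_coord] becomes the part of degree n
    of [conv_dynkin]. The terms with 0 < k < n cancel by induction, and the counit identifies the
    one with k = 0. *)
Lemma act_omega_coord n c : act unshuffle (omega_coord n) c = proj n (dynkin c).
Proof.
elim/ltn_ind: n c => n IH c; case: (posnP n) => [->|n0].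
  have -> : omega_coord 0 = 0 by rewrite omega_coord_step scale0r big_geq // subr0.
  rewrite proj0E coef1_dynkin scale0r.
  by rewrite /act linear0.
have actD := @act_linearl K unshuffle c.
have : n%:R *: act unshuffle << word1 n >> c =
    \sum_(k < n) act unshuffle (<< word1 k >> * omega_coord (n - k)) c.
  rewrite -(linearZ_of actD) omega_coord_newton.
  by apply: (big_morph (fun a => act unshuffle a c)) => [x y|]; rewrite /act ?linearD ?linear0.
rewrite act_word1 -proj_degmul -conv_dynkin.
have -> : proj n (conv id dynkin (unshuffle c)) =
    \sum_(k < n.+1) conv (proj k) (fun d => proj (n - k) (dynkin d)) (unshuffle c).
  rewrite convE proj_mlin; under [RHS]eq_bigr do rewrite convE.
  by rewrite -mlin_sumb; apply: eq_mlin => v; rewrite projM.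
(* The term k = n vanishes because [dynkin] has no constant coefficient. *)
rewrite big_ord_recr /= subnn [X in _ + X]conv0 ?addr0; last first.
  by move=> u v; rewrite proj0E coef1_dynkin scale0r mulr0.
rewrite -(big_mkord xpredT (fun k => conv (proj k) (fun d => proj (n - k) (dynkin d)) (unshuffle c))).
rewrite -(big_mkord xpredT (fun k => act unshuffle (<< word1 k >> * omega_coord (n - k)) c)).
rewrite !(big_ltn n0) subn0 word10 mul1r.
have -> : \sum_(1 <= k < n) act unshuffle (<< word1 k >> * omega_coord (n - k)) c =
    \sum_(1 <= k < n) conv (proj k) (fun d => proj (n - k) (dynkin d)) (unshuffle c).
  apply: eq_big_nat => k /andP[k0 kn].
  rewrite (word1S k0) act_letterM /=; apply: eq_conv => // d.
  by apply: IH; lia.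
move/addIr <-; apply: (unshuffle_counitl (f := fun d => proj n (dynkin d))).
by apply: (linear_comp (f := proj n)); exact: linearP.
Qed.

End Dynkin.

(** The word lists the leaves of the bracket tree. It records the multidegree of the element, hence
    its degree and the parity of its letters. *)
Inductive lie_tree (K : fieldType) : word -> {malg K[word]} -> Prop :=
| LieLetter n : lie_tree (fmu n) << fmu n >>
| LieBracket u v x y : lie_tree u x -> lie_tree v y -> lie_tree (mmul u v) (comm x y).

Section LieTree.
Variable K : fieldType.
Notation A := {malg K[word]}.
Local Notation unshuffle := (@unshuffle K).
Implicit Types x y : A.

Lemma lie_tree_perm u x : lie_tree u x ->
  supported (fun q : word => perm_eq (q : seq posnat) (u : seq posnat)) x.
Proof.
elim=> [n|{}u v {}x y _ ux _ vy]; first exact: supportedU.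
by apply: supportedB;
  [apply: supportedM ux vy _|apply: supportedM vy ux _] => q r qu rv;
  rewrite !fmM; [|rewrite perm_sym perm_catC perm_sym]; apply: perm_cat.
Qed.

Lemma perm_deg (q r : word) : perm_eq (q : seq posnat) (r : seq posnat) -> deg q = deg r.
Proof. by move=> qr; apply/perm_sumn/perm_map. Qed.

Lemma lie_tree_homog u x : lie_tree u x -> homog (deg u) x.
Proof. by move/lie_tree_perm; apply: sub_supported => q /perm_deg ->. Qed.

Lemma lie_tree_prim u x : lie_tree u x -> prim unshuffle x.
Proof.
elim=> [n|{}u v {}x y _ ux _ vy]; first exact: letter_prim.
by apply: prim_comm ux vy; apply: unshuffleM.
Qed.

Lemma lie_tree_deg u x : lie_tree u x -> (0 < deg u)%N.
Proof.
elim=> [n|{}u v {}x y _ ux _ vy]; first by rewrite degU; case: n.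
by rewrite degM addn_gt0 ux.
Qed.

Lemma lie_tree_coef1 u x : lie_tree u x -> x@_mone = 0.
Proof.
by move=> ux; apply: homog_coef1 (lie_tree_homog ux) _; rewrite -lt0n (lie_tree_deg ux).
Qed.
End LieTree.

Lemma natr_neq0 (K : fieldType) : [pchar K] =i pred0 ->
  forall n, (0 < n)%N -> n%:R != 0 :> K.
Proof. by move=> charK n n0; rewrite (pcharf0P K).1 // -lt0n. Qed.

(* On Lie elements y the right action [- . y] is the bracket with y, so that the
   left-normed bracketing, divided by the degree, is a Lie homomorphism: this
   replaces the embedding of M into its enveloping algebra. *)
Section FreeLie.
Variables (K : fieldType) (charK : [pchar K] =i pred0).
Variables (M : lieAlgebra K) (h : posnat -> M).
Notation A := {malg K[word]}.
Local Notation br := (@lie_bracket K M).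
Implicit Types x y : A.

Definition lie_ext : A -> M :=
  mlin (fun q => (deg q)%:R^-1 *: left_bracket br h q).

Definition ract (m : M) : A -> M := mlin (right_action br h m).

Definition lbr : A -> M := mlin (left_bracket br h).

Let brl z : linear (br^~ z). Proof. exact: lie_linear_l. Qed.
Let brr z : linear (br z). Proof. exact: lie_linear_r. Qed.

Lemma lie_brN (x y : M) : br x y = - br y x.
Proof.
apply/eqP; rewrite -addr_eq0; apply/eqP.
have := lie_alternating (x + y).
rewrite (linearD_of (brl (x + y))) !(linearD_of (brr _)) !lie_alternating.
by rewrite add0r addr0.
Qed.

Lemma lie_jacobir (m x y : M) : br (br m x) y - br (br m y) x = br m (br x y).
Proof.
have := lie_jacobi m x y; rewrite (lie_brN y (br m x)) => J.
rewrite (lie_brN x (br y m)) (lie_brN y m) in J.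
have brNl z t : br (- z) t = - br z t.
  by rewrite -scaleN1r (linearZ_of (brl t)) scaleN1r.
rewrite brNl opprK in J.
by apply/eqP; rewrite -subr_eq0 -oppr_eq0 !opprD !opprK -J addrC addrA addrAC.
Qed.

Lemma ract_linearl y : linear (ract^~ y).
Proof.
move=> a m m'; rewrite /ract -mlinZb -mlinDb; apply: eq_mlin => q.
exact: right_action_linear.
Qed.

Lemma ract_linear m : linear (ract m).
Proof. exact: linearP. Qed.

Lemma ractM m x y : ract m (x * y) = ract (ract m x) y.
Proof.
apply: (lin_ext (f := fun x => ract m (x * y)) (h := fun x => ract (ract m x) y)).
- by apply: (linear_comp (f := ract m)); [exact: ract_linear|exact: mulrl_linear].
- by apply: (linear_comp (f := ract^~ y)); [exact: ract_linearl|exact: ract_linear].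
move=> q; apply: (lin_ext (f := fun y => ract m (<< q >> * y))
  (h := fun y => ract (ract m << q >>) y)).
- by apply: (linear_comp (f := ract m)); [exact: ract_linear|exact: mulr_linear].
- exact: ract_linear.
by move=> r; rewrite malgUM /ract !mlinE1 right_actionM.
Qed.

Lemma lbr_linear : linear lbr.
Proof. exact: linearP. Qed.

(** The condition on x excludes the empty prefix, which [left_bracket] sends to 0. *)
Lemma lbrM x y : x@_mone = 0 -> lbr (x * y) = ract (lbr x) y.
Proof.
(* Subtracting the constant term turns the conditional claim into an identity linear in z, which can
   be checked on words. *)
move=> x0; suff E z : lbr ((z - z@_mone *: 1) * y) = ract (lbr (z - z@_mone *: 1)) y.
  by have := E x; rewrite x0 scale0r subr0.
have dl : linear (fun z : A => z - z@_mone *: 1).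
  by apply/add_linear/opp_linear/coef1_linear.
apply: (lin_ext (f := fun z : A => lbr ((z - z@_mone *: 1) * y))
  (h := fun z : A => ract (lbr (z - z@_mone *: 1)) y)).
- apply: (linear_comp (f := lbr)); first exact: lbr_linear.
  by apply: (linear_comp (f := fun z => z * y)); first exact: mulrl_linear.
- apply: (linear_comp (f := ract^~ y)); first exact: ract_linearl.
  by apply: (linear_comp (f := lbr)); first exact: lbr_linear.
move=> q; rewrite mcoeffU1; case: eqP => [->|/eqP q1].
  rewrite scale1r subrr mul0r /lbr linear0.
  by rewrite -[0 in RHS](scale0r 0) (linearZ_of (ract_linearl y)) scale0r.
rewrite scale0r subr0; apply: (lin_ext (f := fun y => lbr (<< q >> * y))
  (h := fun y => ract (lbr << q >>) y)).
- by apply: (linear_comp (f := lbr)); [exact: lbr_linear|exact: mulr_linear].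
- exact: ract_linear.
by move=> r; rewrite malgUM /lbr /ract !mlinE1 left_bracketM.
Qed.

Lemma lie_ext_linear : linear lie_ext.
Proof. exact: linearP. Qed.

Lemma lie_ext_homog n x : homog n x -> (0 < n)%N -> lbr x = n%:R *: lie_ext x.
Proof.
move=> xn n0; rewrite /lie_ext -mlinZb; apply: eq_in_mlin => q /xn.
rewrite /in_mem /= => /eqP ->; rewrite scalerA mulfV ?scale1r //.
exact: natr_neq0.
Qed.

Lemma lie_extU n : lie_ext << fmu n >> = h n.
Proof.
rewrite /lie_ext mlinE1 left_bracketU degU scalerA mulVf ?scale1r //.
by apply: natr_neq0 => //; case: n.
Qed.

(** With X and Y the images of x and y, the left-normed bracketing sends xy - yx to deg u [X, Y] -
    deg v [Y, X] = (deg u + deg v) [X, Y]; the degree is invertible in characteristic 0. *)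
Lemma lie_ext_comm_act u v x y : lie_tree u x -> lie_tree v y ->
  (forall m, ract m x = br m (lie_ext x)) -> (forall m, ract m y = br m (lie_ext y)) ->
  lie_ext (comm x y) = br (lie_ext x) (lie_ext y).
Proof.
move=> ux vy Sx Sy; have n0 : (0 < deg u + deg v)%N by rewrite addn_gt0 (lie_tree_deg ux).
have := lie_ext_homog (lie_tree_homog (LieBracket ux vy)); rewrite degM => /(_ n0).
rewrite /comm (linearB_of lbr_linear).
rewrite (lbrM y (lie_tree_coef1 ux)) (lbrM x (lie_tree_coef1 vy)) Sx Sy.
rewrite (lie_ext_homog (lie_tree_homog ux)) ?(lie_tree_deg ux) //.
rewrite (lie_ext_homog (lie_tree_homog vy)) ?(lie_tree_deg vy) //.
rewrite !(linearZ_of (brl _)) (lie_brN (lie_ext y)) scalerN opprK.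
rewrite -scalerDl -natrD => E.
exact: (scalerI (natr_neq0 charK n0) (esym E)).
Qed.

(** Induction on the tree: a commutator acts as the commutator of two bracketings, which by the
    Jacobi identity is bracketing with the bracket of the two images. *)
Lemma lie_ext_act u y : lie_tree u y -> forall m, ract m y = br m (lie_ext y).
Proof.
elim=> [n|{}u v x {}y ux IHx vy IHy] m.
  by rewrite lie_extU /ract mlinE1 right_actionU.
rewrite (lie_ext_comm_act ux vy IHx IHy) -lie_jacobir /comm.
rewrite (linearB_of (ract_linear m)) (ractM m x y) (ractM m y x).
by rewrite !IHx !IHy.
Qed.

Lemma lie_ext_comm u v x y : lie_tree u x -> lie_tree v y ->
  lie_ext (comm x y) = br (lie_ext x) (lie_ext y).
Proof. by move=> ux vy; apply: lie_ext_comm_act ux vy (lie_ext_act ux) (lie_ext_act vy). Qed.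

End FreeLie.

(** * Lyndon words and the primitive elements of the free algebra *)

Fixpoint slt (s t : seq nat) : bool :=
  match s, t with
  | _, [::] => false
  | [::], _ :: _ => true
  | x :: s', y :: t' => (x < y)%N || (x == y) && slt s' t'
  end.

Section LexOrder.
Implicit Types s t u v : seq nat.

Lemma ltEslt s t :
  ((s : preorder.Order.SeqLexiOrder.Exports.seqlexi nat) < t)%O = slt s t.
Proof.
elim: s t => [|x s IH] [|y t] //.
rewrite Order.SeqLexiOrder.ltxi_cons IH /= !Order.NatOrder.leEnat.
by case: (ltngtP x y).
Qed.

Lemma size_gt0 s : (0 < size s)%N = (s != [::]).
Proof. by case: s. Qed.

Lemma slt_irr s : slt s s = false.
Proof. by elim: s => //= x s ->; rewrite ltnn eqxx. Qed.

Lemma slt_trans t s u : slt s t -> slt t u -> slt s u.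
Proof.
elim: s t u => [|x s IH] [|y t] [|z u] //= /orP[xy|/andP[/eqP-> st]] /orP[yz|/andP[/eqP<- tu]].
- by rewrite (ltn_trans xy yz).
- by rewrite xy.
- by rewrite yz.
- by rewrite (IH _ _ st tu) eqxx orbT.
Qed.

Lemma slt_total s t : s != t -> slt s t || slt t s.
Proof.
elim: s t => [|x s IH] [|y t] //=.
rewrite eqseq_cons; case: (ltngtP x y) => //= _; exact: IH.
Qed.

Lemma slt_asym s t : slt s t -> ~~ slt t s.
Proof. by move=> st; apply/negP => /(slt_trans st); rewrite slt_irr. Qed.

Lemma slt_le_trans s t u : slt s t -> ~~ slt u t -> slt s u.
Proof.
move=> st ut; case: (eqVneq t u) => [<- //|/slt_total/orP[|tu]].
  exact: slt_trans.
by rewrite tu in ut.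
Qed.

Lemma le_slt_trans s t u : ~~ slt t s -> slt t u -> slt s u.
Proof.
move=> st tu; case: (eqVneq s t) => [-> //|/slt_total/orP[/slt_trans|ts]]; first exact.
by rewrite ts in st.
Qed.

Lemma slt_cat2l p s t : slt (p ++ s) (p ++ t) = slt s t.
Proof. by elim: p => //= x p ->; rewrite ltnn eqxx. Qed.

Lemma slt_prefix s t : t != [::] -> slt s (s ++ t).
Proof. by move=> t0; rewrite -{1}(cats0 s) slt_cat2l; case: t t0. Qed.

Lemma le_prefix s t : ~~ slt (s ++ t) s.
Proof. by case: t => [|x t]; rewrite ?cats0 ?slt_irr //; apply/slt_asym/slt_prefix. Qed.

(** Separates comparisons decided by the end of s from those decided by a letter; the latter survive
    any extension. *)
Lemma sltP s t : slt s t ->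
  (exists2 c : seq nat, c != [::] & t = s ++ c) \/ (forall a b, slt (s ++ a) (t ++ b)).
Proof.
elim: s t => [|x s IH] [|y t] //=; first by left; exists (y :: t).
case/orP=> [xy|/andP[/eqP<- /IH[[c c0 ->]|st]]].
- by right=> a b; rewrite xy.
- by left; exists c.
- by right=> a b; rewrite ltnn eqxx st.
Qed.

Lemma slt_cat_size s t a b : (size t <= size s)%N -> slt s t -> slt (s ++ a) (t ++ b).
Proof.
move=> ts /sltP[[c c0 tc]|//]; suff : false by [].
by move: ts c0; rewrite tc size_cat -size_gt0; lia.
Qed.

Lemma lyndonP s : reflect
  (s != [::] /\ forall a b : seq nat, a != [::] -> b != [::] -> s = a ++ b -> slt s b) (lyndon s).
Proof.
apply: (iffP andP) => -[s0 H]; split => //.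
  move=> a b a0 b0 sab; have /allP/(_ (size a)) := H.
  rewrite mem_iota ltEslt [in drop _ _]sab drop_size_cat //; apply.
  by move: a0 b0; rewrite sab size_cat -!size_gt0; lia.
apply/allP => k; rewrite mem_iota => k1; rewrite ltEslt; apply: (H (take k s)).
- by rewrite -size_gt0 size_take; case: ifP; lia.
- by rewrite -size_gt0 size_drop; lia.
- by rewrite cat_take_drop.
Qed.

(** One has uv < v, which settles the suffixes that lie in v. A suffix u'v with u' a proper suffix
    of u exceeds uv because u < u' and u is too long to be a prefix of u'. *)
Lemma lyndon_cat u v : lyndon u -> lyndon v -> slt u v -> lyndon (u ++ v).
Proof.
move=> /lyndonP[u0 uL] /lyndonP[v0 vL] uv.
have uvv : slt (u ++ v) v.
  case/sltP: (uv) => [[c c0 vc]|/(_ v [::])]; last by rewrite cats0.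
  by rewrite {2}vc slt_cat2l; apply: (vL u).
apply/lyndonP; split=> [|a b a0 b0 E]; first by case: (u) u0.
case: (leqP (size u) (size a)) => ua.
  have := congr1 (drop (size u)) E; rewrite drop_size_cat // drop_cat.
  case: ltngtP ua => // [ua _ vE|ua _]; last by rewrite ua subnn drop0 => <-.
  apply: slt_trans uvv _; apply: (vL (drop (size u) a)) => //.
  by rewrite -size_gt0 size_drop; lia.
have := congr1 (take (size a)) E; rewrite take_cat ua take_size_cat // => aE.
have uE : u = a ++ drop (size a) u by rewrite -{1}aE cat_take_drop.
have := congr1 (drop (size a)) E; rewrite drop_cat ua drop_size_cat // => <-.
have u'0 : drop (size a) u != [::] by rewrite -size_gt0 size_drop; lia.
have /sltP[[c c0 /(congr1 size)]|] := uL _ _ a0 u'0 uE; last by apply.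
by rewrite size_cat size_drop; move: a0 c0; rewrite -!size_gt0; lia.
Qed.

(** One step of the Chen-Fox-Lyndon factorisation, built from the right: a new factor absorbs its
    successor as long as it is smaller. *)
Fixpoint insert (u : seq nat) (t : seq (seq nat)) : seq (seq nat) :=
  if t is l :: t' then if slt u l then insert (u ++ l) t' else u :: t else [:: u].

Definition cfl (s : seq nat) : seq (seq nat) := foldr (fun x => insert [:: x]) [::] s.

Definition noninc := sorted (fun a b => ~~ slt a b).

Lemma noninc_trans : transitive (fun a b => ~~ slt a b).
Proof.
move=> y x z xy yz; apply: contra xy => /slt_le_trans; apply.
exact: yz.
Qed.

Lemma flatten_insert u (t : seq (seq nat)) : flatten (insert u t) = u ++ flatten t.
Proof.
elim: t u => [|l t IH] u //=; case: ifP => _ //=.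
by rewrite IH catA.
Qed.

Lemma flatten_cfl s : flatten (cfl s) = s.
Proof. by elim: s => //= x s IH; rewrite flatten_insert IH. Qed.

Lemma insert_lyndon u (t : seq (seq nat)) : lyndon u -> all lyndon t -> all lyndon (insert u t).
Proof.
elim: t u => [|l t IH] u /= uL; first by rewrite uL.
case/andP=> lL tL; case: ifP => ul /=; last by rewrite uL lL.
exact/IH/tL/lyndon_cat.
Qed.

Lemma cfl_lyndon s : all lyndon (cfl s).
Proof. by elim: s => //= x s; apply: insert_lyndon. Qed.

Lemma insert_noninc u (t : seq (seq nat)) : noninc t -> noninc (insert u t).
Proof.
elim: t u => [|l t IH] u //= tS; case: ifP => ul /=; last by rewrite ul.
exact/IH/(path_sorted tS).
Qed.

Lemma cfl_noninc s : noninc (cfl s).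
Proof. by elim: s => //= x s; apply: insert_noninc. Qed.

Lemma prefix_flatten (r a : seq nat) (ls : seq (seq nat)) : r != [::] -> r ++ a = flatten ls ->
  exists l p c r' : seq nat, [/\ l \in ls, p != [::], l = p ++ c & r = r' ++ p].
Proof.
elim: ls r => [|l ls IH] r r0 /= E; first by case: r r0 E.
case: (leqP (size r) (size l)) => rl.
  exists l, r, (drop (size r) l), [::]; split=> //; first by rewrite inE eqxx.
  rewrite -[LHS](cat_take_drop (size r)); congr (_ ++ _).
  have := congr1 (take (size r)) E; rewrite take_size_cat // take_cat.
  case: ltngtP rl => // rl _ E'; rewrite E' //.
  by rewrite rl subnn take0 cats0 take_size.
have E1 := congr1 (take (size l)) E; rewrite take_cat rl take_size_cat // in E1.
have E2 := congr1 (drop (size l)) E; rewrite drop_cat rl drop_size_cat // in E2.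
have r'0 : drop (size l) r != [::] by rewrite -size_gt0 size_drop; lia.
have [l' [p [c [r' [l'ls p0 l'E rE]]]]] := IH _ r'0 E2.
exists l', p, c, (l ++ r'); split=> //; first by rewrite inE l'ls orbT.
by rewrite -catA -rE -{1}E1 cat_take_drop.
Qed.

(** If m were longer than l, its part beyond l would end in a nonempty prefix p of a later factor
    l', whence m < p <= l' <= l <= m. *)
Lemma cfl_head l m (s t : seq (seq nat)) : all lyndon (l :: s) -> noninc (l :: s) -> lyndon m ->
  flatten (l :: s) = flatten (m :: t) -> (size m <= size l)%N.
Proof.
move=> /= /andP[lL sL] sS mL E; rewrite leqNgt; apply/negP => lm.
have E1 := congr1 (take (size l)) E; rewrite /= take_size_cat // take_cat lm in E1.
have E2 := congr1 (drop (size l)) E; rewrite /= drop_size_cat // drop_cat lm in E2.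
have r0 : drop (size l) m != [::] by rewrite -size_gt0 size_drop; lia.
have mE : m = l ++ drop (size l) m by rewrite {1}E1 cat_take_drop.
have [l' [p [c [r' [l's p0 l'E rE]]]]] := prefix_flatten r0 (esym E2).
have mp : slt m p.
  case/lyndonP: mL => _ /(_ (l ++ r') p); apply=> //; last by rewrite -catA -rE.
  by case: (l) lL.
have l'l : ~~ slt l l'.
  have := sS; rewrite /noninc /= path_sortedE; last exact: noninc_trans.
  by case/andP=> /allP/(_ _ l's).
have ml : ~~ slt m l by rewrite mE le_prefix.
have /negP := le_prefix p c; apply; rewrite -l'E.
apply: le_slt_trans l'l _; exact: le_slt_trans ml mp.
Qed.

Lemma cfl_uniq (s t : seq (seq nat)) : all lyndon s -> all lyndon t -> noninc s -> noninc t ->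
  flatten s = flatten t -> s = t.
Proof.
have nz (l : seq nat) x : lyndon l -> l ++ x <> [::] by case: l.
elim: s t => [|l s IH] [|m t] //.
- by move=> _ /andP[/nz mL _] _ _ /= E; case: (mL (flatten t)).
- by move=> /andP[/nz lL _] _ _ _ /= E; case: (lL (flatten s)).
move=> lsL mtL lsS mtS E; have /andP[lL sL] := lsL; have /andP[mL tL] := mtL.
have lm : size l = size m.
  by apply/eqP; rewrite eqn_leq (cfl_head mtL mtS lL (esym E)) (cfl_head lsL lsS mL E).
have /eqP := E; rewrite /= eqseq_cat // => /andP[/eqP-> /eqP st].
by congr (_ :: _); apply: IH => //; [apply: path_sorted lsS|apply: path_sorted mtS].
Qed.

Lemma flattenK (s : seq (seq nat)) : all lyndon s -> noninc s -> cfl (flatten s) = s.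
Proof.
move=> sL sS; apply: cfl_uniq => //; [exact: cfl_lyndon|exact: cfl_noninc|].
exact: flatten_cfl.
Qed.

Lemma cfl1 s : lyndon s -> cfl s = [:: s].
Proof. by move=> sL; rewrite -{1}[s]cats0 -[s ++ [::]]/(flatten [:: s]) flattenK //= sL. Qed.

Lemma insert_single u (t : seq (seq nat)) w : lyndon u -> all lyndon t -> t != [::] -> insert u t = [:: w] ->
  exists a b : seq nat, [/\ lyndon a, lyndon b, slt a b & w = a ++ b].
Proof.
elim: t u => // l t IH u uL /= /andP[lL tL] _; case: ifP => // ul.
case: t IH tL => [|m t] IH tL; first by case=> <-; exists u, l.
by apply: IH => //; apply: lyndon_cat.
Qed.

(** A Lyndon word is its own factorisation, so the last merge in [cfl] joins two Lyndon words a < b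
    to w. *)
Lemma lyndon_factor w : lyndon w -> (1 < size w)%N ->
  exists a b : seq nat, [/\ lyndon a, lyndon b, slt a b & w = a ++ b].
Proof.
case: w => // x w xwL /= w1; have := cfl1 xwL; rewrite /= => E.
apply: insert_single E; [by []|exact: cfl_lyndon|].
by apply: contraTneq w1 => w0; rewrite -[w]flatten_cfl w0.
Qed.

End LexOrder.

(** Zeros are dropped, so that weak compositions, such as the matrices in Mackey's formula, also
    denote words. *)
Definition wd (s : seq nat) : word := FMonom (pmap insub s).

Lemma letters_wd s : letters (wd s) = [seq x <- s | (0 < x)%N].
Proof.
rewrite /letters /wd /= (pmap_filter (insubK _)).
by apply: eq_filter => x /=; case: insubP => [u ->|/negbTE ->].
Qed.

Lemma letters_wd_pos s : all (ltn 0) s -> letters (wd s) = s.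
Proof. by move=> /all_filterP s0; rewrite letters_wd. Qed.

Lemma wd_letters q : wd (letters q) = q.
Proof. by apply: letters_inj; rewrite letters_wd_pos // all_letters. Qed.

Definition concat (s : seq word) : word := \big[@mmul _/mone]_(l <- s) l.

Lemma letters_concat s : letters (concat s) = flatten (map letters s).
Proof.
elim: s => [|l s IH]; first by rewrite /concat big_nil letters1.
by rewrite /concat big_cons lettersM IH.
Qed.

Definition fact (w : word) : seq word := map wd (cfl (letters w)).

Lemma letters_fact w : map letters (fact w) = cfl (letters w).
Proof.
rewrite -map_comp -[RHS]map_id; apply/eq_in_map => s sw /=.
apply: letters_wd_pos; apply/allP => x xs; have /allP := all_letters w; apply.
by rewrite -(flatten_cfl (letters w)); apply/flattenP; exists s.
Qed.

Lemma concat_fact w : concat (fact w) = w.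
Proof. by apply: letters_inj; rewrite letters_concat letters_fact flatten_cfl. Qed.

Definition lyndonw (w : word) := lyndon (letters w).

Definition nonincw (s : seq word) := noninc (map letters s).

Lemma fact_lyndon w : all lyndonw (fact w).
Proof. by have := cfl_lyndon (letters w); rewrite -letters_fact all_map. Qed.

Lemma fact_noninc w : nonincw (fact w).
Proof. by rewrite /nonincw letters_fact cfl_noninc. Qed.

Lemma fact_concat s : all lyndonw s -> nonincw s -> fact (concat s) = s.
Proof.
move=> sL sS; apply: (inj_map letters_inj); rewrite letters_fact letters_concat.
by rewrite flattenK // all_map.
Qed.

Lemma fact_lyndonw w : lyndonw w -> fact w = [:: w].
Proof. by move=> wL; rewrite /fact cfl1 //= wd_letters. Qed.

(** Restricted to rearrangements, the lexicographic order is finite, and equal lengths make it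
    compatible with concatenation on both sides. *)
Definition wgt (w q : word) : bool :=
  perm_eq (q : seq posnat) (w : seq posnat) && slt (letters w) (letters q).

Lemma size_letters (q : word) : size (letters q) = size (q : seq posnat).
Proof. exact: size_map. Qed.

Lemma wgt_size w q : wgt w q -> size (letters q) = size (letters w).
Proof. by case/andP => /perm_size qw _; rewrite !size_letters. Qed.

Lemma wgt_trans : transitive wgt.
Proof.
move=> v u w /andP[vu uv] /andP[wv vw]; rewrite /wgt (slt_trans uv vw) andbT.
exact: perm_trans wv vu.
Qed.

Lemma wgtMl p u q : wgt u q -> wgt (mmul p u) (mmul p q).
Proof. by case/andP=> qu uq; rewrite /wgt !lettersM slt_cat2l uq !fmM perm_cat2l qu. Qed.

Lemma wgtMr p u q : wgt u q -> wgt (mmul u p) (mmul q p).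
Proof.
move=> uq; have sz := wgt_size uq; case/andP: uq => qu uq.
by rewrite /wgt !lettersM !fmM perm_cat2r qu slt_cat_size // sz.
Qed.

(** * The PBW basis of Lyndon brackets *)

Section PBW.
Variables (K : fieldType) (charK : [pchar K] =i pred0).
Notation A := {malg K[word]}.
Notation A2 := {malg K[(word * word)%type]}.
Local Notation ten := (@ten K).
Local Notation unshuffle := (@unshuffle K).
Implicit Types x y : A.

Definition leads (w : word) x := exists2 y, x = << w >> + y & supported (wgt w) y.

Lemma leadsU w : leads w << w >>.
Proof. by exists 0; [rewrite addr0|apply: supported0]. Qed.


Lemma leadsM v w x y : leads v x -> leads w y -> leads (mmul v w) (x * y).
Proof.
move=> [x' -> vx] [y' -> wy].
exists (<< v >> * y' + x' * (<< w >> + y')).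
  by rewrite mulrDl mulrDr malgUM addrA.
apply: supportedD.
  apply: (supportedM (Q := pred1 v) _ wy) => [|q r /eqP-> ]; last exact: wgtMl.
  by apply: supportedU; rewrite /= eqxx.
apply: (supportedM (R := fun q => (q == w) || wgt w q) vx) => [|q r vq].
  apply: supportedD; first by apply: supportedU; rewrite eqxx.
  by apply: sub_supported wy => q ->; rewrite orbT.
by case/orP=> [/eqP-> |wr]; [|apply: wgt_trans (wgtMl _ wr)]; apply: wgtMr.
Qed.

Lemma supported_leads w x : leads w x -> supported (fun q => (q == w) || wgt w q) x.
Proof.
case=> y -> yw; apply: supportedD; first by apply: supportedU; rewrite eqxx.
by apply: sub_supported yw => q ->; rewrite orbT.
Qed.

(** From uv < v < vu the product yx only contributes words larger than uv. *)
Lemma leads_comm u v x y : lyndonw u -> lyndonw v -> slt (letters u) (letters v) ->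
  leads u x -> leads v y -> leads (mmul u v) (comm x y).
Proof.
move=> uL vL uv ux vy; have [z xy zuv] := leadsM ux vy.
exists (z - y * x); first by rewrite /comm xy addrA.
apply: supportedB zuv _; apply: sub_supported (supported_leads (leadsM vy ux)).
have vuw : wgt (mmul u v) (mmul v u).
  rewrite /wgt !fmM perm_catC perm_refl !lettersM /=.
  have /lyndonP[_ /(_ (letters u) (letters v))] := lyndon_cat uL vL uv.
  move=> /(_ _ _ erefl) uvv; apply: slt_trans (uvv _ _) (slt_prefix _ _).
  - by move: uL; rewrite /lyndonw; case: (letters u).
  - by move: vL; rewrite /lyndonw; case: (letters v).
  - by move: uL; rewrite /lyndonw; case: (letters u).
by move=> q /orP[/eqP->|/(wgt_trans vuw)].
Qed.

Lemma lyndon_tree w : lyndonw w -> exists x, lie_tree w x /\ leads w x.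
Proof.
have [m] := ubnP (size (letters w)); elim: m w => // m IH w wm wL.
case: (leqP (size (letters w)) 1) => w1.
  have [n ->] : exists n, w = fmu n.
    have lw : letters w = [seq val i | i <- (w : seq posnat)] by [].
    move: w1 wL; rewrite /lyndonw lw; case: (w : seq posnat) lw => [|n [|? ?]] //= lw.
    by exists n; apply: letters_inj; rewrite lw lettersU.
  by exists << fmu n >>; split; [apply: LieLetter|apply: leadsU].
have [a [b [aL bL ab wE]]] := lyndon_factor wL w1.
have w0 := all_letters w; rewrite wE all_cat in w0; have /andP[a0 b0] := w0.
have [u ua] := letters_surj a0; have [v vb] := letters_surj b0.
have wuv : w = mmul u v by apply: letters_inj; rewrite lettersM ua vb wE.
have := wm; rewrite wE size_cat => sz.
have [||x [ux xl]] := IH u; rewrite /lyndonw ?ua //.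
  by have := size_gt0 b; have /lyndonP[-> _] := bL; lia.
have [||y [vy yl]] := IH v; rewrite /lyndonw ?vb //.
  by have := size_gt0 a; have /lyndonP[-> _] := aL; lia.
exists (comm x y); rewrite wuv; split; first exact: LieBracket.
by apply: leads_comm => //; rewrite /lyndonw ?ua ?vb.
Qed.

(** Any bracketing with leading word w will do, so one is chosen; by [lyndon_tree] the default 0 is
    not reached for Lyndon words. *)
Definition lyn_elt (w : word) : A := classical_sets.xget 0 (fun x => lie_tree w x /\ leads w x).

Lemma lyn_eltP w : lyndonw w -> lie_tree w (lyn_elt w) /\ leads w (lyn_elt w).
Proof. by move=> /lyndon_tree wx; apply: (classical_sets.xgetPex 0 wx). Qed.

Definition pbw_seq (s : seq word) : A := \prod_(l <- s) lyn_elt l.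

Definition pbw (w : word) : A := pbw_seq (fact w).

Lemma pbw_seq_leads s : all lyndonw s -> leads (concat s) (pbw_seq s).
Proof.
elim: s => [|l s IH] /=; first by rewrite /concat /pbw_seq !big_nil; move=> _; apply: leadsU.
case/andP=> lL sL; rewrite /concat /pbw_seq !big_cons.
by apply: leadsM (IH sL); have [] := lyn_eltP lL.
Qed.

Lemma pbw_leads w : leads w (pbw w).
Proof. by rewrite -{1}(concat_fact w); apply/pbw_seq_leads/fact_lyndon. Qed.

Lemma pbw_concat s : all lyndonw s -> nonincw s -> pbw (concat s) = pbw_seq s.
Proof. by move=> sL sS; rewrite /pbw fact_concat. Qed.

Lemma pbw_lyndon w : lyndonw w -> pbw w = lyn_elt w.
Proof. by move=> wL; rewrite /pbw fact_lyndonw // /pbw_seq big_seq1. Qed.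

(** A numerical rank for the triangularity argument: a larger rearrangement has fewer rearrangements
    above it. *)
Definition wrank (w : word) : nat :=
  count (fun s : seq posnat => slt (letters w) (map val s)) (permutations (w : seq posnat)).

Lemma wrank_lt w q : wgt w q -> (wrank q < wrank w)%N.
Proof.
case/andP=> qw wq; rewrite /wrank (seq.permP (perm_permutations qw)).
set s := permutations _; set p := fun s => slt (letters q) _.
have qin : (q : seq posnat) \in s by rewrite mem_permutations.
have : (0 < count (pred1 (q : seq posnat)) s)%N by rewrite -has_count has_pred1.
have := count_predUI p (pred1 (q : seq posnat)) s.
rewrite (@eq_count _ (predI _ _) pred0) ?count_pred0; last first.
  move=> t /=; case: eqP => [->|]; last by rewrite andbF.
  by rewrite /p slt_irr.
have := sub_count (a1 := predU p (pred1 (q : seq posnat)))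
  (a2 := fun t => slt (letters w) (map val t)) _ s.
move=> /(_ _) U; rewrite addn0 => E c0.
apply: leq_trans (U _); first by rewrite E -addn1 leq_add2l.
by move=> t /= /orP[/(slt_trans wq)//|/eqP->].
Qed.

Lemma mcoeff_leads w x q : leads w x -> x@_q != 0 -> (q == w) || wgt w q.
Proof.
by move/supported_leads/supportedP=> xw; apply: contraNT => /xw->.
Qed.

Lemma leads_diag w x : leads w x -> x@_w = 1.
Proof.
case=> y -> /supportedP yw; rewrite mcoeffD mcoeffU1 eqxx yw ?addr0 //.
by rewrite /wgt slt_irr andbF.
Qed.

Lemma pbw_inj : injective (mlin pbw).
Proof.
apply: (triangular_inj (rk := wrank)) => [w|w q qw].
  by rewrite (leads_diag (pbw_leads w)) oner_neq0.
by move/(mcoeff_leads (pbw_leads w)); rewrite (negbTE qw) => /wrank_lt.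
Qed.

Lemma pbw_surj x : exists c, x = mlin pbw c.
Proof.
apply: (triangular_surj (rk := wrank)) => [w|w q qw].
  by rewrite (leads_diag (pbw_leads w)) oner_neq0.
by move/(mcoeff_leads (pbw_leads w)); rewrite (negbTE qw) => /wrank_lt.
Qed.

Definition pbw2 (w : word * word) : A2 := ten (pbw w.1) (pbw w.2).

Lemma pbw2_inj : injective (mlin pbw2).
Proof.
apply: (triangular_inj (rk := fun w => (wrank w.1 + wrank w.2)%N)) => [[u v]|[u v] [p q]].
  rewrite /pbw2 mcoeff_ten (leads_diag (pbw_leads u)) (leads_diag (pbw_leads v)).
  by rewrite mulr1 oner_neq0.
rewrite /pbw2 mcoeff_ten mulf_eq0 negb_or xpair_eqE /= => pq /andP[].
move=> /(mcoeff_leads (pbw_leads u)) up /(mcoeff_leads (pbw_leads v)) vq.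
case/orP: up pq => [/eqP->|/wrank_lt up]; case/orP: vq => [/eqP->|/wrank_lt vq] //.
- by rewrite !eqxx.
- by move=> _; lia.
- by move=> _; lia.
- by move=> _; lia.
Qed.

Lemma pbw1 : pbw mone = 1.
Proof. by rewrite /pbw /fact letters1 /pbw_seq big_nil. Qed.

Lemma pbw2_ten c d : mlin pbw2 (ten c d) = ten (mlin pbw c) (mlin pbw d).
Proof.
rewrite tenE (mlin_comp (mlin pbw2)) /= ten_mlinl; apply: eq_mlin => u.
rewrite (mlin_comp (mlin pbw2)) /= ten_mlinr; apply: eq_mlin => v.
exact: mlinE1.
Qed.

Fixpoint bits (n : nat) : seq bitseq :=
  if n is m.+1 then map (cons true) (bits m) ++ map (cons false) (bits m) else [:: [::]].

Definition comask (T : Type) (m : bitseq) (s : seq T) := mask (map negb m) s.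

Lemma bits_size n m : m \in bits n -> size m = n.
Proof.
elim: n m => [|n IH] m /=; first by rewrite inE => /eqP->.
by rewrite mem_cat => /orP[] /mapP[m' /IH <- ->].
Qed.

(** Each primitive factor goes to one of the two sides, and a bit mask records the choices. *)
Lemma unshuffle_prod (x : word -> A) (s : seq word) :
  (forall l, l \in s -> prim unshuffle (x l)) ->
  unshuffle (\prod_(l <- s) x l) =
  \sum_(m <- bits (size s)) ten (\prod_(l <- mask m s) x l) (\prod_(l <- comask m s) x l).
Proof.
elim: s => [|l s IH] xs; first by rewrite !big_nil big_seq1 !big_nil unshuffle1 ten11.
rewrite big_cons unshuffleM IH; last by move=> k ks; apply: xs; rewrite inE ks orbT.
rewrite xs ?inE ?eqxx //= big_cat !big_map mulrDl.
have mulS a b (F : bitseq -> A2) : ten a b * \sum_(m <- bits (size s)) F m =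
    \sum_(m <- bits (size s)) ten a b * F m by exact: mulr_sumr.
rewrite !mulS; congr (_ + _); apply: eq_bigr => m _; rewrite tenM mul1r.
  by rewrite /= big_cons.
by rewrite /comask /= big_cons.
Qed.

Lemma mask_lyndon m s : all lyndonw s -> all lyndonw (mask m s).
Proof. by move=> /allP sL; apply/allP => l /mem_mask/sL. Qed.

Lemma mask_noninc m s : nonincw s -> nonincw (mask m s).
Proof.
rewrite /nonincw map_mask; apply: subseq_sorted (mask_subseq _ _).
exact: noninc_trans.
Qed.

(** The coproduct of [pbw w] in the coordinates of [pbw2]. Sublists of a nonincreasing list of
    Lyndon words are again such lists, so each splitting is a single pair of basis indices. *)
Definition split_fact (w : word) : A2 :=
  \sum_(m <- bits (size (fact w))) << (concat (mask m (fact w)), concat (comask m (fact w))) >>.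

Lemma unshuffle_pbw c : unshuffle (mlin pbw c) = mlin pbw2 (mlin split_fact c).
Proof.
rewrite unshuffle_mlin (mlin_comp (mlin pbw2)) /=; apply: eq_mlin => w.
rewrite /split_fact (linear_sum (mlin pbw2)) /pbw /pbw_seq unshuffle_prod; last first.
  by move=> l /(allP (fact_lyndon w))/lyn_eltP[/lie_tree_prim].
apply: eq_bigr => m _; rewrite /= mlinE1 /pbw2 /= !pbw_concat //.
- exact/mask_lyndon/fact_lyndon.
- exact/mask_noninc/fact_noninc.
- exact/mask_lyndon/fact_lyndon.
- exact/mask_noninc/fact_noninc.
Qed.

Lemma prim_split c : prim unshuffle (mlin pbw c) ->
  mlin split_fact c = ten c 1 + ten 1 c.
Proof.
have one : mlin pbw 1 = 1 :> A by rewrite mlinE1 pbw1.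
move=> cp; apply: pbw2_inj; rewrite -unshuffle_pbw cp.
rewrite (linearD (mlin pbw2) (ten c 1) (ten 1 c)) /=.
by rewrite (pbw2_ten c 1) (pbw2_ten 1 c) one.
Qed.

Lemma ltn_neq_nil (s : seq word) l : all lyndonw (l :: s) -> concat (l :: s) != mone.
Proof.
case/andP=> lL _; apply: contraTneq lL => E; rewrite /lyndonw.
have := congr1 letters E; rewrite letters_concat letters1 /=.
by case: (letters l).
Qed.

Lemma concat_eq1 (s : seq word) : all lyndonw s -> concat s = mone -> s = [::].
Proof. by case: s => // l s lL /eqP; rewrite (negbTE (ltn_neq_nil lL)). Qed.

Lemma comask_perm (T : eqType) m (s : seq T) : size m = size s ->
  perm_eq (mask m s ++ comask m s) s.
Proof.
elim: m s => [|b m IH] [|x s] //= [sz]; rewrite /comask; case: b => /=.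
  by rewrite perm_cons; apply: IH.
by rewrite -cat1s perm_catCA perm_cons; apply: IH.
Qed.

(* The head Lyndon factor l of w and the concatenation of the others occur in the
   coproduct of pbw w' only for w' = w. *)
Lemma split_fact_uniq w l t m w' : fact w = l :: t -> m \in bits (size (fact w')) ->
  concat (mask m (fact w')) = l -> concat (comask m (fact w')) = concat t -> w' = w.
Proof.
move=> wE /bits_size msz ml mt.
have sL := fact_lyndon w; have sS := fact_noninc w; rewrite wE in sL sS.
have /andP[lL tL] := sL.
have tS : nonincw t by apply: path_sorted sS.
have L' := fact_lyndon w'; have S' := fact_noninc w'.
have ml' : mask m (fact w') = [:: l].
  rewrite -(fact_concat (mask_lyndon m L') (mask_noninc m S')) ml.
  exact: fact_lyndonw.
have mt' : comask m (fact w') = t.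
  rewrite -[LHS]fact_concat; [|exact: mask_lyndon|exact: mask_noninc].
  by rewrite mt; apply: fact_concat.
have P := comask_perm msz; rewrite ml' mt' /= in P.
rewrite -(concat_fact w') -(concat_fact w) wE; congr concat.
apply: (inj_map letters_inj); apply: (@sorted_eq _ (fun a b => ~~ slt a b)) => //.
- exact: noninc_trans.
- move=> a b /andP[ab ba]; apply/eqP; apply: contraT => /slt_total.
  by rewrite (negbTE ab) (negbTE ba).
- by apply: perm_map; rewrite perm_sym.
Qed.

Lemma bits_head n : (true :: nseq n false) \in bits n.+1.
Proof.
rewrite /= mem_cat; apply/orP; left; apply/mapP; exists (nseq n false) => //.
elim: n => [|n IH] //=; rewrite mem_cat; apply/orP; right.
by apply/mapP; exists (nseq n false).
Qed.

Lemma mcoeff_split_fact c p :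
  (mlin split_fact c)@_p = \sum_(w <- msupp c) c@_w *
     (count (fun m => (concat (mask m (fact w)), concat (comask m (fact w))) == p)
        (bits (size (fact w))))%:R.
Proof.
rewrite mcoeff_mlin; apply: eq_bigr => w _; congr (_ * _).
rewrite /split_fact raddf_sum /= -sum1_count natr_sum [RHS]big_mkcond /=.
by apply: eq_bigr => m _; rewrite mcoeffU1; case: eqP.
Qed.

(** Only w contributes to this coefficient, and its positive multiplicity is nonzero in
    characteristic 0. *)
Lemma split_fact_coef c w l t : fact w = l :: t ->
  (mlin split_fact c)@_(l, concat t) = 0 -> c@_w = 0.
Proof.
move=> wE; rewrite mcoeff_split_fact; case: (boolP (w \in msupp c)) => wc; last first.
  by move=> _; apply: mcoeff_outdom.
rewrite (big_fsetD1 w) //= big1_fset ?addr0 => [/eqP|w']; last first.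
  rewrite in_fsetD1 => /andP[ww' _] _; rewrite (_ : count _ _ = 0%N) ?mulr0 //.
  apply/eqP; rewrite -leqn0 leqNgt -has_count; apply/hasPn => m mb.
  apply: contra ww' => /eqP[ml mt]; apply/eqP; exact: split_fact_uniq wE mb ml mt.
rewrite mulf_eq0 => /orP[/eqP //|].
suff : (0 < count (fun m => (concat (mask m (fact w)), concat (comask m (fact w)))
    == (l, concat t)) (bits (size (fact w))))%N.
  by move=> /(natr_neq0 charK)/negbTE->.
rewrite -has_count; apply/hasP; exists (true :: nseq (size t) false).
  by rewrite wE; apply: bits_head.
rewrite wE /comask /= mask_false map_nseq /= mask_true // /concat big_seq1.
by [].
Qed.

(** In PBW coordinates the coproduct is [ten c 1 + ten 1 c], without terms that have two nonempty
    sides. This excludes words with at least two Lyndon factors; the empty word is excluded because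
    its coefficient would equal twice itself. *)
Theorem prim_lyndon x : prim unshuffle x ->
  exists2 c, supported lyndonw c & x = mlin lyn_elt c.
Proof.
have [c ->] := pbw_surj x => /prim_split cE.
have cL : supported lyndonw c.
  apply/supportedP => w wL; case E: (fact w) => [|l [|l' t]].
  - have w1 : w = mone by rewrite -(concat_fact w) E /concat big_nil.
    have := congr1 (fun z => z@_(mone, mone)) cE.
    rewrite /= mcoeffD !mcoeff_ten mcoeffU1 eqxx mulr1 mul1r mcoeff_split_fact.
    rewrite (_ : \sum_(_ <- _) _ = c@_mone) => [/eqP|].
      by rewrite -{1}[c@_mone]addr0 (inj_eq (addrI _)) eq_sym w1 => /eqP.
    have E1 w' : count (fun m => (concat (mask m (fact w')), concat (comask m (fact w')))
        == (mone, mone)) (bits (size (fact w'))) = (w' == mone).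
      case: (eqVneq w' mone) => [->|w'1]; first by rewrite /fact letters1 /= /concat !big_nil eqxx.
      apply/eqP; rewrite -leqn0 leqNgt -has_count; apply/hasPn => m /bits_size mb.
      apply: contra w'1 => /eqP[m1 m2]; have L' := fact_lyndon w'.
      have := comask_perm mb; rewrite /comask.
      rewrite (concat_eq1 (mask_lyndon _ L') m1) (concat_eq1 (mask_lyndon _ L') m2) /=.
      rewrite perm_sym => /perm_nilP f0.
      by rewrite -(concat_fact w') f0 /concat big_nil.
    under eq_bigr do rewrite E1.
    rewrite -[in RHS](mlin_id c) mcoeff_mlin; apply: eq_bigr => w' _.
    by rewrite mcoeffU1.
  - by case/negP: wL; have := fact_lyndon w; rewrite -{2}(concat_fact w) E /= andbT /concat big_seq1.
  have sL := fact_lyndon w; rewrite E in sL; have /andP[lL tL] := sL.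
  apply: split_fact_coef (E) _; rewrite cE mcoeffD !mcoeff_ten !mcoeffU1.
  have l1 : mone == l = false.
    by apply: contraTF lL => /eqP<-; rewrite /lyndonw letters1.
  by rewrite l1 eq_sym (negbTE (ltn_neq_nil tL)) mulr0 mul0r addr0.
exists c; first exact: cL.
by apply: eq_in_mlin => w /cL; apply: pbw_lyndon.
Qed.

Lemma lyn_elt_inj c d : supported lyndonw c -> supported lyndonw d ->
  mlin lyn_elt c = mlin lyn_elt d -> c = d.
Proof.
move=> cL dL E; apply: pbw_inj.
rewrite (eq_in_mlin (b' := lyn_elt)); last by move=> w /cL; apply: pbw_lyndon.
by rewrite E; apply: eq_in_mlin => w /dL /pbw_lyndon ->.
Qed.

(** Brackets are homogeneous for the multidegree, so [Q] and its complement split A. The part of c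
    outside [Q] yields an element of both summands, hence 0. *)
Lemma lyn_elt_supported (Q : pred word) c :
  (forall p q : word, perm_eq (p : seq posnat) (q : seq posnat) -> Q p = Q q) ->
  supported lyndonw c -> supported Q (mlin lyn_elt c) -> supported Q c.
Proof.
move=> Qperm cL; have [d [e [cde dQ eQ]]] := supported_split Q c => QE.
have lynQ (R : pred word) : (forall p q : word, perm_eq (p : seq posnat) (q : seq posnat) -> R p = R q) ->
    forall w, lyndonw w && R w -> supported R (lyn_elt w).
  move=> Rperm w /andP[/lyn_eltP[/lie_tree_perm wp _] Rw]; apply: sub_supported wp => q qw.
  by rewrite (Rperm q w qw).
suff e0 : e = 0 by rewrite cde e0 addr0.
have dL : supported lyndonw d.
  move=> w wd; apply: cL; rewrite -mcoeff_neq0 cde mcoeffD.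
  have -> : e@_w = 0 by apply: ((supportedP _ _).1 eQ); rewrite /= negbK; apply: dQ.
  by rewrite addr0 mcoeff_neq0.
have eL : supported lyndonw e.
  move=> w we; apply: cL; rewrite -mcoeff_neq0 cde mcoeffD.
  have -> : d@_w = 0 by apply: ((supportedP _ _).1 dQ); apply: eQ.
  by rewrite add0r mcoeff_neq0.
apply: lyn_elt_inj (eL) _ _; first exact: supported0.
rewrite linear0; apply: (supported_disjoint (Q := Q)).
  have -> : mlin lyn_elt e = mlin lyn_elt c - mlin lyn_elt d.
    by rewrite cde linearD /= addrAC subrr add0r.
  apply: supportedB QE _; apply: (supported_mlin (Q := fun w => lyndonw w && Q w)).
    by move=> w wd; rewrite /in_mem /=; apply/andP; split; [apply: dL|apply: dQ].
  exact: lynQ.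
apply: (supported_mlin (Q := fun w => lyndonw w && predC Q w)).
  by move=> w we; rewrite /in_mem /=; apply/andP; split; [apply: eL|apply: eQ].
by apply: lynQ => p q pq /=; rewrite (Qperm p q pq).
Qed.

End PBW.

(** * Mackey's formula for the inner product *)

(** These sequences index the terms of the coproduct of Xi^r, with [subr r a] on the other side. *)
Fixpoint subs (r : seq nat) : seq (seq nat) :=
  if r is n :: r' then [seq k :: a | k <- iota 0 n.+1, a <- subs r'] else [:: [::]].

Definition subr (r a : seq nat) : seq nat := [seq x.1 - x.2 | x <- zip r a]%N.

(* The matrices with row sums q and column sums r, read row after row. *)
Fixpoint mats (q r : seq nat) : seq (seq nat) :=
  if q is n :: q' then
    [seq a ++ m | a <- [seq a <- subs r | sumn a == n], m <- mats q' (subr r a)]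
  else if sumn r == 0%N then [:: [::]] else [::].

Fixpoint rowsum (k l : nat) (m : seq nat) : seq nat :=
  if k is k'.+1 then sumn (take l m) :: rowsum k' l (drop l m) else [::].

Fixpoint colsum (k l : nat) (m : seq nat) : seq nat :=
  if k is k'.+1 then [seq x.1 + x.2 | x <- zip (take l m) (colsum k' l (drop l m))]%N
  else nseq l 0%N.

Section Matrices.
Implicit Types q r a m : seq nat.

Lemma mem_subs r a : (a \in subs r) = (size a == size r) && all (fun x => x.2 <= x.1)%N (zip r a).
Proof.
elim: r a => [|n r IH] a; first by rewrite inE; case: a.
apply/allpairsP/andP => [[[k b] /= [kn br ->]]|].
  rewrite -[_ :: _]/(iota 0 n.+1) mem_iota ltnS /= in kn; move: br; rewrite IH => /andP[/eqP bs bl].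
  by rewrite /= bs kn.
case: a => [|k a] /= [] // as' /andP[kn al]; exists (k, a); split=> //=.
  by rewrite -[_ :: _]/(iota 0 n.+1) mem_iota ltnS.
by rewrite IH al andbT.
Qed.

Lemma subs_cons n r : subs (n :: r) = [seq k :: a | k <- iota 0 n.+1, a <- subs r].
Proof. by []. Qed.

Lemma subs_uniq r : uniq (subs r).
Proof.
elim: r => // n r IH; apply: (@allpairs_uniq _ _ _ cons _ _ (iota_uniq 0 n.+1) IH).
by move=> [x a] [y b] _ _ /= [-> ->].
Qed.

Lemma size_subr r a : size a = size r -> size (subr r a) = size r.
Proof. by move=> sa; rewrite size_map size_zip sa minnn. Qed.

Lemma sumn_subr r a : a \in subs r -> (sumn a + sumn (subr r a))%N = sumn r.
Proof.
elim: r a => [|n r IH] [|k a] //; try by rewrite mem_subs.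
rewrite mem_subs /= eqSS => /and3P[sa kn al].
by have := IH a; rewrite mem_subs sa al => /(_ isT) <-; rewrite /subr /=; lia.
Qed.

Lemma addseq_subr r a b : size b = size r -> a \in subs r ->
  (b == subr r a) = ([seq x.1 + x.2 | x <- zip a b]%N == r).
Proof.
elim: r a b => [|n r IH] [|k a] [|c b] //; try by rewrite mem_subs.
case=> sb; rewrite mem_subs /= eqSS => /and3P[sa kn al].
rewrite /subr /= !eqseq_cons; have := IH a b sb; rewrite mem_subs sa al => /(_ isT) <-.
congr (_ && _); apply/eqP/eqP; lia.
Qed.

Lemma size_colsum k l m : size m = (k * l)%N -> size (colsum k l m) = l.
Proof.
elim: k m => [|k IH] m sm /=; first by rewrite size_nseq.
rewrite size_map size_zip IH ?size_drop ?sm ?mulSn ?addKn //.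
by rewrite size_take sm mulSn; case: ltngtP; rewrite ?minnn; lia.
Qed.

Lemma addseq_subs r a b : size a = size r -> size b = size r ->
  [seq x.1 + x.2 | x <- zip a b]%N = r -> a \in subs r.
Proof.
elim: r a b => [|n r IH] [|k a] [|c b] // [sa] [sb] [<- abr].
have := IH a b sa sb abr; rewrite !mem_subs /= eqSS => /andP[-> ->].
by rewrite leq_addr.
Qed.

(** Links the recursive enumeration, which follows [actw], to the description by row and column
    sums, which arises from pairs of maps. *)
Lemma mem_mats q r m : (m \in mats q r) =
  [&& size m == (size q * size r)%N, rowsum (size q) (size r) m == q
    & colsum (size q) (size r) m == r].
Proof.
elim: q r m => [|n q IH] r m /=.
  case: eqP => r0.
    rewrite inE mul0n size_eq0; case: eqP => //= _; apply/esym/eqP.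
    elim: r r0 => //= x r IH /eqP; rewrite addn_eq0 => /andP[/eqP-> /eqP/IH<-].
    by rewrite size_nseq.
  rewrite in_nil; apply/esym/negbTE/negP => /andP[_ /eqP re].
  by apply: r0; rewrite -re sumn_nseq.
apply/idP/idP => [/allpairsPdep[a [b [+ + ->]]]|/and3P[/eqP sm re ce]].
  rewrite mem_filter => /andP[/eqP an ar]; have := ar; rewrite mem_subs => /andP[/eqP sa _].
  rewrite IH size_subr // => /and3P[/eqP sb /eqP rb cb].
  have ta : take (size r) (a ++ b) = a by rewrite take_size_cat.
  have db : drop (size r) (a ++ b) = b by rewrite drop_size_cat.
  apply/and3P; split; first by rewrite size_cat sa sb mulSn.
    by rewrite ta db an rb.
  by rewrite ta db; move: cb; rewrite addseq_subr // size_colsum.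
have sa : size (take (size r) m) = size r.
  by rewrite size_take sm mulSn; case: ltngtP; lia.
have sb : size (drop (size r) m) = (size q * size r)%N by rewrite size_drop sm mulSn addKn.
have sc := size_colsum sb.
have ar := addseq_subs sa sc (eqP ce).
apply/allpairsPdep; exists (take (size r) m), (drop (size r) m); split; last by rewrite cat_take_drop.
  by rewrite mem_filter ar andbT; move: re; rewrite eqseq_cons => /andP[].
rewrite IH size_subr // sb eqxx /= addseq_subr // ce andbT.
by move: re; rewrite eqseq_cons => /andP[].
Qed.

Lemma mats_uniq q r : uniq (mats q r).
Proof.
elim: q r => [|n q IH] r /=; first by case: ifP.
apply: allpairs_uniq_dep => [|a _|]; first exact/filter_uniq/subs_uniq.
  exact: IH.
move=> u v /allpairsPdep[a [b [+ _ ->]]] /allpairsPdep[a' [b' [+ _ ->]]] /=.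
rewrite !mem_filter !mem_subs => /and3P[_ /eqP sa _] /and3P[_ /eqP sa' _] /eqP.
rewrite eqseq_cat ?sa ?sa' // => /andP[/eqP aa' /eqP bb'].
by subst a' b'.
Qed.

Lemma mats_sumn q r m : m \in mats q r -> sumn q = sumn r.
Proof.
elim: q r m => [|n q IH] r m /=; first by case: eqP.
case/allpairsPdep => a [b [+ bm _]]; rewrite mem_filter => /andP[/eqP <- ar].
by rewrite (IH _ _ bm) sumn_subr.
Qed.

Lemma sumn_mats q r m : m \in mats q r -> sumn m = sumn r.
Proof.
elim: q r m => [|n q IH] r m /=; first by case: eqP => // r0; rewrite inE => /eqP->.
case/allpairsPdep => a [b [+ bm ->]]; rewrite mem_filter => /andP[_ ar].
by rewrite sumn_cat (IH _ _ bm) sumn_subr.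
Qed.

Lemma mkseq_cat (F : nat -> nat) k l :
  mkseq F (k + l) = mkseq F k ++ mkseq (fun i => F (k + i)%N) l.
Proof. by rewrite /mkseq iotaD map_cat add0n -{2}[k]addn0 iotaDl -map_comp. Qed.

Lemma rowsum_mkseq (F : nat -> nat) k l :
  rowsum k l (mkseq F (k * l)) = mkseq (fun i => \sum_(j < l) F (i * l + j)%N)%N k.
Proof.
elim: k F => [|k IH] F //=; rewrite mulSn mkseq_cat.
rewrite take_size_cat ?drop_size_cat ?size_mkseq // IH.
rewrite -[k.+1]add1n mkseq_cat /=; congr (_ :: _).
  by rewrite sumnE big_map -{1}(subn0 l) big_mkord.
by apply: eq_mkseq => i; apply: eq_bigr => j _; rewrite mulnDl mul1n addnA.
Qed.

Lemma colsum_mkseq (F : nat -> nat) k l :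
  colsum k l (mkseq F (k * l)) = mkseq (fun j => \sum_(i < k) F (i * l + j)%N)%N l.
Proof.
elim: k F => [|k IH] F /=.
  apply: (@eq_from_nth _ 0%N); rewrite ?size_nseq ?size_mkseq // => i il.
  by rewrite nth_nseq nth_mkseq // il big_ord0.
rewrite mulSn mkseq_cat take_size_cat ?drop_size_cat ?size_mkseq // IH.
apply: (@eq_from_nth _ 0%N); first by rewrite size_map size_zip !size_mkseq minnn.
move=> j; rewrite size_map size_zip !size_mkseq minnn => jl.
rewrite (nth_map (0, 0)%N) ?size_zip ?size_mkseq ?minnn // nth_zip ?size_mkseq //.
rewrite !nth_mkseq // big_ord_recl /= mul0n add0n; congr (_ + _)%N.
by apply: eq_bigr => i _; rewrite /bump /= mulnDl mul1n addnA.
Qed.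

Lemma scanl_pos s m i : (i \in s :: scanl addn s m) =
  (i \in s :: scanl addn s [seq x <- m | (0 < x)%N]).
Proof.
elim: m s => //= x m IH s; case: (posnP x) => [->|x0] /=.
  by rewrite addn0 -IH !inE orbA orbb.
by rewrite [LHS]inE [RHS]inE IH.
Qed.

End Matrices.

Section Splitting.
Variable K : fieldType.
Notation A := {malg K[word]}.
Notation A2 := {malg K[(word * word)%type]}.

(** A zero part repeats a partial sum or adds the partial sum 0, which is never a descent. *)
Lemma Xi_weak m : Xi K m = XiW K (wd m).
Proof.
apply/malgP => -[n p]; rewrite !Xi_coef letters_wd.
have -> : sumn [seq x <- m | (0 < x)%N] = sumn m.
  by elim: m => //= x m IH; case: (posnP x) => [->|_] /=; rewrite IH.
congr ((_ && _)%:R); apply: eq_forallb => i; case: (boolP (i \in Des p)) => //= /Des_gt0 i0.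
by have := scanl_pos 0 m i; rewrite !inE; case: eqP i0 => // ->.
Qed.

Lemma deg_wd m : deg (wd m) = sumn m.
Proof.
rewrite /deg letters_wd; elim: m => //= x m IH.
by case: (posnP x) => [->|_] /=; rewrite IH.
Qed.

Lemma wd_cat s t : wd (s ++ t) = mmul (wd s) (wd t).
Proof. by apply: letters_inj; rewrite lettersM !letters_wd filter_cat. Qed.

Lemma wd_cons n s : wd (n :: s) = mmul (word1 n) (wd s).
Proof.
by apply: letters_inj; rewrite lettersM !letters_wd letters_word1; case: n.
Qed.

Lemma wd_nil : wd [::] = mone.
Proof. by apply: letters_inj; rewrite letters_wd letters1. Qed.

Lemma coprodX_wd r : coprodX << wd r >> =
  \sum_(a <- subs r) << (wd a, wd (subr r a)) >> :> A2.
Proof.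
elim: r => [|n r IH]; first by rewrite wd_nil coprodX1 big_seq1 /subr /= wd_nil.
rewrite wd_cons -malgUM coprodXM IH coprodX_word1 subs_cons.
rewrite big_allpairs_dep -(big_mkord xpredT (fun k => ten << word1 k >> << word1 (n - k) >>)).
rewrite /index_iota subn0 mulr_suml; apply: eq_bigr => k _.
rewrite mulr_sumr; apply: eq_bigr => a _.
by rewrite -tenU tenM !malgUM tenU -!wd_cons.
Qed.

(** Each letter of q takes one row out of r, and the counit at the end requires the columns to be
    exhausted. *)
Lemma actw_mats q r : all (ltn 0) q ->
  actw (@coprodX K) q << wd r >> = \sum_(m <- mats q r) << wd m >>.
Proof.
elim: q r => [|n q IH] r /=.
  move=> _; rewrite mcoeffU1 -deg_eq0 deg_wd; case: eqP => r0.
    by rewrite big_seq1 wd_nil scale1r.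
  by rewrite scale0r big_nil.
case/andP=> n0 q0; rewrite coprodX_wd raddf_sum /= big_allpairs_dep /= big_filter.
rewrite [RHS]big_mkcond; apply: eq_bigr => a _.
rewrite mlinE1 /= projU deg_wd; case: eqP => _; last by rewrite mul0r.
rewrite IH // mulr_sumr; apply: eq_bigr => m _.
by rewrite malgUM wd_cat.
Qed.

End Splitting.

(** * Permutations as stable sorts *)

Section Sorting.
Variable n : nat.
Implicit Types (f : 'I_n -> nat) (s t : 'S_n).

Definition slex f (i j : 'I_n) := (f i < f j)%N || (f i == f j) && (i < j)%N.

Lemma sort_ex f : exists s, [forall i, forall j, (s i < s j)%N == slex f i j].
Proof.
(* Since i < n, this number compares by [f] first and by position second. *)
pose key (i : 'I_n) := (f i * n + i)%N.
have keyE i j : slex f i j = (key i < key j)%N.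
  have := ltn_ord i; have := ltn_ord j; rewrite /slex /key.
  case: (ltngtP (f i) (f j)) => [fij|fij|->] /= jn' in_; last by rewrite ltn_add2l.
    by have := leq_mul fij (leqnn n); rewrite mulSn; lia.
  by have := leq_mul fij (leqnn n); rewrite mulSn; lia.
have key_inj i j : key i = key j -> i = j.
  by move/(congr1 (modn^~ n)); rewrite /key !modnMDl !modn_small // => /val_inj.
pose r (i : 'I_n) := #|[set j : 'I_n | (key j < key i)%N]|.
have r_lt i j : (key i < key j)%N -> (r i < r j)%N.
  move=> ij; apply: proper_card; apply/properP; split.
    by apply/subsetP => k; rewrite !inE => /ltn_trans; apply.
  by exists i; rewrite inE ?ltnn.
have r_mono i j : (r i < r j)%N = (key i < key j)%N.
  apply/idP/idP; last exact: r_lt.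
  apply: contraTT; rewrite -!leqNgt leq_eqVlt => /orP[/eqP/key_inj -> //|/r_lt].
  exact: ltnW.
have r_n i : (r i < n)%N.
  rewrite -[ltnRHS](card_ord n) -cardsT; apply: proper_card.
  by apply/properP; split; [exact: subsetT|exists i; rewrite !inE ?ltnn].
pose g i := Ordinal (r_n i).
have g_inj : injective g.
  move=> i j /(congr1 val) /= rij; apply: key_inj.
  by case: (ltngtP (key i) (key j)) => // /r_lt; rewrite rij ltnn.
exists (perm g_inj); apply/forallP => i; apply/forallP => j.
by rewrite !permE /= r_mono keyE.
Qed.

(* [rho f] sends a value to its position in the stable sort by f. *)
Definition rho f : 'S_n := xchoose (sort_ex f).

Lemma rhoP f i j : (rho f i < rho f j)%N = slex f i j.
Proof. by have /forallP/(_ i)/forallP/(_ j)/eqP := xchooseP (sort_ex f). Qed.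

Lemma card_ord_lt (m : nat) : (m <= n)%N -> #|[set k : 'I_n | (k < m)%N]| = m.
Proof.
move=> mn; rewrite -sum1dep_card (big_ord_narrow mn) sum_nat_const card_ord.
exact: muln1.
Qed.

Lemma perm_order_inj s t : (forall i j, (s i < s j)%N = (t i < t j)%N) -> s = t.
Proof.
move=> st; apply/permP => i; apply/val_inj.
have cardE (u : 'S_n) : (u i : nat) = #|[set j | (u j < u i)%N]|.
  rewrite -[LHS](card_ord_lt (ltnW (ltn_ord (u i)))) -(card_preimset [set k : 'I_n | (k < u i)%N] (@perm_inj _ u)).
  by apply: eq_card => j; rewrite !inE.
rewrite /= cardE [RHS]cardE; apply: eq_card => j; by rewrite !inE st.
Qed.

Lemma rho_uniq f s : (forall i j, (s i < s j)%N = slex f i j) -> s = rho f.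
Proof. by move=> sP; apply: perm_order_inj => i j; rewrite sP rhoP. Qed.

Lemma slex_homo f i j : slex f i j -> (f i <= f j)%N.
Proof. by case/orP=> [/ltnW//|/andP[/eqP->]]. Qed.

(** Radix sort: a stable sort by [g] followed by one on the new positions orders pairs
    lexicographically; the bound [l] encodes a pair as one number. *)
Lemma rho_comp f g (l : nat) (g_lt : forall i, (g i < l)%N) :
  (rho g * rho f)%g = rho (fun v => f (rho g v) * l + g v)%N.
Proof.
apply: rho_uniq => i j; rewrite !permM rhoP /slex rhoP /slex.
move: (g_lt i) (g_lt j); case: (ltngtP (f (rho g i)) (f (rho g j))) => [fij|fij|->] gi gj /=.
- have : ((f (rho g i)).+1 * l <= f (rho g j) * l)%N by rewrite leq_mul2r fij orbT.
  by rewrite mulSn; lia.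
- have : ((f (rho g j)).+1 * l <= f (rho g i) * l)%N by rewrite leq_mul2r fij orbT.
  by rewrite mulSn; lia.
by rewrite ltn_add2l eqn_add2l.
Qed.

Definition ftype f (k : nat) : seq nat := mkseq (fun i => #|[set v | f v == i]|) k.

Lemma eq_ftype f g k : f =1 g -> ftype f k = ftype g k.
Proof. by move=> fg; apply: eq_mkseq => i; apply: eq_card => v; rewrite !inE fg. Qed.

Lemma ftype_perm f s k : ftype (fun v => f (s v)) k = ftype f k.
Proof.
apply: eq_mkseq => i; rewrite -(card_preimset [set v | f v == i] (@perm_inj _ s)).
by apply: eq_card => v; rewrite !inE.
Qed.

(** A nondecreasing map is the sorted list of its values, which is determined by their
    multiplicities. *)
Lemma ftype_homo f g k : (forall v, (f v < k)%N) -> (forall v, (g v < k)%N) ->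
  (forall i j : 'I_n, (i < j)%N -> (f i <= f j)%N) ->
  (forall i j : 'I_n, (i < j)%N -> (g i <= g j)%N) ->
  ftype f k = ftype g k -> f =1 g.
Proof.
move=> fk gk fS gS fg.
have S (h : 'I_n -> nat) : (forall i j : 'I_n, (i < j)%N -> (h i <= h j)%N) ->
    sorted leq [seq h i | i <- enum 'I_n].
  move=> hS; rewrite sorted_map.
  have hS' : subrel (relpre (@nat_of_ord n) ltn) (relpre h leq) by move=> i j; apply: hS.
  by apply: (sub_sorted hS'); rewrite -sorted_map val_enum_ord iota_ltn_sorted.
have C (h : 'I_n -> nat) i : count_mem i [seq h v | v <- enum 'I_n] = #|[set v | h v == i]|.
  rewrite count_map -size_filter cardE /enum_mem -enumT.
  rewrite /(enum _) /=; congr size; rewrite -filter_predI; apply: eq_filter => v.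
  by rewrite !inE /= ?andbT.
have : [seq f i | i <- enum 'I_n] = [seq g i | i <- enum 'I_n].
  apply: (sorted_eq leq_trans anti_leq) (S _ fS) (S _ gS) _.
  apply/allP => i _ /=; rewrite !C; apply/eqP.
  case: (ltnP i k) => ik.
    by have := congr1 (nth 0%N ^~ i) fg; rewrite !nth_mkseq.
  have Z (h : 'I_n -> nat) : (forall v, h v < k)%N -> #|[set v | h v == i]| = 0%N.
    move=> hk; apply: eq_card0 => v; rewrite inE.
    by apply: contraTF ik => /eqP<-; rewrite -ltnNge.
  by rewrite !Z.
by move/eq_in_map => fgE v; apply: fgE; rewrite mem_enum.
Qed.

End Sorting.

(** The index of the part of q that contains position a, both counted from 0. *)
Definition block (q : seq nat) (a : nat) := count (fun s => s <= a)%N (scanl addn 0%N q).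

Section Block.
Implicit Types q : seq nat.

Lemma block_homo q a b : (a <= b)%N -> (block q a <= block q b)%N.
Proof. by move=> ab; apply: sub_count => s /leq_trans; apply. Qed.

Lemma block_lt q a : (a < sumn q)%N -> (block q a < size q)%N.
Proof.
move=> aq; rewrite /block -(size_scanl addn 0%N q) ltn_neqAle count_size andbT.
rewrite -all_count; apply/negP => /allP H.
have q0 : q != [::] by apply: contraTneq aq => ->.
have := scanl_last 0%N q; case: q q0 H aq => // x q _ H aq E.
by have := H _ (mem_last _ (scanl addn (0 + x) q)); rewrite -[last _ _]/(last 0%N (scanl addn 0 (x :: q))) E; lia.
Qed.

Lemma blockS q a : block q a.+1 = (block q a + count_mem a.+1 (scanl addn 0%N q))%N.
Proof.
rewrite /block; elim: (scanl addn 0%N q) => //= s t ->.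
by case: (ltngtP s a.+1); lia.
Qed.

Lemma count_block q i : (i < size q)%N ->
  count (fun a => block q a == i) (iota 0 (sumn q)) = nth 0%N q i.
Proof.
(* The offset [m] lets the induction on q start at any partial sum. *)
suff H m : (i < size q)%N ->
    count (fun a => count (fun s => s <= a)%N (scanl addn m q) == i) (iota m (sumn q)) =
    nth 0%N q i by apply: H.
have scan_ge (s : seq nat) m' j : j \in scanl addn m' s -> (m' <= j)%N.
  elim: s m' => //= x s IH m'; rewrite inE => /orP[/eqP->|/IH]; first exact: leq_addr.
  by apply: leq_trans; apply: leq_addr.
elim: q i m => // x q IH i m /= iq; rewrite iotaD count_cat.
have -> : count (fun a => ((m + x <= a) + count (fun s => s <= a)
    (scanl addn (m + x) q) == i)%N) (iota m x) = (if i is 0%N then x else 0)%N.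
  rewrite (@eq_in_count _ _ (fun=> i == 0%N)); last first.
    move=> a; rewrite mem_iota => /andP[_ ax]; rewrite leqNgt ax add0n.
    rewrite (@eq_in_count _ _ pred0) ?count_pred0 ?[0%N == i]eq_sym // => s /scan_ge ms.
    by apply/negbTE; rewrite -ltnNge; apply: leq_trans ms.
  case: i {iq} => [|i]; last by rewrite count_pred0.
  by rewrite count_predT size_iota.
rewrite (@eq_in_count _ _ (fun a => (count (fun s => s <= a)%N
    (scanl addn (m + x) q)).+1 == i)%N); last first.
  by move=> a; rewrite mem_iota => /andP[-> _].
case: i iq => [|i] iq; first by rewrite (eq_count (a2 := pred0)) ?count_pred0 ?addn0.
rewrite add0n /= -(IH i (m + x)%N iq); by apply: eq_count => a; rewrite eqSS.
Qed.

End Block.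

(** * Bilinearity and associativity of the inner product *)

Section Inner.
Variable K : fieldType.
Notation KS := {malg K[gperm]}.
Notation A := {malg K[word]}.
Local Notation X := (mlin (XiW K)).

Definition ginner (g h : gperm) : KS :=
  if tag h == tag g then elt K (tagged g * tagged_as g h)%g else 0.

Lemma innerE x y : inner x y = mlin (fun g => mlin (ginner g) y) x.
Proof.
apply: eq_bigr => g _; rewrite /mlin scaler_sumr big_mkcond.
apply: eq_bigr => h _; rewrite /ginner; case: eqP => _; last by rewrite !scaler0.
by rewrite scalerA.
Qed.

Lemma inner_linearl y : linear (fun x : KS => inner x y).
Proof. by move=> a x z; rewrite !innerE linearP. Qed.

Lemma inner_linearr x : linear (fun y : KS => inner x y).
Proof.
move=> a y z; rewrite !innerE -mlinZb -mlinDb.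
by apply: eq_mlin => g; rewrite linearP.
Qed.

Lemma innerU g h : inner << g >> << h >> = ginner g h.
Proof. by rewrite innerE !mlinE1. Qed.

Lemma inner_elt n (p s : 'S_n) : inner (elt K p) (elt K s) = elt K (p * s)%g.
Proof. by rewrite innerU /ginner eqxx tagged_asE. Qed.

Lemma inner_neq m n (p : 'S_m) (s : 'S_n) : m != n -> inner (elt K p) (elt K s) = 0.
Proof. by rewrite innerU /ginner /= eq_sym => /negbTE->. Qed.

Lemma inner0l y : inner 0 y = 0 :> KS.
Proof. by rewrite innerE linear0. Qed.

Lemma inner0r x : inner x 0 = 0 :> KS.
Proof. by have := linearZ_of (inner_linearr x) 0 0; rewrite !scale0r. Qed.

Lemma innerA x y z : inner x (inner y z) = inner (inner x y) z :> KS.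
Proof.
apply: (lin_ext (f := fun x => inner x (inner y z)) (h := fun x => inner (inner x y) z)).
- exact: inner_linearl.
- by apply: (linear_comp (f := fun t => inner t z)); exact: inner_linearl.
move=> g; apply: (lin_ext (f := fun y => inner << g >> (inner y z))
  (h := fun y => inner (inner << g >> y) z)).
- by apply: (linear_comp (f := inner << g >>)); [exact: inner_linearr|exact: inner_linearl].
- by apply: (linear_comp (f := fun t => inner t z)); [exact: inner_linearl|exact: inner_linearr].
move=> h; apply: (lin_ext (f := fun z => inner << g >> (inner << h >> z))
  (h := fun z => inner (inner << g >> << h >>) z)).
- by apply: (linear_comp (f := inner << g >>)); exact: inner_linearr.
- exact: inner_linearr.
case: g h => m p [n s] [k t]; rewrite -!/(elt K _).
have [mn|nm] := eqVneq m n; last first.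
  rewrite (inner_neq p s nm) inner0l.
  have [nk|nk] := eqVneq n k; last by rewrite (inner_neq s t nk) inner0r.
  by subst k; rewrite inner_elt inner_neq.
subst n; rewrite inner_elt.
have [nk|nk] := eqVneq m k; last by rewrite (inner_neq s t nk) inner0r inner_neq.
by subst k; rewrite !inner_elt mulgA.
Qed.

Lemma inner_suml (I : Type) (r : seq I) (P : pred I) (F : I -> KS) y :
  inner (\sum_(i <- r | P i) F i) y = \sum_(i <- r | P i) inner (F i) y.
Proof.
apply: (big_morph (fun x => inner x y)); last exact: inner0l.
exact: linearD_of (inner_linearl y).
Qed.

Lemma inner_sumr (I : Type) (r : seq I) (P : pred I) (F : I -> KS) x :
  inner x (\sum_(i <- r | P i) F i) = \sum_(i <- r | P i) inner x (F i).
Proof.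
apply: (big_morph (inner x)); last exact: inner0r.
exact: linearD_of (inner_linearr x).
Qed.

End Inner.

Section XiSum.
Variable K : fieldType.

Lemma notin_Des n (p : 'S_n) (i j : 'I_n) : j.+1 = i -> i \notin Des p -> (p j < p i)%N.
Proof.
move=> ji; rewrite inE negb_exists => /forallP/(_ j).
rewrite ji eqxx /= -leqNgt leq_eqVlt => /orP[/eqP/val_inj/perm_inj E|//].
by move: ji; rewrite E => /eqP; rewrite eqn_leq ltnn.
Qed.

Lemma block_increasing (q : seq nat) n (p : 'S_n) :
  (forall i : 'I_n, i \in Des p -> (i : nat) \in scanl addn 0%N q) ->
  forall a b : 'I_n, (a < b)%N -> block q a = block q b -> (p a < p b)%N.
Proof.
move=> Dp a b; have [d] := ubnP (b - a); elim: d a b => // d IH a b bd ab Eab.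
have b0 : (0 < b)%N by apply: leq_trans ab.
have b'n : (b.-1 < n)%N by apply: leq_ltn_trans (ltn_ord b); apply: leq_pred.
pose b' := Ordinal b'n; have b'b : b'.+1 = b by rewrite /= prednK.
have ab' : (a <= b')%N by rewrite -ltnS b'b.
have Eb : block q b' = block q b.
  apply/eqP; rewrite eqn_leq block_homo ?leq_pred //= -Eab.
  exact: block_homo.
have pb : (p b' < p b)%N.
  apply: (notin_Des b'b); apply/negP => /Dp; apply/negP/count_memPn.
  have := blockS q b'; rewrite b'b Eb -{1}[block q b]addn0 => /eqP.
  by rewrite eqn_add2l => /eqP<-.
move: ab'; rewrite leq_eqVlt => /orP[/eqP/val_inj-> //|ab'].
apply: ltn_trans pb; apply: IH ab' _; last by rewrite Eab.
by move: bd; rewrite -b'b; lia.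
Qed.

(** A permutation with descents in D(q) increases on each block, so its inverse is the stable sort
    by the map that sends a value to the block of its position. Every map with fibre sizes q arises
    exactly once in this way. *)
Lemma Xi_sum (q : seq nat) n : sumn q = n ->
  Xi K q = \sum_(f : {ffun 'I_n -> 'I_(size q)} | ftype (fun v => f v) (size q) == q)
     elt K (rho (fun v => f v))^-1%g.
Proof.
move=> qn; subst n; rewrite /Xi Xi_setE.
pose h' (p : 'S_(sumn q)) : {ffun 'I_(sumn q) -> 'I_(size q)} :=
  [ffun v => Ordinal (block_lt (ltn_ord ((p^-1)%g v)))].
have h'E p v : h' p v = block q ((p^-1)%g v) :> nat by rewrite ffunE.
have DesP p : Des p \subset comp_set q ->
    forall i : 'I_(sumn q), i \in Des p -> (i : nat) \in scanl addn 0%N q.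
  by move=> /subsetP Dp i /Dp; rewrite inE.
rewrite (reindex_onto (fun f : {ffun 'I_(sumn q) -> 'I_(size q)} => (rho (fun v => f v))^-1%g) h'); last first.
  move=> p /DesP /block_increasing inc; rewrite -[RHS]invgK; congr (_^-1)%g.
  apply/esym/rho_uniq => i j; rewrite /slex !h'E.
  set a := (p^-1)%g i; set b := (p^-1)%g j.
  have -> : i = p a by rewrite permKV.
  have -> : j = p b by rewrite permKV.
  case: (ltngtP a b) => [ab|ba|/val_inj->]; last by rewrite !ltnn eqxx.
  - have := block_homo q (ltnW ab); rewrite leq_eqVlt => /orP[/eqP E|->//].
    by rewrite E eqxx ltnn (inc _ _ ab E).
  - have := block_homo q (ltnW ba); rewrite leq_eqVlt => /orP[/eqP E|E].
      by rewrite E eqxx ltnn /= ltnNge (ltnW (inc _ _ ba E)).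
    by rewrite ltnNge (ltnW E) gtn_eqF.
apply: eq_bigl => f; set r := rho _.
have fr v : (h' (r^-1)%g v : nat) = block q (r v) by rewrite h'E invgK.
have block_type : ftype (fun v : 'I_(sumn q) => block q v) (size q) = q.
  apply: (@eq_from_nth _ 0%N); rewrite ?size_mkseq // => i iq.
  rewrite nth_mkseq // -[RHS](count_block iq) -sum1dep_card.
  rewrite -(big_mkord (fun a => block q a == i) (fun=> 1%N)) /index_iota subn0.
  exact: sum1_count.
apply/andP/eqP => [[_ /eqP fE]|fq].
  rewrite -[RHS]block_type -(ftype_perm (fun v : 'I_(sumn q) => block q v) r); apply: eq_ftype => v.
  by rewrite /= -fr fE.
have fb v : (f ((r^-1)%g v) : nat) = block q v.
  move: v; apply: (@ftype_homo _ _ _ (size q)) => [v|v|i j ij|i j ij|].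
  - exact: ltn_ord.
  - exact/block_lt/ltn_ord.
  - apply: slex_homo (_ : slex (fun v => f v) _ _).
    by rewrite -rhoP -/r !permKV.
  - exact/block_homo/ltnW.
  - by rewrite block_type (ftype_perm (fun v => f v)).
split; last first.
  by apply/eqP/ffunP => v; apply/val_inj; rewrite /= fr -fb permK.
apply/subsetP => i; rewrite !inE => /existsP[j /andP[/eqP ji pij]].
apply/negPn/negP => /count_memPn c0.
have Ef : (f ((r^-1)%g i) : nat) = f ((r^-1)%g j).
  by rewrite !fb -ji blockS ji c0 addn0.
have : slex (fun v => f v) ((r^-1)%g j) ((r^-1)%g i).
  by rewrite -rhoP -/r !permKV -ji.
by rewrite /slex Ef ltnn eqxx /= ltnNge (ltnW pij).
Qed.

End XiSum.

(** * Products of the Xi^q as sums over matrices *)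

Section Mackey.
Variable K : fieldType.

Lemma eq_rho n (f g : 'I_n -> nat) : f =1 g -> rho f = rho g.
Proof. by move=> fg; apply: rho_uniq => i j; rewrite rhoP /slex !fg. Qed.

Lemma Xi_sum_size (q : seq nat) n k : sumn q = n -> size q = k ->
  Xi K q = \sum_(f : {ffun 'I_n -> 'I_k} | ftype (fun v => f v) k == q)
     elt K (rho (fun v => f v))^-1%g.
Proof. by move=> qn qk; subst k; apply: Xi_sum. Qed.

Section Pairing.
Variables n k l : nat.
Implicit Types (f : {ffun 'I_n -> 'I_k}) (g : {ffun 'I_n -> 'I_l}).

Lemma pair_lt (i : 'I_k) (j : 'I_l) : (i * l + j < k * l)%N.
Proof.
have : (i.+1 * l <= k * l)%N by rewrite leq_mul2r ltn_ord orbT.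
by rewrite mulSn; have := ltn_ord j; lia.
Qed.

Definition pairf (fg : {ffun 'I_n -> 'I_k} * {ffun 'I_n -> 'I_l}) : {ffun 'I_n -> 'I_(k * l)} :=
  [ffun v => Ordinal (pair_lt (fg.1 v) (fg.2 v))].

Lemma div_lt (c : 'I_(k * l)) : (c %/ l < k)%N.
Proof.
case: l c => [|l'] c; last by rewrite ltn_divLR.
by have := ltn_ord c; rewrite [X in (_ < X)%N]muln0.
Qed.

Lemma mod_lt (c : 'I_(k * l)) : (c %% l < l)%N.
Proof.
case: l c => [|l'] c; last by rewrite ltn_mod.
by have := ltn_ord c; rewrite [X in (_ < X)%N]muln0.
Qed.

Lemma pairf_bij : bijective pairf.
Proof.
exists (fun h : {ffun 'I_n -> 'I_(k * l)} =>
  ([ffun v => Ordinal (div_lt (h v))], [ffun v => Ordinal (mod_lt (h v))])).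
  move=> [f g]; congr pair; apply/ffunP => v; rewrite !ffunE; apply/val_inj => /=;
    have gl := ltn_ord (g v); have l0 : (0 < l)%N by apply: leq_ltn_trans gl.
    by rewrite divnMDl // divn_small // addn0.
  by rewrite modnMDl modn_small.
move=> h; apply/ffunP => v; rewrite !ffunE; apply/val_inj => /=.
by rewrite -divn_eq.
Qed.

Lemma pair_eq f g v i j : (j < l)%N ->
  ((pairf (f, g) v : nat) == i * l + j)%N = (f v == i :> nat) && (g v == j :> nat).
Proof.
move=> jl; rewrite ffunE /=; have gl := ltn_ord (g v).
have l0 : (0 < l)%N by apply: leq_ltn_trans jl.
apply/eqP/andP => [E|[/eqP-> /eqP->] //].
have := congr1 (divn^~ l) E; have := congr1 (modn^~ l) E => /=.
by rewrite !modnMDl !modn_small // !divnMDl // !divn_small // !addn0 => -> ->.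
Qed.

Lemma ftype_row f g :
  mkseq (fun i => \sum_(j < l) #|[set v | (pairf (f, g) v : nat) == i * l + j]|)%N k =
  ftype (fun v => f v) k.
Proof.
apply: eq_mkseq => i; rewrite -[RHS]sum1dep_card.
rewrite (partition_big (fun v => g v) predT) //=; apply: eq_bigr => j _.
by rewrite -sum1dep_card; apply: eq_bigl => v; rewrite pair_eq.
Qed.

Lemma ftype_col f g :
  ftype (fun v => g v) l =
  mkseq (fun j => \sum_(i < k) #|[set v | (pairf (f, g) v : nat) == i * l + j]|)%N l.
Proof.
apply: (@eq_from_nth _ 0%N); rewrite ?size_mkseq // => j jl; rewrite !nth_mkseq //.
rewrite -[LHS]sum1dep_card (partition_big (fun v => f v) predT) //=; apply: eq_bigr => i _.
by rewrite -sum1dep_card; apply: eq_bigl => v; rewrite pair_eq // andbC.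
Qed.

Lemma pairf_mats f g q r : size q = k -> size r = l ->
  (ftype (fun v => pairf (f, g) v) (k * l) \in mats q r) =
  (ftype (fun v => f v) k == q) && (ftype (fun v => g v) l == r).
Proof.
move=> qk rl; rewrite mem_mats qk rl size_mkseq eqxx /= rowsum_mkseq colsum_mkseq.
by rewrite ftype_row -ftype_col.
Qed.
End Pairing.

(** By [rho_comp], f and g contribute the permutation of v |-> (f (rho g v), g v). Composing f with
    the inverse of rho g keeps its fibre sizes and leaves the pair (f, g), whose fibre sizes form a
    matrix with row sums q and column sums r. *)
Lemma inner_Xi q r : inner (Xi K q) (Xi K r) = \sum_(m <- mats q r) Xi K m.
Proof.
case: (eqVneq (sumn q) (sumn r)) => [qr|qr]; last first.
  rewrite big_seq big1 => [|m /mats_sumn/eqP]; last by rewrite (negbTE qr).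
  rewrite /Xi !Xi_setE inner_suml big1 // => p _; rewrite inner_sumr big1 // => s _.
  exact: inner_neq.
set n := sumn r; set k := size q; set l := size r.
pose F (f : {ffun 'I_n -> 'I_k}) (g : {ffun 'I_n -> 'I_l}) : {malg K[gperm]} :=
  elt K (rho (fun v => pairf (f, g) v))^-1%g.
transitivity (\sum_(g : {ffun 'I_n -> 'I_l} | ftype (fun v => g v) l == r)
              \sum_(f : {ffun 'I_n -> 'I_k} | ftype (fun v => f v) k == q) F f g).
  rewrite (Xi_sum_size qr (erefl k)) (Xi_sum_size (erefl n) (erefl l)) inner_suml.
  under eq_bigr do rewrite inner_sumr.
  rewrite exchange_big; apply: eq_bigr => g _ /=.
  pose H (s : 'S_n) (f : {ffun 'I_n -> 'I_k}) : {ffun 'I_n -> 'I_k} := [ffun v => f (s v)].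
  have HK (s : 'S_n) : cancel (H s) (H s^-1%g).
    by move=> f; apply/ffunP => v; rewrite !ffunE permKV.
  have Hinj : injective (H (rho (fun v => g v))^-1%g) by apply: can_inj (HK _).
  rewrite (reindex_inj Hinj) /=; apply: eq_big => f.
    rewrite -(ftype_perm (fun v => f v) (rho (fun v => g v))^-1%g); congr (_ == _).
    by apply: eq_ftype => v; rewrite ffunE.
  move=> _; rewrite inner_elt -invMg (@rho_comp _ _ _ l) => [|v]; last exact: ltn_ord.
  congr (elt K _^-1)%g; apply: eq_rho => v; rewrite !ffunE /= permK.
  by [].
rewrite big_seq (eq_bigr (fun m =>
  \sum_(h : {ffun 'I_n -> 'I_(k * l)} | ftype (fun v => h v) (k * l) == m)
     elt K (rho (fun v => h v))^-1%g)); last first.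
  move=> m mm; apply: Xi_sum_size; first exact: sumn_mats mm.
  by have := mm; rewrite mem_mats => /and3P[/eqP].
rewrite -big_seq [RHS](exchange_big_dep xpredT) //=.
rewrite [RHS](eq_bigr (fun h : {ffun 'I_n -> 'I_(k * l)} =>
  if ftype (fun v => h v) (k * l) \in mats q r then elt K (rho (fun v => h v))^-1%g else 0)); last first.
  move=> h _; set t := ftype _ _; rewrite -big_filter.
  have -> : [seq m <- mats q r | t == m] = if t \in mats q r then [:: t] else [::].
    have := filter_pred1_uniq (mats_uniq q r) (x := t).
    case: ifP => [tm /(_ isT) <-|tm _]; first by apply: eq_filter => m; rewrite eq_sym.
    by apply/eqP; rewrite -[_ == _]negbK -has_filter; apply/negP => /hasP[m mm /eqP tE]; rewrite tE mm in tm.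
  by case: ifP => _; rewrite ?big_seq1 ?big_nil.
rewrite -[RHS]big_mkcond [RHS](reindex _ (onW_bij _ (pairf_bij n k l))) /=.
rewrite (exchange_big_dep xpredT) //= pair_big_dep /=; apply: eq_bigl => -[f g] /=.
by rewrite pairf_mats // andbC.
Qed.

Local Notation X := (mlin (XiW K)).

Lemma inner_actw u c : inner (XiW K u) (X c) = X (actw (@coprodX K) (letters u) c).
Proof.
apply: (lin_ext (f := fun c => inner (XiW K u) (X c))
  (h := fun c => X (actw (@coprodX K) (letters u) c))).
- by apply: (linear_comp (f := inner (XiW K u))); [exact: inner_linearr|exact: linearP].
- by apply: (linear_comp (f := X)); [exact: linearP|exact: actw_linear].
move=> r; rewrite mlinE1 inner_Xi -{2}(wd_letters r) actw_mats ?all_letters //.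
rewrite (linear_sum X); apply: eq_bigr => m _.
by rewrite /= mlinE1 Xi_weak.
Qed.

Lemma inner_act a c : inner (X a) (X c) = X (act (@coprodX K) a c).
Proof.
apply: (lin_ext (f := fun a => inner (X a) (X c))
  (h := fun a => X (act (@coprodX K) a c))).
- by apply: (linear_comp (f := fun t => inner t (X c))); [exact: inner_linearl|exact: linearP].
- by apply: (linear_comp (f := X)); [exact: linearP|exact: act_linearl].
by move=> u; rewrite /act !mlinE1 inner_actw.
Qed.

End Mackey.

(** * Coefficients of products in the descent algebra *)

Section DescentSide.
Variable K : fieldType.
Notation A := {malg K[word]}.
Notation A2 := {malg K[(word * word)%type]}.
Notation KS := {malg K[gperm]}.
Notation KS2 := {malg K[(gperm * gperm)%type]}.
Local Notation X := (mlin (XiW K)).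
Local Notation tg n p := (@Tagged nat n (fun k => 'S_k) p : gperm).

Lemma X_inj : injective X.
Proof. exact: can_inj (@Xi_coordK K). Qed.

Lemma X1 : X 1 = star_one K.
Proof. by rewrite mlinE1 /XiW letters1. Qed.

Lemma tensE (x y : KS) : tens x y = mlin (fun g => mlin (fun h => << (g, h) >>) y) x.
Proof.
apply: eq_bigr => g _; rewrite /mlin scaler_sumr; apply: eq_bigr => h _.
by rewrite scalerA; apply/malgP => k; rewrite mcoeffZ !mcoeffU mulr_natr.
Qed.

Lemma mcoeff_tens (x y : KS) g h : (tens x y)@_(g, h) = x@_g * y@_h.
Proof. by rewrite tensE mcoeff_mlin2. Qed.

Lemma tens_linearl (y : KS) : linear (fun x : KS => tens x y).
Proof. by move=> a x z; rewrite !tensE linearP. Qed.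

Lemma tens_linearr (x : KS) : linear (fun y : KS => tens x y).
Proof.
move=> a y z; rewrite !tensE -mlinZb -mlinDb.
by apply: eq_mlin => g; rewrite linearP.
Qed.

Lemma tens_X c d : tens (X c) (X d) = mlin (@tensW K) (ten c d).
Proof.
apply: (lin_ext (f := fun c => tens (X c) (X d)) (h := fun c => mlin (@tensW K) (ten c d))).
- by apply: (linear_comp (f := fun x => tens x (X d))); [exact: tens_linearl|exact: linearP].
- by apply: (linear_comp (f := mlin (@tensW K))); [exact: linearP|exact: ten_linl].
move=> u; apply: (lin_ext (f := fun d => tens (X << u >>) (X d))
  (h := fun d => mlin (@tensW K) (ten << u >> d))).
- by apply: (linear_comp (f := tens (X << u >>))); [exact: tens_linearr|exact: linearP].
- by apply: (linear_comp (f := mlin (@tensW K))); [exact: linearP|exact: ten_linr].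
by move=> v; rewrite tenU !mlinE1.
Qed.

(** A coefficient in one factor leaves an element on which the injectivity of [X] can be used; this
    is done for each factor in turn. *)
Lemma tensW_inj : injective (mlin (@tensW K)).
Proof.
suff H w : mlin (@tensW K) w = 0 -> w = 0.
  by move=> v w /eqP; rewrite -subr_eq0 -raddfB => /eqP/H/eqP; rewrite subr_eq0 => /eqP.
move=> w0.
have C g h : \sum_(uv <- msupp w) w@_uv * ((XiW K uv.1)@_g * (XiW K uv.2)@_h) = 0.
  have E := congr1 (fun z => z@_(g, h)) w0; rewrite mcoeff0 in E.
  by rewrite -[RHS]E mcoeff_mlin; apply: eq_bigr => uv _; rewrite /tensW mcoeff_tens.
have free c : X c = 0 -> c = 0 by move=> c0; apply: X_inj; rewrite c0 linear0.
pose cg g := mlin (fun uv : word * word => (XiW K uv.1)@_g *: << uv.2 >> : A) w.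
have cg0 g : cg g = 0.
  apply: free; apply/malgP => h; rewrite mcoeff0 -[RHS](C g h) /cg (mlin_comp X) /=.
  rewrite mcoeff_mlin; apply: eq_bigr => uv _.
  by rewrite (linearZ_of (f := X)) ?mlinE1 ?mcoeffZ //; exact: linearP.
pose dv v := mlin (fun uv : word * word => (uv.2 == v)%:R *: << uv.1 >> : A) w.
have dv0 v : dv v = 0.
  apply: free; apply/malgP => g; rewrite mcoeff0.
  transitivity ((cg g)@_v); last by rewrite cg0 mcoeff0.
  rewrite /dv (mlin_comp X) /= !mcoeff_mlin; apply: eq_bigr => uv _.
  rewrite (linearZ_of (f := X)) ?mlinE1 ?mcoeffZ ?mcoeffU1 //; last exact: linearP.
  by congr (_ * _); apply: mulrC.
apply/malgP => -[u v]; rewrite mcoeff0; transitivity ((dv v)@_u); last by rewrite dv0 mcoeff0.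
rewrite -[in LHS](mlin_id w) !mcoeff_mlin; apply: eq_bigr => -[u' v'] _.
by rewrite mcoeffZ !mcoeffU1 xpair_eqE /= -natrM mulnb andbC.
Qed.

Lemma coprod_X c : coprod (X c) = mlin (@tensW K) (coprodX c).
Proof. by rewrite /coprod Xi_coordK coprodX.unlock. Qed.

Lemma primitive_X (P : KS -> Prop) c : primitive P (X c) <-> P (X c) /\ prim (@coprodX K) c.
Proof.
rewrite /primitive /prim coprod_X -X1 !tens_X -(linearD (mlin (@tensW K))).
split=> -[Px E]; split; [exact: Px|exact: tensW_inj E|exact: Px|].
by apply: (congr1 (mlin (@tensW K))) E.
Qed.

Lemma homogeneousP n (x : KS) : homogeneous n x <-> supported (fun g => tag g == n) x.
Proof. by split=> xn g /xn /eqP. Qed.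

Lemma XiW_homogeneous q : supported (fun g => tag g == deg q) (XiW K q).
Proof.
apply/supportedP => -[n p] /= nq; rewrite Xi_coef -/(deg q).
by rewrite (negbTE nq).
Qed.

Lemma homogeneous_X n c : homogeneous n (X c) <-> homog n c.
Proof.
split=> [/homogeneousP Xn|cn]; last first.
  apply/homogeneousP/(supported_mlin cn) => q /eqP<-; exact: XiW_homogeneous.
pose kproj := mlin (fun g : gperm => if tag g == n then << g >> else 0 : KS).
have kl : linear kproj by exact: linearP.
have kprojX d : kproj (X d) = X (proj n d).
  apply: (lin_ext (f := fun d => kproj (X d)) (h := fun d => X (proj n d))).
  - by apply: (linear_comp (f := kproj)); [exact: kl|exact: linearP].
  - by apply: (linear_comp (f := X)); exact: linearP.
  move=> q; rewrite mlinE1 projU; case: eqP => [qn|/eqP qn].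
    rewrite mlinE1 -[RHS]mlin_id; apply: eq_in_mlin => g /XiW_homogeneous.
    by rewrite /in_mem /= qn => ->.
  rewrite linear0 /kproj (eq_in_mlin (b' := fun=> 0)).
    by rewrite /mlin big1 // => g _; rewrite scaler0.
  move=> g /XiW_homogeneous; rewrite /in_mem /= => /eqP->.
  by rewrite (negbTE qn).
have <- : proj n c = c; last exact: proj_homog.
apply: X_inj; rewrite -kprojX -[RHS]mlin_id; apply: eq_in_mlin => g /Xn.
by rewrite /in_mem /= => ->.
Qed.

Lemma elt_homogeneous n (p : 'S_n) : supported (fun g => tag g == n) (elt K p).
Proof. exact: supportedU. Qed.

Lemma descent_X n x : descent_comp n x -> exists2 c, homog n c & x = X c.
Proof.
move=> xD; have [c xc] := Xi_span xD; exists c => //; apply/homogeneous_X.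
rewrite -xc; apply/homogeneousP; case: xD => d _ ->.
apply: (@supported_mlin _ _ _ predT) => // D _; apply: supported_sum => p _ _.
exact: elt_homogeneous.
Qed.

(** A predicate on integers, so that descents can be shifted and compared between different
    symmetric groups. *)
Definition desn n (p : 'S_n) (i : nat) : bool := [exists j : 'I_n, (j == i :> nat) && (j \in Des p)].

Lemma desnE n (p : 'S_n) (i : 'I_n) : desn p i = (i \in Des p).
Proof.
by apply/existsP/idP => [[j /andP[/eqP/val_inj->]]|ip]; [|exists i; rewrite eqxx].
Qed.

Lemma desn_lt n (p : 'S_n) i : desn p i -> (0 < i < n)%N.
Proof. by case/existsP=> j /andP[/eqP<- /Des_gt0 ->] /=. Qed.

Lemma perm_with_descents n (D : pred nat) :
  exists p : 'S_n, forall i, desn p i = [&& 0 < i, i < n & D i]%N.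
Proof.
have [|p pD] := @Des_surj n [set i : 'I_n | (0 < i)%N && D i].
  by move=> i; rewrite inE => /andP[].
exists p => i; apply/existsP/and3P => [[j /andP[/eqP<-]]|[i0 ilt Di]].
  by rewrite pD inE => /andP[].
by exists (Ordinal ilt); rewrite pD inE i0 Di eqxx.
Qed.

Lemma XiW_coef q n (p : 'S_n) : (XiW K q)@_(tg n p) =
  ((n == deg q) && all (fun i => desn p i ==> (i \in scanl addn 0%N (letters q))) (iota 1 n.-1))%:R.
Proof.
rewrite Xi_coef; congr ((_ && _)%:R); apply/forallP/allP => H i.
  rewrite mem_iota => i1; have ilt : (i < n)%N by lia.
  by have := H (Ordinal ilt); rewrite -desnE.
apply/implyP; rewrite -desnE => pi; have := desn_lt pi => i0.
by have := H i; rewrite mem_iota pi; apply; lia.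
Qed.

Lemma scanl_shift a m r : scanl addn (a + m)%N r = map (addn a) (scanl addn m r).
Proof. by elim: r m => //= x r IH m; rewrite -addnA IH. Qed.

Lemma scanl_ge m r i : i \in scanl addn m r -> (m <= i)%N.
Proof.
elim: r m => //= x r IH m; rewrite inE => /orP[/eqP->|/IH]; first exact: leq_addr.
by apply: leq_trans; apply: leq_addr.
Qed.

Lemma mem_scanl_cat q r i : (0 < i)%N ->
  (i \in scanl addn 0%N (q ++ r)) =
  if (i < sumn q)%N then i \in scanl addn 0%N q
  else (i == sumn q) || (i - sumn q \in scanl addn 0%N r)%N.
Proof.
move=> i0; have fold m s : foldl addn m s = (m + sumn s)%N.
  by elim: s m => [|x s IH] m /=; rewrite ?addn0 // IH addnA.
have E := scanl_shift (sumn q) 0 r; rewrite addn0 in E; rewrite scanl_cat mem_cat fold add0n E.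
case: (ltngtP i (sumn q)) => iq /=.
- rewrite orbC; case: (boolP (i \in map _ _)) => // /mapP[j _ ij].
  by move: iq; rewrite ij ltnNge leq_addr.
- have -> : (i \in scanl addn 0%N q) = false.
    by apply/negbTE; apply: contraL iq => /scanl_le; rewrite add0n leqNgt.
  by rewrite -{1}(subnKC (ltnW iq)) mem_map //; apply: addnI.
- apply/orP; left; have := mem_last 0%N (scanl addn 0%N q).
  by rewrite scanl_last add0n -iq inE; case: (i) i0.
Qed.

(** Only the descents of the two parts are prescribed, since they determine the coefficients of
    elements of D. Whether p descends at a is forgotten. *)
Definition restricts n a b (p : 'S_n) (p1 : 'S_a) (p2 : 'S_b) :=
  [/\ n = (a + b)%N, forall i, desn p1 i = [&& 0 < i, i < a & desn p i]%N
    & forall i, desn p2 i = [&& 0 < i, i < b & desn p (a + i)]%N].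

Lemma restricts_exist n a b (p : 'S_n) : n = (a + b)%N ->
  exists (p1 : 'S_a) (p2 : 'S_b), restricts p p1 p2.
Proof.
move=> nab; have [p1 p1P] := perm_with_descents a (desn p).
have [p2 p2P] := perm_with_descents b (fun i => desn p (a + i)%N).
by exists p1, p2.
Qed.

(** The partial sums of q.r are those of q, ending with the cut, and the shifts of those of r. The
    condition on descents thus splits, and a descent at the cut is always allowed. *)
Lemma XiWM_coef q r n (p : 'S_n) (p1 : 'S_(deg q)) (p2 : 'S_(deg r)) :
  restricts p p1 p2 ->
  (XiW K (mmul q r))@_(tg n p) = (XiW K q)@_(tg (deg q) p1) * (XiW K r)@_(tg (deg r) p2).
Proof.
case=> nqr D1 D2; rewrite !XiW_coef degM (introT eqP nqr) !eqxx -natrM mulnb; congr (_%:R).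
rewrite lettersM /=.
congr nat_of_bool; apply/allP/andP => [H|[/allP H1 /allP H2] i].
  split; apply/allP => i; rewrite mem_iota => i1; apply/implyP.
    rewrite D1 => /and3P[i0 iq pi]; have := H i; rewrite mem_iota pi.
    by rewrite mem_scanl_cat // -/(deg q) iq; apply; lia.
  rewrite D2 => /and3P[i0 ir pi]; have := H (deg q + i)%N; rewrite mem_iota pi.
  rewrite mem_scanl_cat -/(deg q); last by lia.
  rewrite (ltnNge _ (deg q)) leq_addr /= addKn -[X in _ == X]addn0 eqn_add2l.
  by rewrite [i == 0%N]gtn_eqF //; apply; lia.
rewrite mem_iota => i1; apply/implyP => pi; have i0 : (0 < i)%N by lia.
rewrite mem_scanl_cat // -/(deg q); case: ltngtP => // iq.
  have := H1 i; rewrite mem_iota D1 i0 iq pi; apply; lia.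
have := H2 (i - deg q)%N; rewrite mem_iota D2 subnKC ?(ltnW iq) // pi !andbT.
have -> : (0 < i - deg q)%N by lia.
have -> : (i - deg q < deg r)%N by lia.
by apply; lia.
Qed.

Lemma XM_coef c d n a b (p : 'S_n) (p1 : 'S_a) (p2 : 'S_b) :
  homog a c -> homog b d -> restricts p p1 p2 ->
  (X (c * d))@_(tg n p) = (X c)@_(tg a p1) * (X d)@_(tg b p2).
Proof.
move=> ca db R; rewrite -[c in LHS]mlin_id mlin_mulr (mlin_comp X) /= mcoeff_mlin.
rewrite [(X c)@__]mcoeff_mlin mulr_suml; apply: eq_big_seq => q /ca.
rewrite /in_mem /= => /eqP qa; rewrite -mulrA; congr (_ * _).
rewrite -[d in LHS]mlin_id mulr_mlin (mlin_comp X) /= mcoeff_mlin.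
rewrite [(X d)@__]mcoeff_mlin mulr_sumr; apply: eq_big_seq => r /db.
rewrite /in_mem /= => /eqP rb; rewrite mulrCA; congr (_ * _).
by rewrite malgUM mlinE1; subst a b; apply: XiWM_coef.
Qed.

End DescentSide.

(** * The coefficients of omega_n *)

Section Omega.
Variable K : fieldType.
Notation A := {malg K[word]}.
Notation KS := {malg K[gperm]}.
Local Notation X := (mlin (XiW K)).
Local Notation omega_coord := (omega_coord K).
Local Notation tg n p := (@Tagged nat n (fun k => 'S_k) p : gperm).
Implicit Types D : pred nat.

Definition no_descent (n : nat) D := all (fun i => ~~ D i) (iota 1 n.-1).

Definition initial_descents (n k : nat) D := all (fun i => D i == (i <= k)%N) (iota 1 n.-1).

(** The coefficient of omega_n at a permutation with descents D; it is nonzero only if these form an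
    initial segment. *)
Definition omega_val (n : nat) D : K := \sum_(k < n) (-1) ^+ k * (initial_descents n k D)%:R.

Lemma eq_no_descent n D D' : (forall i, (0 < i < n)%N -> D i = D' i) ->
  no_descent n D = no_descent n D'.
Proof.
by move=> DD'; apply: eq_in_all => i; rewrite mem_iota => i1; rewrite DD' //; lia.
Qed.

Lemma eq_omega_val n D D' : (forall i, (0 < i < n)%N -> D i = D' i) ->
  omega_val n D = omega_val n D'.
Proof.
move=> DD'; apply: eq_bigr => k _; congr (_ * _%:R); congr nat_of_bool.
by apply: eq_in_all => i; rewrite mem_iota => i1; rewrite DD' //; lia.
Qed.

Lemma all_iotaS (P : pred nat) n : (0 < n)%N ->
  all P (iota 1 n) = P 1%N && all (fun i => P i.+1) (iota 1 n.-1).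
Proof.
case: n => // n _; rewrite /= -[2%N]/(1 + 1)%N iotaDl all_map.
by congr (_ && _); apply: eq_all => i /=; rewrite add1n.
Qed.

Lemma no_descentS n D : (0 < n)%N ->
  no_descent n.+1 D = ~~ D 1%N && no_descent n (fun i => D i.+1).
Proof. by move=> n0; rewrite /no_descent all_iotaS. Qed.

Lemma initial_descents0 n D : (0 < n)%N ->
  initial_descents n.+1 0 D = ~~ D 1%N && no_descent n (fun i => D i.+1).
Proof.
move=> n0; rewrite /initial_descents all_iotaS //=; congr (_ && _).
  by case: (D 1%N).
by apply: eq_all => i; case: (D i.+1).
Qed.

Lemma initial_descentsS n k D : (0 < n)%N ->
  initial_descents n.+1 k.+1 D = D 1%N && initial_descents n k (fun i => D i.+1).
Proof. by move=> n0; rewrite /initial_descents all_iotaS //= eqb_id. Qed.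

Lemma omega_valS n D : (0 < n)%N -> omega_val n.+1 D =
  if D 1%N then - omega_val n (fun i => D i.+1)
  else (no_descent n (fun i => D i.+1))%:R.
Proof.
move=> n0; rewrite /omega_val big_ord_recl expr0 mul1r initial_descents0 //.
rewrite (eq_bigr (fun k : 'I_n => - ((-1) ^+ k * (D 1%N && initial_descents n k (fun i => D i.+1))%:R))).
  case: (D 1%N) => /=; first by rewrite add0r sumrN.
  by rewrite big1 ?addr0 // => k _; rewrite mulr0 oppr0.
by move=> k _; rewrite lift0 initial_descentsS // exprS mulN1r mulNr.
Qed.

(** Induction by removing the first position. If it is a descent, only the term k = 1 survives;
    otherwise the terms with k >= 2 are the recursion for the shifted predicate. *)
Lemma omega_val_newton n D : (0 < n)%N ->
  \sum_(1 <= k < n) (no_descent k D)%:R * omega_val (n - k) (fun i => D (k + i)%N) =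
  n%:R * (no_descent n D)%:R - omega_val n D.
Proof.
elim: n D => // n IH D _; case: (posnP n) => [->|n0].
  by rewrite big_geq // /omega_val big_ord1 /= expr0 !mulr1 subrr.
rewrite big_ltn // subn1 /= mul1r big_add1 /=.
have -> : omega_val n (fun i => D (1 + i)%N) = omega_val n (fun i => D i.+1).
  by apply: eq_omega_val => i _; rewrite add1n.
have -> : \sum_(1 <= k < n) (no_descent k.+1 D)%:R * omega_val (n.+1 - k.+1) (fun i => D (k.+1 + i)%N)
    = (~~ D 1%N)%:R * \sum_(1 <= k < n) (no_descent k (fun i => D i.+1))%:R *
        omega_val (n - k) (fun i => D (k + i).+1).
  rewrite mulr_sumr; apply: eq_big_nat => k /andP[k0 kn].
  by rewrite no_descentS // subSS mulrA -natrM mulnb.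
rewrite (IH (fun i => D i.+1)) // no_descentS // omega_valS //.
case: (D 1%N) => /=; first by rewrite !mul0r mulr0 addr0 sub0r opprK.
by rewrite mul1r addrC subrK -natr1 mulrDl mul1r addrK.
Qed.

Lemma XiW_word1_coef k (p : 'S_k) : (0 < k)%N ->
  (XiW K (word1 k))@_(tg k p) = (no_descent k (desn p))%:R.
Proof.
move=> k0; rewrite XiW_coef deg_word1 eqxx letters_word1; case: k k0 p => //= k _ p.
congr (_%:R); congr nat_of_bool; apply: eq_in_all => i; rewrite mem_iota => i1.
rewrite add0n inE; case: eqP => [ik|]; first by lia.
by rewrite implybF.
Qed.

Lemma omega_coord_coef n (p : 'S_n) : (X (omega_coord n))@_(tg n p) = omega_val n (desn p).
Proof.
elim/ltn_ind: n p => n IH p; case: (posnP n) => [n0|n0].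
  subst n; rewrite omega_coord_step scale0r big_geq // subr0 linear0 mcoeff0.
  by rewrite /omega_val big_ord0.
rewrite omega_coord_step linearB mcoeffB linearZ /= mcoeffZ mlinE1 XiW_word1_coef //.
apply/eqP; rewrite subr_eq addrC -subr_eq eq_sym; apply/eqP.
rewrite -omega_val_newton // linear_sum raddf_sum /=; apply: eq_big_nat => k /andP[k0 kn].
have nk : n = (k + (n - k))%N by rewrite subnKC // ltnW.
have [p1 [p2 R]] := restricts_exist p nk; have [_ D1 D2] := R.
rewrite (XM_coef _ (@omega_coord_homog K (n - k)) R); last first.
  by apply: supportedU; rewrite deg_word1.
rewrite mlinE1 XiW_word1_coef // IH; last by lia.
congr (_%:R * _).
  by congr nat_of_bool; apply: eq_no_descent => i /andP[i0 ik]; rewrite D1 i0 ik.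
by apply: eq_omega_val => i /andP[i0 ik]; rewrite D2 i0 ik.
Qed.

Lemma Delta_coef q n (p : 'S_n) : (Delta K (letters q))@_(tg n p) =
  ((n == deg q) && all (fun i => desn p i == (i \in scanl addn 0%N (letters q))) (iota 1 n.-1))%:R.
Proof.
rewrite /Delta /Delta_set raddf_sum /=; case: eqP => [nq|/eqP nq]; last first.
  rewrite big1 // => s _; rewrite elt_coef; case: eqP => // /(congr1 tag) /= nm.
  by rewrite -/(deg q) in nm; rewrite nm eqxx in nq.
move: p; rewrite nq => p; rewrite (eq_bigr (fun s => (s == p)%:R)); last first.
  by move=> s _; rewrite elt_coef eq_Tagged.
have -> : (\sum_(s | Des s == comp_set (letters q)) (s == p)%:R)
    = (Des p == comp_set (letters q))%:R :> K.
  case: eqP => Dp; last by rewrite big1 // => s /eqP Ds; case: eqP => // sp; case: Dp; rewrite -sp.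
  rewrite (bigD1 p) /= ?Dp ?eqxx // big1 ?addr0 // => s /andP[_ /negbTE->] //.
congr (_%:R); congr nat_of_bool; apply/eqP/allP => [Dp i|H].
  rewrite mem_iota => i1; have ilt : (i < deg q)%N by lia.
  by rewrite -[i]/(val (Ordinal ilt)) desnE Dp inE.
apply/setP => i; rewrite -desnE; case: (posnP i) => i0.
  apply/idP/idP => [/desn_lt|/comp_set_gt0]; first by rewrite i0.
  by rewrite i0.
have ii : (i : nat) \in iota 1 (deg q).-1.
  by rewrite mem_iota i0 /=; have := ltn_ord i; rewrite -/(deg q); lia.
by rewrite inE (eqP (H _ ii)).
Qed.

Lemma omega_X n : X (omega_coord n) = omega K n.
Proof.
apply/malgP => -[m p]; rewrite /omega [RHS]raddf_sum [RHS]/=.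
have qE k : (k < n)%N -> exists2 q, letters q = rcons (nseq k 1%N) (n - k)%N & deg q = n.
  move=> kn; have [|q qE] := @letters_surj (rcons (nseq k 1%N) (n - k)%N).
    by rewrite all_rcons /= subn_gt0 kn all_nseq orbT.
  by exists q => //; rewrite /deg qE sumn_rcons sumn_nseq mul1n subnKC // ltnW.
case: (eqVneq m n) => [mn|mn]; last first.
  rewrite big1 => [|k _]; last first.
    have [q <- qn] := qE k (ltn_ord k).
    by rewrite mcoeffZ Delta_coef qn (negbTE mn) mulr0.
  have /homogeneousP/supportedP := (homogeneous_X n (omega_coord n)).2 (@omega_coord_homog K n).
  by apply.
subst m; rewrite omega_coord_coef; apply: eq_bigr => k _.
have [q qk qn] := qE k (ltn_ord k); rewrite -qk mcoeffZ Delta_coef qn eqxx qk.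
congr (_ * _%:R); congr nat_of_bool; apply: eq_in_all => i; rewrite mem_iota => i1.
congr (_ == _); rewrite -cats1 mem_scanl_cat ?sumn_nseq; last by lia.
rewrite mul1n /= ?add0n inE.
have scan1 j m : (j \in scanl addn m (nseq k 1%N)) = (m < j <= m + k)%N.
  elim: (val k) m => [|k' IH] m /=; first by rewrite in_nil; lia.
  by rewrite inE IH; lia.
rewrite scan1; case: ltngtP => ik; lia.
Qed.

End Omega.

(** * Lie series *)

Section LieSeries.
Variables (K : fieldType) (charK : [pchar K] =i pred0).
Notation A := {malg K[word]}.
Notation KS := {malg K[gperm]}.
Local Notation X := (mlin (XiW K)).
Local Notation omega_coord := (omega_coord K).
Local Notation proj := (@proj K).
Local Notation coprodX := (@coprodX K).
Local Notation unshuffle := (@unshuffle K).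
Local Notation dynkin := (@dynkin K).
Implicit Types a c x y : A.

Lemma word1_val (n : posnat) : word1 (val n) = fmu n.
Proof. by apply: letters_inj; rewrite letters_word1 lettersU; case: n => -[]. Qed.

Lemma posnat_neq0 (n : posnat) : (val n)%:R != 0 :> K.
Proof. by apply: natr_neq0 => //; case: n. Qed.

Lemma dynkin_homog q : homog (deg q) (dynkin << q >>).
Proof.
rewrite dynkinW; elim/word_rind: q => [|n q IH].
  by rewrite left_bracket1; apply: supported0.
case: (eqVneq q mone) => [->|q1].
  by rewrite mul1m left_bracketU; apply/supportedZ/homogU.
rewrite (left_bracketM _ (@comm_linearl K) _ q1) right_actionU degM.
apply: supportedB; first exact/homogM/homogU.
by rewrite addnC; apply: homogM => //; apply: homogU.
Qed.

Lemma proj_dynkin n c : proj n (dynkin c) = dynkin (proj n c).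
Proof.
apply: (lin_ext (f := fun c => proj n (dynkin c)) (h := fun c => dynkin (proj n c))).
- by apply: (linear_comp (f := proj n)); exact: linearP.
- by apply: (linear_comp (f := dynkin)); exact: linearP.
move=> q; rewrite projU; case: eqP => [<-|/eqP qn].
  exact/proj_id/dynkin_homog.
by rewrite linear0; apply: proj_neq (@dynkin_homog q) qn.
Qed.

Let omg (n : posnat) : A := omega_coord (val n).

Let omg_homog n : homog (val n) (omg n). Proof. exact: omega_coord_homog. Qed.

Let omg_prim n : prim coprodX (omg n). Proof. exact: omega_coord_prim. Qed.

Let omg_lead n : (omg n)@_(fmu n) != 0.
Proof. by rewrite -word1_val omega_coord_lead posnat_neq0. Qed.

Lemma omg_surj y : exists c, y = lift omg c.
Proof. exact: lift_surjective omg_homog omg_lead y. Qed.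

Lemma act_omega_coord_prim n y : prim coprodX (act coprodX (omega_coord n) y).
Proof.
have [c ->] := omg_surj y; rewrite (act_lift omg_homog omg_prim) act_omega_coord proj_dynkin.
by apply: (lift_prim omg_prim); apply: dynkin_prim.
Qed.

Lemma actw_letter (n : posnat) y : actw coprodX [:: val n] y = proj (val n) y.
Proof.
have [c ->] := omg_surj y; rewrite (actw_lift omg_homog omg_prim) (lift_proj omg_homog).
congr (lift _ _); rewrite -act_word1 word1_val /act mlinE1 lettersU.
by [].
Qed.

(** In [ten x 1 + ten 1 x] one side is 1, which has no component of positive degree, whereas both
    sides must supply one. *)
Lemma actw_prim (u : word) x : prim coprodX x -> (1 < size (letters u))%N ->
  actw coprodX (letters u) x = 0.
Proof.
move=> xp.
have proj1 k : (0 < k)%N -> proj k 1 = 0.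
  by move=> k0; apply: (proj_neq (m := 0) (@homog1 K)); rewrite eq_sym -lt0n.
have key n m v : (0 < n)%N -> (0 < m)%N -> actw coprodX (n :: m :: v) x = 0.
  move=> n0 m0.
  have act10 : actw coprodX (m :: v) 1 = 0.
    rewrite actw_cons /= coprodX1 -ten11 conv_ten; [|exact: linearP|exact: actw_linear].
    by rewrite proj1 // mul0r.
  rewrite actw_cons; have -> : forall w, w = ten x 1 + ten 1 x ->
      conv (proj n) (actw coprodX (m :: v)) w =
      conv (proj n) (actw coprodX (m :: v)) (ten x 1) +
      conv (proj n) (actw coprodX (m :: v)) (ten 1 x).
    by move=> w ->; rewrite convD.
  2: exact: xp.
  rewrite !conv_ten; try exact: linearP; try exact: actw_linear.
  by rewrite act10 proj1 // mulr0 mul0r addr0.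
have := all_letters u; case: (letters u) => [|n [|m v]] // n0 _.
by case/and3P: n0 => n0 m0 _; apply: key.
Qed.

(** A word of degree n other than the letter n has at least two letters and acts by 0. *)
Lemma act_single_proj (n : posnat) a x : homog (val n) a ->
  (forall u : word, (1 < size (letters u))%N -> actw coprodX (letters u) x = 0) ->
  act coprodX a x = a@_(fmu n) *: proj (val n) x.
Proof.
move=> an x0; rewrite /act; set y := proj _ x.
have -> : mlin (fun u => actw coprodX (letters u) x) a = mlin (fun u => (u == fmu n)%:R *: y) a.
  apply: eq_in_mlin => u /an; rewrite /in_mem /= => un; case: eqP => [->|/eqP nu].
    by rewrite lettersU actw_letter scale1r.
  by rewrite scale0r x0 // size_letters; apply: deg_fmu un nu.
apply: (lin_ext (f := mlin (fun u => (u == fmu n)%:R *: y))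
  (h := fun a => a@_(fmu n) *: y)) => [|k z t|u].
- exact: linearP.
- by rewrite mcoeffD mcoeffZ scalerDl scalerA.
by rewrite mlinE1 mcoeffU1.
Qed.

Lemma act_single (n : posnat) a x : homog (val n) a -> homog (val n) x ->
  (forall u : word, (1 < size (letters u))%N -> actw coprodX (letters u) x = 0) ->
  act coprodX a x = a@_(fmu n) *: x.
Proof. by move=> an xn x0; rewrite (act_single_proj an x0) proj_id. Qed.

(** Here omega_n acts as n times the projection, and its multiples are primitive. *)
Lemma prim_projX (n : posnat) x : prim coprodX x -> prim coprodX (proj (val n) x).
Proof.
move=> xp; have n0 := posnat_neq0 n.
have E : act coprodX (omg n) x = (val n)%:R *: proj (val n) x.
  rewrite (@act_single_proj n (omg n) x (@omg_homog n)) -?word1_val ?omega_coord_lead //.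
  by move=> u; apply: actw_prim.
have := primZ (val n)%:R^-1 (act_omega_coord_prim (val n) x).
by rewrite E scalerA (mulVf n0) scale1r.
Qed.

Section Gamma.
Variables (gamma : posnat -> KS) (gammaL : Lie_series gamma).

Definition gcoord (n : posnat) : A := Xi_coord (gamma n).

Lemma gammaE n : gamma n = X (gcoord n).
Proof.
by have [/descent_X[c _ cE] _] := gammaL n; rewrite /gcoord cE Xi_coordK.
Qed.

Lemma gcoord_homog n : homog (val n) (gcoord n).
Proof.
by have [/descent_X[c cn cE] _] := gammaL n; rewrite /gcoord cE Xi_coordK.
Qed.

Let a (n : posnat) : A := (val n)%:R^-1 *: gcoord n.

Let a_homog n : homog (val n) (a n). Proof. exact/supportedZ/gcoord_homog. Qed.

Let aE n : (val n)%:R^-1 *: gamma n = X (a n).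
Proof. by rewrite gammaE /a (linearZ_of (f := X)) //; exact: linearP. Qed.

Lemma act_omega_coord_id (n : posnat) : act coprodX (omg n) (omg n) = (val n)%:R *: omg n.
Proof.
have lE : lift omg << fmu n >> = omg n by rewrite liftE gwordU.
rewrite -{2}lE (act_lift omg_homog omg_prim) act_omega_coord dynkinW left_bracketU.
rewrite proj_id; last by apply/supportedZ/supportedU; rewrite degU.
have -> : lift omg ((val n)%:R *: << fmu n >>) = (val n)%:R *: lift omg << fmu n >>.
  by apply: linearZ_of; exact: linearP.
by rewrite lE.
Qed.

Lemma lie_idempotent_coord n : [/\ prim coprodX (a n) & (a n)@_(fmu n) = 1].
Proof.
have [_ [_ idem img]] := gammaL n; rewrite aE in idem img.
have n0 := posnat_neq0 n.
have hX (c : A) : homog (val n) c -> homogeneous (val n) (X c).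
  by move=> cn; apply/homogeneous_X.
have [y yn aw] : inner_image (omega K (val n)) (homogeneous (val n)) (X (a n)).
  by apply/img; exists (X (a n)); [apply/hX|rewrite idem].
rewrite -omega_X in aw.
(* [y] need not lie in D; by associativity the word meets the factor omega_n first and kills it. *)
have a0 (u : word) : (1 < size (letters u))%N -> actw coprodX (letters u) (a n) = 0.
  move=> u1; apply: (@X_inj K); rewrite linear0 -inner_actw aw innerA inner_actw.
  by rewrite (actw_prim (@omega_coord_prim K (val n)) u1) linear0 inner0l.
have actE c : homog (val n) c -> act coprodX c (a n) = c@_(fmu n) *: a n.
  by move=> cn; exact: (@act_single n c (a n) cn (@a_homog n) a0).
(* Otherwise omega_n, which lies in the right ideal of the idempotent, would vanish in spite of its
   coefficient n at Xi^n. *)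
have an0 : a n != 0.
  apply/eqP => az.
  have [z zn oz] : inner_image (X (a n)) (homogeneous (val n)) (X (omg n)).
    apply/img; rewrite -omega_X; exists (X ((val n)%:R^-1 *: omg n)).
      exact/hX/supportedZ/omg_homog.
    rewrite inner_act (linearZ_of (@act_linear K coprodX _)) act_omega_coord_id.
    by rewrite scalerA (mulVf n0) scale1r.
  have : X (omg n) = X 0 by rewrite oz az linear0 inner0l.
  move/(@X_inj K)/(congr1 (fun c => c@_(fmu n))) => /= /eqP.
  by rewrite mcoeff0 (negbTE (omg_lead n)).
have lead1 : (a n)@_(fmu n) = 1.
  have := idem; rewrite inner_act (actE _ (@a_homog n)) => /(@X_inj K) E.
  have : ((a n)@_(fmu n) - 1) *: a n = 0 by rewrite scalerBl scale1r E subrr.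
  by move/eqP; rewrite scaler_eq0 (negbTE an0) orbF subr_eq0 => /eqP.
split=> //; have := act_omega_coord_prim (val n) (a n).
rewrite actE; last exact: omega_coord_homog.
rewrite -word1_val omega_coord_lead => P.
by have := primZ (val n)%:R^-1 P; rewrite scalerA (mulVf n0) scale1r.
Qed.

Lemma gcoordE n : gcoord n = (val n)%:R *: a n.
Proof. by rewrite scalerA mulfV ?scale1r // posnat_neq0. Qed.

Lemma gcoord_prim n : prim coprodX (gcoord n).
Proof. by rewrite gcoordE; apply: primZ; have [] := lie_idempotent_coord n. Qed.

Lemma gcoord_lead n : (gcoord n)@_(fmu n) = (val n)%:R.
Proof. by rewrite gcoordE mcoeffZ; have [_ ->] := lie_idempotent_coord n; rewrite mulr1. Qed.

Lemma gcoord_lead_neq0 n : (gcoord n)@_(fmu n) != 0.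
Proof. by rewrite gcoord_lead posnat_neq0. Qed.

Local Notation G := (lift gcoord).

Lemma gammaW_X q : gammaW gamma q = X (gword gcoord q).
Proof.
elim/word_ind: q => [|n q IH]; first by rewrite gword1 X1 /gammaW fm1.
have -> : gammaW gamma (mmul (fmu n) q) = star (gamma n) (gammaW gamma q).
  by rewrite /gammaW fmM fmU.
by rewrite IH gammaE starE gwordM gwordU.
Qed.

Lemma mlin_gammaW c : mlin (gammaW gamma) c = X (G c).
Proof.
rewrite lift.unlock (mlin_comp X) /=; apply: eq_mlin => q; exact: gammaW_X.
Qed.

Lemma act_gcoord_prim_id n x : prim coprodX x -> homog (val n) x ->
  act coprodX (gcoord n) x = (val n)%:R *: x.
Proof.
move=> xp xn; rewrite -gcoord_lead; apply: act_single xn _; first exact: gcoord_homog.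
by move=> u; apply: actw_prim.
Qed.

(** From omega_n gamma_n = n gamma_n, each gamma_n y is a multiple of omega_n. *)
Lemma act_gcoord_prim n y : prim coprodX (act coprodX (gcoord n) y).
Proof.
have n0 := posnat_neq0 n.
have E : act coprodX (omg n) (gcoord n) = (val n)%:R *: gcoord n.
  rewrite (@act_single n (omg n) (gcoord n) (@omg_homog n) (@gcoord_homog n)).
    by rewrite -word1_val omega_coord_lead.
  by move=> u; apply: actw_prim; apply: gcoord_prim.
suff <- : (val n)%:R^-1 *: act coprodX (omg n) (act coprodX (gcoord n) y) =
    act coprodX (gcoord n) y by apply/primZ/act_omega_coord_prim.
apply: (@X_inj K); rewrite (linearZ_of (f := X)); last exact: linearP.
rewrite -!inner_act innerA inner_act E (linearZ_of (f := X)); last exact: linearP.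
rewrite (linearZ_of (inner_linearl _)) scalerA (mulVf n0) scale1r.
by [].
Qed.

(** Converse of [lift_prim] by the Dynkin-Specht-Wever argument: omega_n multiplies [G c] by n, so
    [dynkin] multiplies c by n, and the image of [dynkin] is primitive. *)
Lemma prim_lift_homog (n : posnat) c : homog (val n) c -> prim coprodX (G c) ->
  prim unshuffle c.
Proof.
move=> cn Gp; have n0 := posnat_neq0 n.
have hom := @gcoord_homog; have prm := gcoord_prim.
have Gn : homog (val n) (G c) by apply: lift_homog.
have : G (proj (val n) (dynkin c)) = G ((val n)%:R *: c).
  rewrite -act_omega_coord -(act_lift hom prm) (@act_single n (omg n) (G c) (@omg_homog n) Gn); last first.
    by move=> u; apply: actw_prim.
  rewrite -word1_val omega_coord_lead (linearZ_of (f := G)) //; exact: linearP.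
move/(lift_injective hom gcoord_lead_neq0) => E.
have : prim unshuffle (proj (val n) (dynkin c)).
  by rewrite proj_dynkin; apply: dynkin_prim.
move/(primZ (val n)%:R^-1); rewrite E scalerA (mulVf n0) scale1r.
by [].
Qed.

End Gamma.
End LieSeries.

(** * Inner squares of the products gamma_q *)

Section Idempotents.
Variables (K : fieldType) (charK : [pchar K] =i pred0).
Notation A := {malg K[word]}.
Notation KS := {malg K[gperm]}.
Local Notation X := (mlin (XiW K)).
Local Notation proj := (@proj K).
Local Notation unshuffle := (@unshuffle K).

(** The number of permutations of the positions of u that preserve its letters, counted by matching
    one letter at a time. *)
Fixpoint matchings (u : seq nat) : nat :=
  if u is n :: v then (count_mem n u * matchings v)%N else 1.

Lemma qfact_matchings q : qfact q = (\prod_(n <- letters q) n * matchings (letters q))%N.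
Proof.
rewrite /qfact; set N := (sumn _).+1.
have : all (fun n => 0 < n < N)%N (letters q).
  apply/allP => n nq; have /allP/(_ _ nq) /= n0 := all_letters q.
  rewrite /N ltnS; apply/andP; split=> //.
  elim: (letters q) nq => //= m s IH; rewrite inE => /orP[/eqP->|/IH]; lia.
elim: (letters q) => [|n s IH] /=; first by rewrite big_nil big1.
case/andP=> /andP[n0 nN] /IH sE; rewrite big_cons eqxx add1n.
have nI : n \in index_iota 1 N by rewrite mem_index_iota n0.
rewrite (bigD1_seq n) ?iota_uniq //= eqxx add1n factS expnS.
move: sE; rewrite (bigD1_seq n) ?iota_uniq //=.
rewrite [in X in _ -> X](eq_bigr (fun i => (count_mem i s)`! * i ^ count_mem i s)%N); last first.
  by move=> i; rewrite eq_sym => /negbTE->; rewrite add0n.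
by move=> E; rewrite [RHS]mulnACA -E; ring.
Qed.

Lemma size_comask (T : Type) m (s : seq T) : size m = size s ->
  (size (mask m s) + size (comask m s))%N = size s.
Proof.
elim: m s => [|b m IH] [|x s] //= [/IH]; rewrite /comask; case: b => /=; lia.
Qed.

Lemma count_mask (T : eqType) (x : T) (s : seq T) :
  count (fun m => mask m s == [:: x]) (bits (size s)) = count_mem x s.
Proof.
have count0 (t : seq T) : count (fun m => mask m t == [::]) (bits (size t)) = 1%N.
  by elim: t => //= y t IH; rewrite count_cat !count_map /= IH count_pred0.
elim: s => //= y s IH; rewrite count_cat !count_map /= IH; congr addn.
case: (eqVneq y x) => [->|yx] /=.
  by rewrite -[RHS](count0 s); apply: eq_count => m /=; rewrite eqseq_cons eqxx.
by rewrite -[RHS](count_pred0 (bits (size s))); apply: eq_count => m /=;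
  rewrite eqseq_cons (negbTE yx).
Qed.

Lemma prod_letters (s : seq posnat) : \prod_(n <- s) << fmu n >> = << FMonom s >> :> A.
Proof.
elim: s => [|n s IH]; first by rewrite big_nil; congr (<< _ >>); apply: letters_inj; rewrite letters1.
rewrite big_cons IH malgUM; congr << _ >>.
by apply: letters_inj; rewrite lettersM lettersU.
Qed.

Lemma unshuffle_mask (q : word) : unshuffle << q >> =
  \sum_(m <- bits (size (q : seq posnat))) << (FMonom (mask m q), FMonom (comask m q)) >>.
Proof.
have qE : << q >> = \prod_(l <- [seq fmu n | n <- (q : seq posnat)]) << l >> :> A.
  by rewrite big_map prod_letters fmK.
rewrite qE unshuffle_prod => [|_ /mapP[n _ ->]]; last exact: letter_prim.
rewrite size_map; apply: eq_bigr => m _.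
by rewrite /comask -!map_mask !big_map !prod_letters tenU.
Qed.

Lemma actw_mask n u (q : word) : actw unshuffle (n :: u) << q >> =
  \sum_(m <- bits (size (q : seq posnat)))
    proj n << FMonom (mask m q) >> * actw unshuffle u << FMonom (comask m q) >>.
Proof.
rewrite actw_cons /= unshuffle_mask (linear_sum (conv (proj n) (actw unshuffle u))) /=.
by apply: eq_bigr => m _; rewrite convU.
Qed.

(** Every letter of u is positive, so it must receive a nonempty piece of q. *)
Lemma actw_long u (q : word) : all (ltn 0) u -> (size (q : seq posnat) < size u)%N ->
  actw unshuffle u << q >> = 0.
Proof.
elim: u q => //= n u IH q /andP[n0 u0] qu.
rewrite -/(actw unshuffle (n :: u) _) actw_mask big_seq big1 // => m /bits_size/size_comask mq.
have [mask0|mask0] := posnP (size (mask m q)).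
  rewrite projU ifF ?mul0r //; apply/eqP => n_eq; move: n0; rewrite -n_eq.
  by rewrite (size0nil mask0).
rewrite IH ?mulr0 //; apply: leq_trans (_ : _ <= size (q : seq posnat))%N qu.
by rewrite -mq -[X in (X < _)%N]add0n ltn_add2r.
Qed.

(** With equally many letters on both sides, each letter of u receives exactly one letter, equal to
    itself, and the pieces are multiplied in the order of u. *)
Lemma actw_match u (q : word) : perm_eq u (letters q) ->
  actw unshuffle u << q >> = (matchings u)%:R *: << wd u >>.
Proof.
elim: u q => [|n u IH] q uq.
  have -> : q = mone.
    by apply: letters_inj; rewrite letters1; apply: size0nil; rewrite -(perm_size uq).
  by rewrite /= mcoeffUU; congr (_ *: << _ >>); apply: letters_inj; rewrite letters1 letters_wd.
rewrite actw_mask.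
have nu0 : all (ltn 0) (n :: u) by rewrite (perm_all _ uq) all_letters.
have sq : size (q : seq posnat) = (size u).+1.
  by rewrite -[LHS](size_map val) -/(letters q) -(perm_size uq).
have n_q : n \in letters q by rewrite -(perm_mem uq) inE eqxx.
have [k kq nk] := mapP n_q.
rewrite (eq_big_seq (fun m => (mask m (q : seq posnat) == [:: k])%:R *:
    ((matchings u)%:R *: << wd (n :: u) >>))); last first.
  move=> m /bits_size sm; have mq := size_comask sm; have pm := comask_perm sm.
  case: eqP => [mE|mN].
    have pu : perm_eq u (letters (FMonom (comask m q))).
      rewrite -(perm_cons n); apply: perm_trans uq _.
      by move: (perm_map val pm); rewrite mE nk perm_sym.
    rewrite (IH _ pu) mE scale1r projU ifT; last by rewrite nk /deg /= addn0.
    rewrite malg_scalerAr; congr (_ *: _); rewrite malgUM; congr << _ >>.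
     apply: letters_inj; rewrite lettersM !letters_wd_pos //.
      by rewrite nk.
    by case/andP: nu0.
  rewrite scale0r.
  case mk: (mask m q) mq mN => [|l [|l' s]] mq mN.
  - rewrite projU ifF ?mul0r //; apply/eqP => n_eq.
    by move: nu0; rewrite -n_eq.
  - rewrite projU ifF ?mul0r //; apply/eqP => n_eq; case: mN; congr [:: _].
    by apply: val_inj; rewrite -nk -n_eq /deg /= addn0.
  rewrite actw_long ?mulr0 //; first by case/andP: nu0.
  by move: mq; rewrite sq /= addSn => -[<-]; rewrite addSn ltnS leq_addl.
rewrite -scaler_suml -natr_sum scalerA -natrM; congr (_%:R *: _).
rewrite /= eqxx; congr muln.
have -> : (1 + count_mem n u)%N = count_mem n (letters q) by rewrite -(seq.permP uq) /= eqxx.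
rewrite count_map nk -(@eq_count _ (pred1 k)); last by move=> l; rewrite /= (inj_eq val_inj).
rewrite -count_mask -sum1_count [RHS]big_mkcond /=.
by apply: eq_bigr => m _; case: eqP.
Qed.

Section Gamma.
Variables (gamma : posnat -> KS) (gammaL : Lie_series gamma).
Local Notation gc := (gcoord gamma).

Lemma glead_gcoord q : glead gc q = (\prod_(n <- letters q) n)%:R.
Proof.
rewrite /glead natr_prod big_map; apply: eq_bigr => n _.
exact: gcoord_lead.
Qed.

(** In the left factor, words longer than q act by 0, and q has as coefficient the product of its
    letters. The right factor is the image of the word q, on which q acts by its number of
    matchings. The two numbers multiply to q?. *)
Lemma act_gword_diag q :
  act (@coprodX K) (gword gc q) (gword gc q) = (qfact q)%:R *: gword gc q.
Proof.
have [y yE yq] := gword_lead (g := gc) (gcoord_homog gammaL) q.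
have actE u : actw (@coprodX K) u (gword gc q) = lift gc (actw unshuffle u << q >>).
  have -> : gword gc q = lift gc << q >> by rewrite liftE.
  apply: actw_lift; [exact: gcoord_homog|exact: gcoord_prim].
rewrite {1}yE; apply: etrans (act_linearl (@coprodX K) _ _ _ _) _.
have -> : act (@coprodX K) y (gword gc q) = 0.
  rewrite /act /mlin big_seq big1 // => p /yq /andP[_ qp].
  rewrite actE actw_long ?linear0 ?scaler0 ?all_letters //.
  by rewrite size_map.
rewrite addr0 /act mlinE1 actE (actw_match (perm_refl _)) wd_letters.
rewrite (linearZ_of (f := lift gc)); last exact: linearP.
rewrite liftE scalerA glead_gcoord -natrM -qfact_matchings.
by [].
Qed.

Lemma qfact_neq0 q : (qfact q)%:R != 0 :> K.
Proof.
apply: natr_neq0 => //; rewrite /qfact big_nat prodn_cond_gt0 // => i /andP[i0 _].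
by rewrite muln_gt0 fact_gt0 expn_gt0 i0.
Qed.

Lemma gammaW_idempotent q : let e := (qfact q)%:R^-1 *: gammaW gamma q in inner e e = e.
Proof.
move=> e; have eE : e = X ((qfact q)%:R^-1 *: gword gc q).
  by rewrite (linearZ_of (f := X)); [rewrite -gammaW_X|exact: linearP].
rewrite eE inner_act; congr (mlin _ _).
rewrite (linearZ_of (@act_linear K _ _)) (linearZ_of (@act_linearl K _ _)).
rewrite act_gword_diag [in X in _ *: X]scalerA (mulVf (qfact_neq0 q)) scale1r.
by [].
Qed.

End Gamma.
End Idempotents.

(** * Peaks *)

Section Peaks.
Variables (K : fieldType) (charK : [pchar K] =i pred0).
Notation A := {malg K[word]}.
Notation KS := {malg K[gperm]}.
Local Notation X := (mlin (XiW K)).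
Local Notation tg n p := (@Tagged nat n (fun k => 'S_k) p : gperm).

Definition peakn n (p : 'S_n) (i : nat) : bool := [&& 1 < i, desn p i & ~~ desn p i.-1]%N.

Lemma PeakE n (p : 'S_n) (i : 'I_n) : (i \in Peak p) = peakn p i.
Proof.
have desP (j k : 'I_n) : k.+1 = j -> desn p j = (p j < p k)%N.
  move=> kj; rewrite desnE inE; apply/existsP/idP => [[k' /andP[/eqP kj']]|pjk].
    by have -> : k' = k by apply: val_inj => /=; lia.
  by exists k; rewrite kj eqxx.
have pneq (j k : 'I_n) : k.+1 = j -> (p k < p j)%N = ~~ desn p j.
  move=> kj; rewrite (desP _ _ kj) -leqNgt [RHS]leq_eqVlt.
  have kNj : k != j by apply/eqP => kE; move: kj; rewrite kE; lia.
  by rewrite (inj_eq (@ord_inj n)) (inj_eq perm_inj) (negbTE kNj).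
rewrite inE; apply/existsP/idP => [[j /existsP[k /and4P[/eqP ji /eqP kj pkj pij]]]|].
  by rewrite /peakn (desP _ _ ji) pij -ji -(pneq _ _ kj) pkj -kj.
case/and3P=> i1 di dj; have jn : (i.-1 < n)%N by have := ltn_ord i; lia.
have kn : (i.-2 < n)%N by have := ltn_ord i; lia.
have ji : (Ordinal jn).+1 = i by move=> /=; lia.
have kj : (Ordinal kn).+1 = Ordinal jn by move=> /=; lia.
exists (Ordinal jn); apply/existsP; exists (Ordinal kn).
apply/and4P; split; [exact/eqP|exact/eqP|by rewrite (pneq _ _ kj)|].
by rewrite -(desP _ _ ji).
Qed.

Lemma peakn_lt n (p : 'S_n) i : peakn p i -> (1 < i < n)%N.
Proof. by case/and3P => -> /desn_lt/andP[_ ->]. Qed.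

Lemma peakn_sparse n (p : 'S_n) i : peakn p i -> ~~ peakn p i.+1.
Proof. by case/and3P => _ di _; rewrite /peakn /= di !andbF. Qed.

(** Membership becomes an invariance of coefficients, which suits the product formula [XM_coef]. *)
Lemma peak_compP n (x : KS) : peak_comp n x <-> homogeneous n x /\
  forall p p' : 'S_n, Peak p = Peak p' -> x@_(tg n p) = x@_(tg n p').
Proof.
have PeakC (P : {set 'I_n}) (p : 'S_n) : (Peak_set K P)@_(tg n p) = (Peak p == P)%:R.
  rewrite raddf_sum /=; transitivity (\sum_(s | Peak s == P) (s == p)%:R : K).
    by apply: eq_bigr => s _; rewrite elt_coef eq_Tagged.
  case: eqP => Pp; last first.
    by rewrite big1 // => s /eqP sP; case: eqP => // sp; rewrite -sp in Pp.
  rewrite (bigD1 p) /=; last exact/eqP.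
  by rewrite eqxx big1 ?addr0 // => s /andP[_ /negbTE->].
split=> [[c cP ->]|[xn xP]].
  split=> [|p p' pp'].
    apply/homogeneousP; apply: (@supported_mlin _ _ _ predT) => // P _.
    by apply: supported_sum => p _ _; apply: elt_homogeneous.
  rewrite !raddf_sum /=; apply: eq_bigr => P _; rewrite !mcoeffZ !PeakC pp'.
  by [].
pose co (P : {set 'I_n}) := if [pick p | Peak p == P] is Some p then x@_(tg n p) else 0.
have coE p : co (Peak p) = x@_(tg n p).
  by rewrite /co; case: pickP => [p' /eqP/xP//|/(_ p)]; rewrite eqxx.
exists (\sum_(P : {set 'I_n}) co P *: << P >>).
  apply: supported_sum => P _ _; rewrite /co; case: pickP => [p /eqP PE|_]; last first.
    by rewrite scale0r; apply: supported0.
  apply/supportedZ/supportedU/forallP => i; apply/implyP; rewrite -PE PeakE.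
  by case/peakn_lt/andP.
have -> : mlin (@Peak_set K n) (\sum_(P : {set 'I_n}) co P *: << P >>) =
    \sum_(P : {set 'I_n}) co P *: Peak_set K P.
  rewrite (linear_sum (mlin (@Peak_set K n))) /=; apply: eq_bigr => P _.
  by rewrite (linearZ_of (f := mlin (@Peak_set K n))) ?mlinE1 //; exact: linearP.
apply/malgP => -[m p]; rewrite raddf_sum /=; case: (eqVneq m n) => [mn|mn]; last first.
  rewrite big1 => [|P _]; first by apply: mcoeff_outdom; apply: contra mn => /xn /= ->.
  rewrite mcoeffZ; apply/eqP; rewrite mulf_eq0; apply/orP; right.
  rewrite raddf_sum /= big1 // => s _; rewrite elt_coef; case: eqP => // /(congr1 tag) /= nm.
  by rewrite nm eqxx in mn.
subst m; rewrite (bigD1 (Peak p)) //= big1 => [|P PP].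
  by rewrite addr0 mcoeffZ PeakC eqxx mulr1 coE.
by rewrite mcoeffZ PeakC eq_sym (negbTE PP) mulr0.
Qed.

Lemma eq_Peak n (p p' : 'S_n) : Peak p = Peak p' <-> forall i, peakn p i = peakn p' i.
Proof.
split=> [E i|E]; last by apply/setP => i; rewrite !PeakE E.
have [in_|ni] := ltnP i n; first by rewrite -(PeakE p (Ordinal in_)) E PeakE.
by apply/idP/idP => /peakn_lt/andP[_]; rewrite ltnNge ni.
Qed.

(** A peak of p at a or a + 1 involves the forgotten descent at a and leaves no trace. The peaks of
    both parts therefore depend only on the peaks of p. *)
Lemma restricts_peak n a b (p : 'S_n) (p1 : 'S_a) (p2 : 'S_b) i : restricts p p1 p2 ->
  peakn p1 i = (i < a)%N && peakn p i /\
  peakn p2 i = [&& 1 < i, i < b & peakn p (a + i)]%N.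
Proof.
case=> nab D1 D2; rewrite /peakn !D1 !D2; split.
  case: i => [|[|i]]; rewrite /= ?andbF //.
  by have [ia|] := ltnP i.+2 a; rewrite ?andbF //= (ltnW ia).
case: i => [|[|i]]; rewrite /= ?andbF //.
have [ib|] := ltnP i.+2 b; rewrite ?andbF //= (ltnW ib).
by rewrite !addnS /=.
Qed.

Lemma peak_compM a b c d : homog a c -> homog b d ->
  peak_comp a (X c) -> peak_comp b (X d) -> peak_comp (a + b) (X (c * d)).
Proof.
move=> ca db /peak_compP[_ cP] /peak_compP[_ dP]; apply/peak_compP; split=> [|p p' /eq_Peak pp'].
  exact/homogeneous_X/homogM.
have [p1 [p2 R]] := restricts_exist p (erefl (a + b)%N).
have [p1' [p2' R']] := restricts_exist p' (erefl (a + b)%N).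
rewrite (XM_coef ca db R) (XM_coef ca db R'); congr (_ * _).
  apply: cP; apply/eq_Peak => i.
  by have [-> _] := restricts_peak i R; have [-> _] := restricts_peak i R'; rewrite pp'.
apply: dP; apply/eq_Peak => i.
by have [_ ->] := restricts_peak i R; have [_ ->] := restricts_peak i R'; rewrite pp'.
Qed.

Lemma peak_comp1 : peak_comp 0 (X 1).
Proof.
apply/peak_compP; split=> [|p p' _]; first exact/homogeneous_X/homog1.
by have -> : p = p' by apply/permP => -[].
Qed.

(** After a point m of the set, [P] is false at m + 1 and then alternates up to the next point m +
    x, where it is false again; so x is odd. *)
Lemma odd_gaps (P : nat -> bool) m n s : all (ltn 0) s ->
  (forall i, P i -> ~~ P i.+1) -> ~~ P m.+1 -> ~~ P n -> (m + sumn s)%N = n ->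
  (forall i, (m < i < n)%N -> (i \in scanl addn m s) = ~~ P i && ~~ P i.+1) ->
  all odd s.
Proof.
elim: s m => //= x s IH m /andP[x0 s0] sp Pm Pn nE H.
have inP k : (0 < k < x)%N -> P (m + k).+1 = ~~ P (m + k)%N.
  case/andP=> k0 kx; have := H (m + k)%N; rewrite inE.
  have -> : (m + k == m + x)%N = false by lia.
  have -> : (m + k \in scanl addn (m + x)%N s) = false.
    by apply/negP => /scanl_ge; lia.
  have -> : (m < m + k < n)%N by lia.
  move=> /(_ isT); case: (boolP (P (m + k)%N)) => [/sp/negbTE->//|_] /=.
  by case: (P _).
have par k : (0 < k <= x)%N -> P (m + k)%N = ~~ odd k.
  elim: k => // -[|k] IHk kx; first by rewrite addn1 (negbTE Pm).
  by rewrite addnS inP ?IHk //= ltnW.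
have xodd : odd x = ~~ P (m + x)%N by rewrite par ?x0 ?negbK // leqnn.
case: s s0 IH nE H => [|y s] s0 IH nE H.
  by rewrite /= andbT xodd; move: nE; rewrite /= addn0 => ->.
have y0 : (0 < y)%N by case/andP: s0.
have := H (m + x)%N; rewrite inE eqxx /=.
have -> : (m < m + x < n)%N by move: nE => /=; lia.
move=> /(_ isT)/esym/andP[Px PxS]; rewrite xodd Px; apply: (IH (m + x)%N) => //.
  by rewrite -nE /= !addnA.
move=> i /andP[mi in_]; rewrite -H ?in_ ?inE; last by rewrite andbT; lia.
by rewrite (_ : (i == m + x)%N = false) //; lia.
Qed.

Definition peak_word n (p : 'S_n) (q : word) :=
  [/\ deg q = n, odd_word q & forall i, (0 < i < n)%N ->
    (i \in scanl addn 0%N (letters q)) = ~~ peakn p i && ~~ peakn p i.+1].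

Lemma peak_word_exist n (p : 'S_n) : exists q, peak_word p q.
Proof.
have [|q [qn qD]] := @comp_surj n (fun i => [&& 0 < i, ~~ peakn p i & ~~ peakn p i.+1])%N.
  by [].
exists q; split=> //; last by move=> i /andP[i0 in_]; rewrite qD // i0.
apply: (@odd_gaps (peakn p) 0 n); rewrite ?all_letters //.
- exact: peakn_sparse.
- by apply/negP => /peakn_lt; rewrite ltnn andbF.
- by move=> i /andP[i0 in_]; rewrite qD // i0.
Qed.

(** Peaks are recovered from left to right: after a peak i there is none at i + 1, and otherwise the
    membership of i decides. *)
Lemma peak_word_inj n (p p' : 'S_n) q : peak_word p q -> peak_word p' q -> Peak p = Peak p'.
Proof.
move=> [_ _ H] [_ _ H']; apply/eq_Peak; elim=> // i IH.
have [in_|ni] := ltnP i.+1 n; last first.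
  by apply/idP/idP => /peakn_lt/andP[_]; rewrite ltnNge ni.
case: i => // i in IH in_ *.
have := H i.+1; rewrite /= (ltnW in_) H' ?(ltnW in_) // => /(_ isT); rewrite -IH.
case: (boolP (peakn p i.+1)) => [pi _|_ /=]; last by case: (peakn p' _); case: (peakn p _).
have pi' : peakn p' i.+1 by rewrite -IH.
by rewrite (negbTE (peakn_sparse pi)) (negbTE (peakn_sparse pi')).
Qed.

Section Gamma.
Variables (gamma : posnat -> KS) (gammaL : Lie_series gamma).
Hypothesis gammaP : forall n : posnat, odd (val n) -> peak_comp (val n) (gamma n).
Local Notation gc := (gcoord gamma).
Local Notation G := (lift gc).

Lemma gword_peak q : odd_word q -> peak_comp (deg q) (X (gword gc q)).
Proof.
elim/word_ind: q => [|n q IH]; first by rewrite gword1 deg1 => _; apply: peak_comp1.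
rewrite /odd_word lettersM lettersU /= => /andP[nodd qodd].
rewrite gwordM gwordU degM degU; apply: peak_compM.
- exact: gcoord_homog.
- exact/gword_homog/gcoord_homog.
- by rewrite -gammaE //; apply: gammaP.
- exact: IH.
Qed.

Lemma peak_comp_subspace n : subspace (@peak_comp K n).
Proof.
split; first by exists 0; [apply: supported0|rewrite raddf0].
move=> a x y [c cP ->] [d dP ->]; exists (a *: c + d); last by rewrite linearP.
by apply: supportedD => //; apply: supportedZ.
Qed.

Lemma lift_peak n c : homog n c -> supported odd_word c -> peak_comp n (X (G c)).
Proof.
move=> cn cO; rewrite lift.unlock (mlin_comp X) /=.
have [S0 SD] := peak_comp_subspace n.
rewrite /mlin big_seq; apply: (big_ind (@peak_comp K n)) => // [x y Sx Sy|q qc].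
  by rewrite -[x]scale1r; apply: SD.
rewrite -[_ *: _]addr0; apply: SD => //.
by have /eqP <- := cn _ qc; apply: gword_peak; apply: cO.
Qed.

Lemma peak_comp_lift n x : peak_comp n x ->
  exists c, [/\ homog n c, supported odd_word c & x = X (G c)].
Proof.
pose R : {set {set 'I_n}} := [set Peak p | p in 'S_n].
have repr (r : 'I_#|R|) : exists pq : 'S_n * word, Peak pq.1 = enum_val r /\ peak_word pq.1 pq.2.
  have /imsetP[p _ ->] := enum_valP r; have [q pq] := peak_word_exist p.
  by exists (p, q).
have [pq pqP] := fin_all_exists repr.
have qI : injective (fun r => (pq r).2).
  move=> r s qrs; have [rE rP] := pqP r; have [sE sP] := pqP s.
  by apply: enum_val_inj; rewrite -rE -sE; rewrite qrs in rP; apply: peak_word_inj rP sP.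
pose lin (v : 'rV[K]_#|R|) : A := \sum_r v 0 r *: << (pq r).2 >>.
have lin_homog v : homog n (lin v).
  apply: supported_sum => r _ _; apply/supportedZ; have [_ [qn _ _]] := pqP r.
  by apply: supportedU; rewrite qn.
have lin_odd v : supported odd_word (lin v).
  by apply: supported_sum => r _ _; apply/supportedZ/supportedU; have [_ []] := pqP r.
have lin_inj v : lin v = 0 -> v = 0.
  move=> v0; apply/rowP => r; rewrite mxE; have := congr1 (mcoeff (pq r).2) v0.
  rewrite (raddf_sum (mcoeff _)) mcoeff0 (eq_bigr (fun s => v 0 s * (s == r)%:R)); last first.
    by move=> s _; rewrite /= mcoeffZ mcoeffU1 (inj_eq qI).
  by rewrite (bigD1 r) //= eqxx mulr1 big1 ?addr0 // => s /negbTE->; rewrite mulr0.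
pose ev (y : KS) : 'rV[K]_#|R| := \row_s y@_(tg n (pq s).1).
have ev_inj y z : peak_comp n y -> peak_comp n z -> ev y = ev z -> y = z.
  move=> /peak_compP[yn yP] /peak_compP[zn zP] /rowP E; apply/malgP => -[m p].
  case: (eqVneq m n) => [mn|mn]; last first.
    rewrite !mcoeff_outdom //; apply: contra mn; first by move=> /zn /= ->.
    by move=> /yn /= ->.
  subst m; have pR : Peak p \in R by apply/imsetP; exists p.
  have pE : Peak p = Peak (pq (enum_rank_in pR (Peak p))).1.
    by have [-> _] := pqP (enum_rank_in pR (Peak p)); rewrite enum_rankK_in.
  by rewrite (yP _ _ pE) (zP _ _ pE); have := E (enum_rank_in pR (Peak p)); rewrite !mxE.
have linP v : peak_comp n (X (G (lin v))) by apply: lift_peak.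
pose M : 'M[K]_#|R| := \matrix_(r, s) (X (G << (pq r).2 >>))@_(tg n (pq s).1).
have evE v : ev (X (G (lin v))) = v *m M.
  apply/rowP => s; rewrite !mxE /lin (linear_sum G) /= (linear_sum X) /= raddf_sum /=.
  apply: eq_bigr => r _; rewrite mxE (linearZ_of (f := G)); last exact: linearP.
  by rewrite (linearZ_of (f := X)); [rewrite mcoeffZ|exact: linearP].
have free : row_free M.
  apply: inj_row_free => v; rewrite -evE => v0; apply: lin_inj.
  apply: (lift_injective (@gcoord_homog _ _ gammaL) (@gcoord_lead_neq0 _ charK _ gammaL)).
  apply: (@X_inj K); apply: ev_inj; first exact: linP.
    by rewrite !linear0; have [] := peak_comp_subspace n.
  by rewrite v0; apply/rowP => s; rewrite !mxE !linear0 mcoeff0.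
move=> xP; have : (ev x <= M)%MS.
  by apply: submx_full; rewrite row_full_unit -row_free_unit.
case/submxP => v vE; exists (lin v); split=> //.
by apply: ev_inj => //; rewrite evE.
Qed.

End Gamma.
End Peaks.

(** * The peak algebra *)

Section PeakAlgebra.
Variables (K : fieldType) (charK : [pchar K] =i pred0).
Notation A := {malg K[word]}.
Notation KS := {malg K[gperm]}.
Local Notation X := (mlin (XiW K)).
Local Notation proj := (@proj K).
Local Notation coprodX := (@coprodX K).
Local Notation unshuffle := (@unshuffle K).
Implicit Types c d : A.

Lemma mcoeff_proj n c q : (proj n c)@_q = if deg q == n then c@_q else 0.
Proof.
rewrite projE mcoeff_mlin; case: (boolP (q \in msupp c)) => qc; last first.
  rewrite big_seq big1 => [|r rc]; first by rewrite (mcoeff_outdom qc) if_same.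
  have rq : r != q by apply: contraNneq qc => <-.
  by case: eqP; rewrite ?mcoeff0 ?mulr0 // mcoeffU1 (negbTE rq) mulr0.
rewrite (big_fsetD1 q) //= big1_fset ?addr0 => [|r].
  by case: eqP; rewrite ?mcoeffUU ?mulr1 // mcoeff0 mulr0.
rewrite in_fsetD1 => /andP[rq _] _.
by case: eqP; rewrite ?mcoeff0 ?mulr0 // mcoeffU1 (negbTE rq) mulr0.
Qed.

Lemma sum_proj (I : choiceType) (s : seq I) (f : I -> nat) c : uniq s -> injective f ->
  supported (fun q => has (fun i => f i == deg q) s) c -> c = \sum_(i <- s) proj (f i) c.
Proof.
move=> us fI cs; apply/malgP => q; rewrite raddf_sum /=.
case: (boolP (q \in msupp c)) => qc; last first.
  rewrite (mcoeff_outdom qc) big1 // => i _.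
  by rewrite mcoeff_proj (mcoeff_outdom qc) if_same.
have /hasP[i is_ /eqP fi] := cs _ qc.
rewrite (bigD1_seq i) //= mcoeff_proj fi eqxx big1 ?addr0 // => j ji.
by rewrite mcoeff_proj -fi (inj_eq fI) eq_sym (negbTE ji).
Qed.

Lemma supported_proj (Q : pred word) n c : supported Q c -> supported Q (proj n c).
Proof.
move=> /supportedP cQ; apply/supportedP => q qQ.
by rewrite mcoeff_proj cQ // if_same.
Qed.

(* The scalar part of a primitive element vanishes, by subtracting the other
   homogeneous components, which are primitive. *)
Lemma prim_proj0 c : prim coprodX c -> proj 0 c = 0.
Proof.
move=> cp; pose s := [fset deg q | q in msupp c]%fset.
have E : c = \sum_(i <- (0%N |` s)%fset) proj i c.
  apply: (sum_proj (f := id)) => // q qc; apply/hasP; exists (deg q) => //=.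
  by rewrite in_fset1U; apply/orP; right; apply: in_imfset.
rewrite (big_fsetD1 0%N) ?in_fset1U //= in E.
have P : prim coprodX (\sum_(i <- (0%N |` s) `\ 0%N) proj i c)%fset.
  apply: prim_sum => i; rewrite in_fsetD1 => /andP[i0 _].
  by rewrite -lt0n in i0; apply: (prim_projX charK (exist _ i i0 : posnat)).
have : prim coprodX (proj 0 c).
  have -> : proj 0 c = (-1) *: (\sum_(i <- (0%N |` s) `\ 0%N) proj i c)%fset + c.
    by apply/eqP; rewrite scaleN1r addrC eq_sym subr_eq -E.
  exact: prim_lin.
rewrite proj0E /prim; set k := c@_mone.
rewrite (linearZ_of (f := coprodX)); last exact: linearP.
rewrite coprodX1 tenZl tenZr ten11 => /(congr1 (mcoeff mone)).
rewrite mcoeffD !mcoeffZ mcoeffUU mulr1 => /eqP.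
by rewrite -subr_eq0 opprD addrA subrr sub0r oppr_eq0 => /eqP->; rewrite scale0r.
Qed.

Lemma actw_unshuffle_perm u (q : word) : supported
  (fun r : word => perm_eq (r : seq posnat) (q : seq posnat)) (actw unshuffle u << q >>).
Proof.
elim: u q => [|n u IH] q.
  rewrite /= mcoeffU1; case: eqP => [->|_]; last by rewrite scale0r; apply: supported0.
  by rewrite scale1r; apply: supportedU.
rewrite actw_mask big_seq; apply: supported_sum => m _ /bits_size/comask_perm pm.
apply: (supportedM (Q := pred1 (FMonom (mask m q))) _ (IH _)).
  rewrite projU; case: eqP => _; last exact: supported0.
  by apply: supportedU; rewrite /= eqxx.
move=> r t /eqP-> rt; rewrite fmM /= -(perm_cat2l (mask m (q : seq posnat))) in rt *.
exact: perm_trans rt pm.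
Qed.

Lemma act_unshuffle_supported (Q : pred word) a c :
  (forall p q : word, perm_eq (p : seq posnat) (q : seq posnat) -> Q p = Q q) ->
  supported Q c -> supported Q (act unshuffle a c).
Proof.
move=> QP cQ; rewrite /act; apply: (@supported_mlin _ _ _ predT) => // u _.
rewrite -[c]mlin_id (linear_mlin _ _ (@actw_linear K unshuffle _)).
apply: (supported_mlin cQ) => q qQ; apply: sub_supported (@actw_unshuffle_perm _ q).
by move=> r /QP ->.
Qed.

Lemma odd_word_perm (p q : word) :
  perm_eq (p : seq posnat) (q : seq posnat) -> odd_word p = odd_word q.
Proof. by move=> pq; apply: perm_all; apply: perm_map. Qed.

Section Gamma.
Variables (gamma : posnat -> KS) (gammaL : Lie_series gamma).
Hypothesis gammaP : forall n : posnat, odd (val n) -> peak_comp (val n) (gamma n).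
Local Notation gc := (gcoord gamma).
Local Notation G := (lift gc).

Definition psi c : KS := X (G c).

Lemma psi_is_linear : linear psi.
Proof. by move=> a c d; rewrite /psi !linearP. Qed.

HB.instance Definition _ := GRing.isLinear.Build K A KS *:%R psi psi_is_linear.

Lemma lift_gcoord_inj : injective G.
Proof. exact: (lift_injective (@gcoord_homog _ _ gammaL) (@gcoord_lead_neq0 _ charK _ gammaL)). Qed.

Lemma psi_inj : injective psi.
Proof. by move=> c d /(@X_inj K)/lift_gcoord_inj. Qed.

Lemma psi1 : psi 1 = star_one K.
Proof. by rewrite /psi lift1 X1. Qed.

Lemma psiM c d : psi (c * d) = star (psi c) (psi d).
Proof. by rewrite /psi lift_morph starE. Qed.

Lemma psiE c : psi c = mlin (gammaW gamma) c.
Proof. by rewrite mlin_gammaW. Qed.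

Lemma psiU n : psi << fmu n >> = gamma n.
Proof. by rewrite /psi liftE gwordU -gammaE. Qed.

Lemma psi_homogeneous n c : homog n c -> homogeneous n (psi c).
Proof. by move=> cn; apply/homogeneous_X/lift_homog => //; apply: gcoord_homog. Qed.

Lemma peak_algP x : peak_alg x <-> exists2 c, supported odd_word c & x = psi c.
Proof.
split=> [[s [y ys ->]]|[c cO ->]].
  rewrite big_seq; apply: (big_ind (fun x => exists2 c, supported odd_word c & x = psi c)).
  - by exists 0; [apply: supported0|rewrite linear0].
  - move=> _ _ [c cO ->] [d dO ->]; exists (c + d); last by rewrite linearD.
    exact: supportedD.
  - by move=> n /ys/(peak_comp_lift charK gammaL gammaP)[c [_ cO ->]]; exists c.
exists [fset deg q | q in msupp c]%fset, (fun n => psi (proj n c)).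
  move=> n _; apply: (lift_peak gammaL gammaP); first exact: proj_homog.
  exact: supported_proj.
rewrite -linear_sum /=; congr psi.
apply: (sum_proj (f := id)) => // q qc; apply/hasP; exists (deg q) => //=.
exact: in_imfset.
Qed.

Lemma prim_lift_proj (n : posnat) c : prim coprodX (G c) -> prim unshuffle (proj (val n) c).
Proof.
move=> Gp; apply: (prim_lift_homog charK gammaL (n := n)); first exact: proj_homog.
by rewrite -(lift_proj (@gcoord_homog _ _ gammaL)); apply: prim_projX.
Qed.

Lemma prim_lift_sum c : prim coprodX (G c) -> exists s : {fset posnat},
  c = \sum_(i <- s) proj (val i) c.
Proof.
move=> Gp; pose n1 : posnat := exist _ 1%N isT.
exists [fset insubd n1 (deg q) | q in msupp c]%fset.
apply: (sum_proj (f := val)) => [||q qc]; [exact: fset_uniq|exact: val_inj|].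
have q0 : (0 < deg q)%N.
  rewrite lt0n; apply: contraTneq qc => q0; rewrite -mcoeff_eq0.
  have -> : c@_q = (proj 0 c)@_q by rewrite mcoeff_proj q0.
  apply/eqP; transitivity ((0 : A)@_q); last exact: mcoeff0.
  congr (_@__); apply: lift_gcoord_inj; rewrite linear0 -(lift_proj (@gcoord_homog _ _ gammaL)).
  exact: prim_proj0.
apply/hasP; exists (insubd n1 (deg q)); last by rewrite val_insubd q0.
exact: in_imfset.
Qed.

Lemma primitive_peakP x : primitive (@peak_alg K) x <->
  exists c, [/\ supported odd_word c, prim unshuffle c & x = psi c].
Proof.
split=> [xP|[c [cO cp ->]]]; last first.
  by apply/primitive_X; split; [apply/peak_algP; exists c|apply: lift_prim => //; apply: gcoord_prim].
have [/peak_algP[c cO xE] _] := xP; exists c; split=> //.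
move: xP; rewrite xE => /primitive_X[_ Gp].
have [s ->] := prim_lift_sum Gp; apply: prim_sum => i _; exact: prim_lift_proj.
Qed.

Lemma inner_imageP (n : posnat) x : inner_image (gamma n) (peak_comp (val n)) x <->
  exists c, [/\ homog (val n) c, supported odd_word c, prim unshuffle c & x = psi c].
Proof.
have hom := @gcoord_homog _ _ gammaL; have prm := gcoord_prim charK gammaL.
split=> [[y /(peak_comp_lift charK gammaL gammaP)[c [cn cO ->]] ->]|[c [cn cO cp ->]]].
  rewrite (gammaE gammaL) inner_act (act_lift hom prm); set d := act _ _ _.
  have dn : homog (val n) d.
    apply: act_unshuffle_supported => // p q pq; rewrite /deg /letters.
    by rewrite !sumnE !big_map (perm_big _ pq).
  exists d; split=> //.
    by apply: act_unshuffle_supported => //; apply: odd_word_perm.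
  apply: (prim_lift_homog charK gammaL dn); rewrite -(act_lift hom prm).
  exact: act_gcoord_prim.
exists (psi ((val n)%:R^-1 *: c)).
  by apply: (lift_peak gammaL gammaP); apply: supportedZ.
rewrite (gammaE gammaL) /psi inner_act; congr (mlin _ _).
rewrite (@act_gcoord_prim_id _ charK _ gammaL).
- rewrite -(linearZ_of (f := G)); last exact: linearP.
  by rewrite scalerA mulfV ?scale1r // posnat_neq0.
- by apply: (lift_prim prm); apply: primZ.
- by apply: lift_homog => //; apply: supportedZ.
Qed.

Lemma primitive_direct_sum : is_direct_sum (primitive (@peak_alg K))
  (fun n : posnat => inner_image (gamma n) (peak_comp (val n))).
Proof.
split=> [x|s y yS y0 i is_].
  split=> [xP|[s [y ys ->]]]; last first.
    rewrite big_seq; apply: (big_ind (primitive (@peak_alg K))).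
    - apply/primitive_peakP; exists 0; split; [exact: supported0|exact: prim0|by rewrite linear0].
    - move=> _ _ /primitive_peakP[c [cO cp ->]] /primitive_peakP[d [dO dp ->]].
      apply/primitive_peakP; exists (c + d); split; last by rewrite linearD.
        exact: supportedD.
      by rewrite -[c]scale1r; apply: prim_lin.
    - move=> n /ys/inner_imageP[c [_ cO cp ->]]; apply/primitive_peakP.
      by exists c.
  have [c [cO _ xE]] := (primitive_peakP x).1 xP.
  move: xP; rewrite xE => /primitive_X[_ Gp].
  have [s sE] := prim_lift_sum Gp; exists s, (fun i => psi (proj (val i) c)).
    move=> i _; apply/inner_imageP; exists (proj (val i) c); split=> //.
    - exact: proj_homog.
    - exact: supported_proj.
    - exact: prim_lift_proj.
  by rewrite -linear_sum /= -sE.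
have yh j : j \in s -> homogeneous (val j) (y j).
  by move=> /yS/inner_imageP[c [cn _ _ ->]]; apply: psi_homogeneous.
apply/malgP => g; rewrite mcoeff0; case: (eqVneq (tag g) (val i)) => [gi|gi]; last first.
  by apply: mcoeff_outdom; apply: contra gi => /(yh _ is_)/eqP.
have := congr1 (mcoeff g) y0; rewrite raddf_sum mcoeff0 (big_fsetD1 i) //=.
rewrite big1_fset ?addr0 // => j; rewrite in_fsetD1 => /andP[ji js] _.
apply: mcoeff_outdom; apply: contra ji => /(yh _ js) gj.
by apply/eqP/val_inj; rewrite -gj -gi.
Qed.

Lemma peak_alg_basis : is_basis (@peak_alg K) odd_word
  (fun q => (qfact q)%:R^-1 *: gammaW gamma q).
Proof.
pose e q := (qfact q)%:R^-1 *: gammaW gamma q.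
pose sc (k : word -> K) : A -> A := mlin (fun q => k q *: << q >>).
have scO k c : supported odd_word c -> supported odd_word (sc k c).
  by move=> cO; apply: (supported_mlin cO) => q qO; apply/supportedZ/supportedU.
have eE c : mlin e c = psi (sc (fun q => (qfact q)%:R^-1) c).
  rewrite (mlin_comp psi) /=; apply: eq_mlin => q.
  by rewrite linearZ /= psiE mlinE1.
have scK c : sc (fun q => (qfact q)%:R) (sc (fun q => (qfact q)%:R^-1) c) = c.
  rewrite /sc (mlin_comp (mlin _)) /= -[RHS]mlin_id; apply: eq_mlin => q.
  rewrite (linearZ_of (f := mlin (fun q => (qfact q)%:R *: << q >>))); last exact: linearP.
  by rewrite mlinE1 scalerA mulVf ?scale1r // qfact_neq0.
have scK' c : sc (fun q => (qfact q)%:R^-1) (sc (fun q => (qfact q)%:R) c) = c.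
  rewrite /sc (mlin_comp (mlin _)) /= -[RHS]mlin_id; apply: eq_mlin => q.
  rewrite (linearZ_of (f := mlin (fun q => (qfact q)%:R^-1 *: << q >>))); last exact: linearP.
  by rewrite mlinE1 scalerA mulfV ?scale1r // qfact_neq0.
split=> [x|c cO c0].
  split=> [/peak_algP[c cO ->]|[c cO ->]].
    by exists (sc (fun q => (qfact q)%:R) c); [apply: scO|rewrite eE scK'].
  by apply/peak_algP; exists (sc (fun q => (qfact q)%:R^-1) c); [apply: scO|rewrite -eE].
have : psi (sc (fun q => (qfact q)%:R^-1) c) = psi 0 by rewrite -eE linear0.
by move/psi_inj => E; rewrite -(scK c) E /sc linear0.
Qed.

Lemma peak_alg_iso : alg_iso_on (@star K) (star_one K) (fun a : A => supported odd_word a)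
  (@peak_alg K) (mlin (gammaW gamma)).
Proof.
split.
- by move=> a c d _ _; rewrite linearP.
- by rewrite -psiE psi1.
- by move=> c d _ _; rewrite -!psiE psiM.
- by move=> c d _ _; rewrite -!psiE; apply: psi_inj.
by move=> x; split=> [/peak_algP[c cO ->]|[c cO ->]];
  [exists c; rewrite -?psiE|apply/peak_algP; exists c; rewrite -?psiE].
Qed.

End Gamma.
End PeakAlgebra.

Section LinearOn.
Variables (K : fieldType) (V U : lmodType K) (L : V -> Prop) (f : V -> U).
Hypotheses (Ls : subspace L) (fL : linear_on L f).

Lemma linear_on0 : f 0 = 0.
Proof.
by have := fL (-1) Ls.1 Ls.1; rewrite scaler0 addr0 scaleN1r addNr.
Qed.

Lemma linear_on_mlin (J : choiceType) (b : J -> V) c : (forall j, j \in msupp c -> L (b j)) ->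
  L (mlin b c) /\ f (mlin b c) = mlin (fun j => f (b j)) c.
Proof.
move=> Lb; rewrite /mlin [X in L X]big_seq [X in f X]big_seq [RHS]big_seq.
apply: (big_rec2 (fun x y => L x /\ f x = y)) => [|j y x jc [Lx <-]].
  by split; [exact: Ls.1|exact: linear_on0].
by split; [apply: Ls.2|rewrite fL] => //; apply: Lb.
Qed.

End LinearOn.

Lemma eq_linear_on (K : fieldType) (V U : lmodType K) (L : V -> Prop) (f g : V -> U)
    (J : choiceType) (b : J -> V) (c : {malg K[J]}) :
  subspace L -> linear_on L f -> linear_on L g ->
  (forall j, j \in msupp c -> L (b j) /\ f (b j) = g (b j)) -> f (mlin b c) = g (mlin b c).
Proof.
move=> Ls fL gL fg; have Lb j : j \in msupp c -> L (b j) by move=> /fg[].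
have [_ ->] := linear_on_mlin Ls fL Lb; have [_ ->] := linear_on_mlin Ls gL Lb.
by apply: eq_in_mlin => j /fg[].
Qed.

Lemma eq_bilinear (K : fieldType) (V U : lmodType K) (f g : V -> V -> U)
    (J : choiceType) (b : J -> V) (c d : {malg K[J]}) :
  (forall z, linear (f^~ z)) -> (forall z, linear (f z)) ->
  (forall z, linear (g^~ z)) -> (forall z, linear (g z)) ->
  (forall j k, j \in msupp c -> k \in msupp d -> f (b j) (b k) = g (b j) (b k)) ->
  f (mlin b c) (mlin b d) = g (mlin b c) (mlin b d).
Proof.
move=> fl fr gl gr fg.
apply: etrans (linear_mlin (f := fun x => f x (mlin b d)) b c (fl _)) _.
apply: etrans (esym (linear_mlin (f := fun x => g x (mlin b d)) b c (gl _))).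
apply: eq_in_mlin => j jc.
rewrite (linear_mlin (f := f (b j)) b d (fr _)) (linear_mlin (f := g (b j)) b d (gr _)).
by apply: eq_in_mlin => k kd; apply: fg.
Qed.

Section PrimitiveLie.
Variables (K : fieldType) (charK : [pchar K] =i pred0).
Notation A := {malg K[word]}.
Notation KS := {malg K[gperm]}.
Local Notation unshuffle := (@unshuffle K).
Local Notation comm := (@comm K).
Implicit Types c d : A.

Lemma prim_odd_lyndon c : supported odd_word c -> prim unshuffle c ->
  exists2 d, supported (fun w => lyndonw w && odd_word w) d & c = mlin (lyn_elt K) d.
Proof.
move=> cO cp; have [d dL cE] := prim_lyndon charK cp; rewrite cE in cO.
have dO := lyn_elt_supported odd_word_perm dL cO.
by exists d => [w wd|] //; rewrite /in_mem /=; apply/andP; split; [apply: dL|apply: dO].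
Qed.

Lemma comm_linearr c : linear (comm c).
Proof.
move=> a x y; rewrite /comm mulrDr mulrDl malg_scalerAr -scalerAl scalerBr opprD.
by rewrite addrACA.
Qed.

Lemma lie_ext_commutator (M : lieAlgebra K) (h : posnat -> M) c d :
  prim unshuffle c -> prim unshuffle d ->
  lie_ext h (comm c d) = lie_bracket (lie_ext h c) (lie_ext h d).
Proof.
have ll := lie_ext_linear h.
have tree (e : A) : supported lyndonw e -> forall w, w \in msupp e -> lie_tree w (lyn_elt K w).
  by move=> eL w we; have [] := lyn_eltP K (eL _ we : lyndonw w).
move=> /(prim_lyndon charK)[c' c'L ->] /(prim_lyndon charK)[d' d'L ->].
apply: (eq_bilinear (f := fun x y => lie_ext h (comm x y))
    (g := fun x y => lie_bracket (lie_ext h x) (lie_ext h y))).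
- by move=> z a x y; rewrite comm_linearl ll.
- by move=> z a x y; rewrite comm_linearr ll.
- by move=> z a x y; rewrite ll lie_linear_l.
- by move=> z a x y; rewrite ll lie_linear_r.
move=> j k /(tree _ c'L) jT /(tree _ d'L) kT.
exact: lie_ext_comm jT kT.
Qed.

Lemma odd_wordM (u v : word) : odd_word (mmul u v) = odd_word u && odd_word v.
Proof. by rewrite /odd_word lettersM all_cat. Qed.

Lemma lie_tree_odd u (x : A) : lie_tree u x -> odd_word u -> supported odd_word x.
Proof.
move=> ux uO; apply: sub_supported (lie_tree_perm ux) => r ru.
by rewrite (odd_word_perm ru).
Qed.

Lemma words_of_degree (n : nat) : exists s : seq word, forall q, deg q = n -> q \in s.
Proof.
exists (map wd (subs (nseq n n))) => q qn.
have all_le (s : seq nat) : all (fun x => x <= sumn s)%N s.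
  by elim: s => //= x s IH; rewrite leq_addr /=; apply: sub_all IH => y; lia.
have size_le (s : seq nat) : all (ltn 0) s -> (size s <= sumn s)%N.
  by elim: s => //= x s IH /andP[x0 /IH]; lia.
apply/mapP; exists (letters q ++ nseq (n - size (letters q)) 0%N); last first.
  apply: letters_inj; rewrite letters_wd filter_cat.
  rewrite (all_filterP (all_letters q)) (_ : [seq x <- nseq _ 0%N | _] = [::]) ?cats0 //.
  by elim: (n - _)%N.
have := size_le _ (all_letters q); rewrite -/(deg q) qn => sq.
rewrite mem_subs size_cat !size_nseq subnKC // eqxx /=.
apply/(all_nthP (0, 0)%N) => i; rewrite size_zip size_cat !size_nseq subnKC // minnn => in_.
rewrite nth_zip ?size_cat ?size_nseq ?subnKC //= nth_nseq in_ nth_cat.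
case: ifP => iq; last by rewrite nth_nseq if_same.
by have /(all_nthP 0%N)/(_ i iq) := all_le (letters q); rewrite -/(deg q) qn.
Qed.

Section Gamma.
Variables (gamma : posnat -> KS) (gammaL : Lie_series gamma).
Hypothesis gammaP : forall n : posnat, odd (val n) -> peak_comp (val n) (gamma n).
Local Notation psi := (psi gamma).
Local Notation L := (primitive (@peak_alg K)).
Local Notation P := (@peak_alg K).

Definition psi_inv (x : KS) : A := classical_sets.xget 0 (fun c => psi c = x).

Lemma psiK : cancel psi psi_inv.
Proof.
by move=> c; apply: classical_sets.xget_unique => // d /(psi_inj charK gammaL).
Qed.

Lemma commutator_psi c d : Defs.commutator (@star K) (psi c) (psi d) = psi (comm c d).
Proof. by rewrite /Defs.commutator -!psiM -linearB. Qed.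

Lemma psi_alg c : supported odd_word c -> P (psi c).
Proof. by move=> cO; apply/(peak_algP charK gammaL gammaP); exists c. Qed.

Lemma psi_prim c : supported odd_word c -> prim unshuffle c -> L (psi c).
Proof. by move=> cO cp; apply/(primitive_peakP charK gammaL gammaP); exists c. Qed.

Lemma lie_tree_L u (x : A) : lie_tree u x -> odd_word u -> L (psi x).
Proof. by move=> ux uO; apply: psi_prim (lie_tree_odd ux uO) (lie_tree_prim ux). Qed.

Lemma peak_subspace : subspace P.
Proof.
split; first by rewrite -(linear0 psi); apply/psi_alg/supported0.
move=> a _ _ /(peak_algP charK gammaL gammaP)[c cO ->] /(peak_algP charK gammaL gammaP)[d dO ->].
by rewrite -linearP; apply/psi_alg/supportedD => //; apply: supportedZ.
Qed.

Lemma peak_subalgebra : subalgebra (@star K) (star_one K) P.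
Proof.
split; first exact: peak_subspace.
  by rewrite -(psi1 gamma); apply/psi_alg/supportedU; rewrite /odd_word letters1.
move=> _ _ /(peak_algP charK gammaL gammaP)[c cO ->] /(peak_algP charK gammaL gammaP)[d dO ->].
rewrite -psiM; apply/psi_alg/(supportedM cO dO) => u v uO vO.
by rewrite odd_wordM uO.
Qed.

Lemma primitive_lie_subalgebra : lie_subalgebra (@star K) L.
Proof.
split; first split.
- by rewrite -(linear0 psi); apply: psi_prim; [exact: supported0|exact: prim0].
- move=> a _ _ /(primitive_peakP charK gammaL gammaP)[c [cO cp ->]]
    /(primitive_peakP charK gammaL gammaP)[d [dO dp ->]].
  rewrite -linearP; apply: psi_prim; last exact: prim_lin.
  by apply: supportedD => //; apply: supportedZ.
move=> _ _ /(primitive_peakP charK gammaL gammaP)[c [cO cp ->]]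
    /(primitive_peakP charK gammaL gammaP)[d [dO dp ->]].
rewrite commutator_psi; apply: psi_prim; last exact: prim_comm (@unshuffleM K) cp dp.
have MO (x y : A) : supported odd_word x -> supported odd_word y -> supported odd_word (x * y).
  by move=> xO yO; apply: (supportedM xO yO) => u v uO vO; rewrite odd_wordM uO.
by apply: supportedB; apply: MO.
Qed.

Lemma gamma_L (n : posnat) : odd (val n) -> L (gamma n).
Proof.
move=> nO; rewrite -(psiU gammaL); apply: (lie_tree_L (LieLetter K n)).
by rewrite /odd_word lettersU /= nO.
Qed.

Lemma eq_primitive (U : lmodType K) (f g : KS -> U) : linear_on L f -> linear_on L g ->
  (forall u x, lie_tree u x -> odd_word u -> f (psi x) = g (psi x)) ->
  forall x, L x -> f x = g x.
Proof.
move=> fL gL fg x /(primitive_peakP charK gammaL gammaP)[c [cO cp ->]].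
have [d dL ->] := prim_odd_lyndon cO cp; rewrite (mlin_comp psi) /=.
apply: (eq_linear_on primitive_lie_subalgebra.1 fL gL) => w wd.
have /andP[wL wO] : lyndonw w && odd_word w := dL _ wd; have [wT _] := lyn_eltP K wL.
by split; [apply: lie_tree_L wT wO|apply: fg wT wO].
Qed.

Lemma lie_hom_eq (M : lmodType K) (br : M -> M -> M) (f g : KS -> M) :
  lie_hom_on (@star K) L br f -> lie_hom_on (@star K) L br g ->
  (forall n : posnat, odd (val n) -> f (gamma n) = g (gamma n)) ->
  forall x, L x -> f x = g x.
Proof.
move=> [fl fM] [gl gM] fg; apply: eq_primitive => // u x; elim=> [n|v w y z vy IHy wz IHz].
  by rewrite /odd_word lettersU /= andbT psiU // => /fg.
rewrite odd_wordM => /andP[vO wO]; rewrite -commutator_psi.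
have Ly := lie_tree_L vy vO; have Lz := lie_tree_L wz wO.
by rewrite fM // gM // IHy // IHz.
Qed.

Lemma primitive_free : freely_generated (@star K) L (fun n : posnat => odd (val n)) gamma.
Proof.
split; [exact: primitive_lie_subalgebra|exact: gamma_L|move=> M h].
have hom : lie_hom_on (@star K) L (@lie_bracket K M) (fun x => lie_ext h (psi_inv x)).
  split=> [a _ _|_ _] /(primitive_peakP charK gammaL gammaP)[c [cO cp ->]]
    /(primitive_peakP charK gammaL gammaP)[d [dO dp ->]].
    by rewrite -linearP !psiK lie_ext_linear.
  by rewrite commutator_psi !psiK lie_ext_commutator.
have ext (n : posnat) : lie_ext h (psi_inv (gamma n)) = h n.
  by rewrite -(psiU gammaL) psiK lie_extU.
exists (fun x => lie_ext h (psi_inv x)); split=> // f' f'hom f'g.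
by apply: (lie_hom_eq f'hom hom) => n nO; rewrite f'g // ext.
Qed.

Lemma peak_enveloping : is_enveloping_algebra (@star K) (star_one K) L P.
Proof.
split; [exact: peak_subalgebra|exact: primitive_lie_subalgebra|by move=> x []|move=> B f fhom].
pose F x := lift (fun n => f (gamma n)) (psi_inv x).
have [Ps _ _] := peak_subalgebra.
have Fhom : alg_hom_on (@star K) (star_one K) P F.
  split.
  - move=> a _ _ /(peak_algP charK gammaL gammaP)[c _ ->] /(peak_algP charK gammaL gammaP)[d _ ->].
    by rewrite -linearP /F !psiK linearP.
  - by rewrite -(psi1 gamma) /F psiK lift1.
  move=> _ _ /(peak_algP charK gammaL gammaP)[c _ ->] /(peak_algP charK gammaL gammaP)[d _ ->].
  rewrite -psiM /F !psiK liftM // => a x y; exact: esym (scalerAr a x y).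
have FP (n : posnat) : F (gamma n) = f (gamma n).
  by rewrite -{1}(psiU gammaL) /F psiK liftE gwordU.
have [Fl F1 FM] := Fhom.
have FL : lie_hom_on (@star K) L (fun u v : B => u * v - v * u) F.
  split=> [a x y [Px _] [Py _]|x y [Px _] [Py _]]; first exact: Fl.
  have PM := peak_subalgebra; case: PM => _ _ PM.
  rewrite -(FM x y Px Py) -(FM y x Py Px) /Defs.commutator.
  have -> : star x y - star y x = (-1) *: star y x + star x y by rewrite scaleN1r addrC.
  by rewrite Fl ?scaleN1r 1?addrC //; apply: PM.
exists F; split=> //; first by apply: (lie_hom_eq FL fhom) => n _; apply: FP.
move=> F' [F'l F'1 F'M] F'f x /(peak_algP charK gammaL gammaP)[c cO ->].
rewrite -[c]mlin_id (mlin_comp psi) /=; apply: (eq_linear_on Ps F'l Fl) => q /cO qO.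
split; first exact/psi_alg/supportedU.
have : odd_word q by [].
elim/word_ind: q {qO} => [_|n q IH]; first by rewrite psi1 F'1 F1.
rewrite odd_wordM => /andP[nO qO]; rewrite -malgUM psiM psiU //.
have nO' : odd (val n) by move: nO; rewrite /odd_word lettersU /= andbT.
have Pn : P (gamma n) by case: (gamma_L nO').
have Pq : P (psi << q >>) by apply/psi_alg/supportedU.
by rewrite F'M // FM // IH // F'f ?FP //; apply: gamma_L.
Qed.

Lemma primitive_dim (n : posnat) (lyn : seq word) : uniq lyn ->
  (forall q, (q \in lyn) = [&& lyndonw q, odd_word q & deg q == val n]) ->
  has_dim (inner_image (gamma n) (peak_comp (val n))) (size lyn).
Proof.
move=> ul lynE; pose w (i : 'I_(size lyn)) := nth mone lyn i.
have wl i : w i \in lyn by apply: mem_nth.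
pose idx q : {malg K['I_(size lyn)]} := if insub (index q lyn) is Some i then << i >> else 0.
have idxK i : idx (w i) = << i >>.
  rewrite /idx index_uniq // insubT //= => il; congr << _ >>; exact: val_inj.
have KidxE q : q \in lyn -> mlin (fun i => << w i >>) (idx q) = << q >> :> A.
  move=> ql; rewrite /idx; case: insubP => [i _ iE|]; last by rewrite index_mem ql.
  by rewrite mlinE1 /w iE nth_index.
exists (fun i => psi (lyn_elt K (w i))).
have bE (c : {malg K['I_(size lyn)]}) : mlin (fun i => psi (lyn_elt K (w i))) c =
    psi (mlin (lyn_elt K) (mlin (fun i => << w i >>) c)).
  rewrite (mlin_comp (mlin _)) /= (mlin_comp psi) /=.
  by apply: eq_mlin => i; rewrite mlinE1.
have cL (c : {malg K['I_(size lyn)]}) : supported (mem lyn) (mlin (fun i => << w i >> : A) c).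
  by apply: (@supported_mlin _ _ _ predT) => // i _; apply/supportedU/wl.
have lynL d : supported (mem lyn) d -> supported lyndonw d.
  by apply: sub_supported => q; rewrite /= lynE => /and3P[].
split=> [x|c _ c0]; last first.
  rewrite bE -(linear0 psi) in c0; have := psi_inj charK gammaL c0.
  rewrite -[X in _ = X](linear0 (mlin (lyn_elt K))).
  move/(lyn_elt_inj (lynL _ (cL c)) (@supported0 _ _ _)) => c00.
  have := congr1 (mlin idx) c00; rewrite linear0 (mlin_comp (mlin idx)) /= => E.
  rewrite -[c]mlin_id -E; apply: eq_mlin => i; rewrite mlinE1 idxK.
  by [].
split=> [/(inner_imageP charK gammaL gammaP)[c [cn cO cp ->]]|[c _ ->]]; last first.
  apply/(inner_imageP charK gammaL gammaP); rewrite bE; set d := mlin _ c.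
  have dlyn : supported (mem lyn) d := cL c.
  have tr q : q \in lyn -> [/\ lie_tree q (lyn_elt K q), odd_word q & deg q = val n].
    by rewrite lynE => /and3P[/(lyn_eltP K)[qT _] qO /eqP qn].
  exists (mlin (lyn_elt K) d); split=> //.
  - by apply: (supported_mlin dlyn) => q /tr[qT _ <-]; apply: lie_tree_homog.
  - by apply: (supported_mlin dlyn) => q /tr[qT qO _]; apply: lie_tree_odd qT qO.
  - by apply: (prim_mlin dlyn) => q /tr[/lie_tree_prim].
have [d dL cE] := prim_lyndon charK cp; rewrite cE in cO cn.
have dO := lyn_elt_supported odd_word_perm dL cO.
have degP (p q : word) : perm_eq (p : seq posnat) (q : seq posnat) ->
    (deg p == val n) = (deg q == val n).
  by move=> pq; rewrite /deg /letters !sumnE !big_map (perm_big _ pq).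
have dn := lyn_elt_supported degP dL cn.
have dl q : q \in msupp d -> q \in lyn.
  by move=> qd; rewrite lynE; apply/and3P; split; [apply: dL|apply: dO|apply: dn].
exists (mlin idx d); first by [].
rewrite bE cE (mlin_comp (mlin (fun i => << w i >>))) /= -{1}[d]mlin_id.
by congr (psi (mlin _ _)); apply: eq_in_mlin => q /dl/KidxE.
Qed.

End Gamma.
End PrimitiveLie.

Theorem theorem7 (K : fieldType) (charK : [pchar K] =i pred0)
    (gamma : posnat -> KS K) (gammaL : Lie_series gamma)
    (gammaP : forall n : posnat, odd (val n) -> peak_comp (val n) (gamma n)) :
  [/\ is_basis (@peak_alg K) odd_word
        (fun q => (qfact q)%:R^-1 *: gammaW gamma q)
      /\ (forall q, odd_word q ->
            let e := (qfact q)%:R^-1 *: gammaW gamma q in inner e e = e),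
      alg_iso_on (@star K) (star_one K) (fun a : {malg K[word]} =>
          supported odd_word a)
        (@peak_alg K) (mlin (gammaW gamma)),
      is_direct_sum (primitive (@peak_alg K))
        (fun n : posnat => inner_image (gamma n) (peak_comp (val n))),
      freely_generated (@star K) (primitive (@peak_alg K))
        (fun n : posnat => odd (val n)) gamma
      /\ is_enveloping_algebra (@star K) (star_one K)
           (primitive (@peak_alg K)) (@peak_alg K)
    & forall n : posnat, exists lyn : seq word,
        [/\ uniq lyn,
            forall q, (q \in lyn) = [&& lyndon (letters q), odd_word q
                                      & sumn (letters q) == val n]
          & has_dim (inner_image (gamma n) (peak_comp (val n))) (size lyn)]].
Proof.
split.
- split; first exact: peak_alg_basis.
  by move=> q _; apply: gammaW_idempotent.
- exact: peak_alg_iso.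
- exact: primitive_direct_sum.
- split; [exact: (primitive_free charK gammaL gammaP)|].
  exact: (peak_enveloping charK gammaL gammaP).
move=> n; have [s sP] := words_of_degree (val n).
have lynE q : (q \in undup [seq q <- s | [&& lyndonw q, odd_word q & deg q == val n]]) =
    [&& lyndonw q, odd_word q & deg q == val n].
  by rewrite mem_undup mem_filter; case: and3P => // -[_ _ /eqP/sP ->].
exists (undup [seq q <- s | [&& lyndonw q, odd_word q & deg q == val n]]).
by split; [exact: undup_uniq|exact: lynE|apply: primitive_dim (undup_uniq _) lynE].
Qed.
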